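(* Let $T_m$ be a pseudo-multiplier with symbol $m$ defined on $\mathbb{R}^n\times\mathbb{N}_0^n$, that is, $$T_mf(x)=\sum_{\nu\in\mathbb{N}_0^n}m(x,\nu)\,\widehat{f}(\phi_\nu)\,\phi_\nu(x),\qquad f\in \mathrm{Dom}(T_m),\qquad \widehat{f}(\phi_\nu)=\langle f,\phi_\nu\rangle_{L^2},$$ where $\{\phi_\nu\}_{\nu\in\mathbb{N}_0^n}$ are the normalized Hermite functions on $\mathbb{R}^n$. Then the following hold. (1) $T_m$ is a Hilbert-Schmidt operator on $L^2(\mathbb{R}^n)$, i.e. $T_m\in S_2(L^2)$, if and only if $$\sum_{\nu\in\mathbb{N}_0^n}\int_{\mathbb{R}^n}|m(x,\nu)|^2\phi_\nu(x)^2\,dx<\infty .$$ (2) If $T_m$ is a positive and self-adjoint operator, then $T_m$ is trace class, i.e. $T_m\in S_1(L^2)$, if and only if $$\sum_{\nu\in\mathbb{N}_0^n}\int_{\mathbb{R}^n}m(x,\nu)\phi_\nu(x)^2\,dx<\infty .$$ (3) $T_m\in S_r(L^2)$, $0<r\le 1$, if $$\sum_{\nu\in\mathbb{N}_0^n}\left(\int_{\mathbb{R}^n}|m(x,\nu)|^2\phi_\nu(x)^2\,dx\right)^{\frac r2}<\infty .$$ (4) If $1<r<2$ and there exists $\sigma>n\left(\frac1r-\frac12\right)$ such that $$\sum_{\nu\in\mathbb{N}_0^n}|\nu|^{2\sigma}\int_{\mathbb{R}^n}|m(x,\nu)|^2\phi_\nu(x)^2\,dx<\infty ,$$ then $T_m\in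 S_r(L^2)$.
   Context: $\mathbb{N}_0=\{0,1,2,\dots\}$, and for $\nu=(\nu_1,\dots,\nu_n)\in\mathbb{N}_0^n$, $|\nu|=\nu_1+\cdots+\nu_n$. $\langle\cdot,\cdot\rangle_{L^2}$ is the inner product of $L^2=L^2(\mathbb{R}^n)$. Hermite functions: for $x=(x_1,\dots,x_n)\in\mathbb{R}^n$, $\phi_\nu(x)=\prod_{j=1}^n\phi_{\nu_j}(x_j)$, where $\phi_{\nu_j}(x_j)=(2^{\nu_j}\nu_j!\sqrt{\pi})^{-1/2}H_{\nu_j}(x_j)e^{-x_j^2/2}$ and $H_{\nu_j}$ is the Hermite polynomial of order $\nu_j$. The family $\{\phi_\nu\}_{\nu\in\mathbb{N}_0^n}$ is a complete orthonormal system in $L^2(\mathbb{R}^n)$. Pseudo-multiplier: the linear operator $T_m$ associated by the displayed formula to a function $m$ on $\mathbb{R}^n\times\mathbb{N}_0^n$, called its symbol; $\mathrm{Dom}(T_m)$ denotes the domain of $T_m$, which is not specified further. Schatten classes: a linear operator $T$ on a Hilbert space $H$ belongs to the Schatten class $S_r(H)$ of order $r$ if $\sum_{k}\lambda_k(T)^r<\infty$, where $\{\lambda_k(T)\}$ is the sequence of singular values of $T$, i.e. the eigenvalues of $\sqrt{T^*T}$. $S_2$ is the class of Hilbert-Schmidt operators and $S_1$ is the trace class. *)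

(* Defs.v *)
From HB Require Import structures.
From mathcomp Require Import all_boot all_order all_algebra.
From mathcomp Require Import finmap generic_quotient ring_quotient.
From mathcomp Require Import all_classical all_reals all_analysis.
From mathcomp Require Import measurable_realfun.
From mathcomp Require Import complex ring.

Set Implicit Arguments.
Unset Strict Implicit.
Unset Printing Implicit Defensive.
Import Order.TTheory GRing.Theory Num.Theory.
Import numFieldNormedType.Exports Normc.
Local Open Scope classical_set_scope.
Local Open Scope ring_scope.

(* Lebesgue measure on R^n, the n-fold product of Lebesgue measure on R;
   R^n is carried by n-tuples with their product (Borel) sigma-algebra *)
Section LebesgueTuple.
Context {R : realType}.
Local Notation mR := (measurableTypeR R).

Definition tcons n (p : mR * n.-tuple mR) : n.+1.-tuple mR :=
  [tuple of p.1 :: p.2].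

Lemma measurable_tcons n : measurable_fun [set: mR * n.-tuple mR] (@tcons n).
Proof. exact: measurable_cons. Qed.

Section step.
Variables (n : nat) (m : {sigma_finite_measure set (n.-tuple mR) -> \bar R}).

Definition lebesgue_step : set (n.+1.-tuple mR) -> \bar R :=
  pushforward (lebesgue_measure \x m)%E (@tcons n).

Let mstep := measure_function_pushforward__canonical__measure_function_Measure
  (lebesgue_measure \x m)%E (@measurable_tcons n).

HB.instance Definition _ := isMeasure.Build _ _ _ lebesgue_step
  (measure0 mstep) (measure_ge0 mstep)
  (@measure_semi_sigma_additive _ _ _ mstep).

Lemma lebesgue_step_sigma_finite : sigma_finite setT lebesgue_step.
Proof.
have /sigma_finiteP[F [FT ndF Foo]] := sigma_finiteT (@lebesgue_measure R).
have /sigma_finiteP[G [GT ndG Goo]] := sigma_finiteT m.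
exists (fun k => [set x | F k (thead x) /\ G k [tuple of behead x]]).
  apply/esym; rewrite -subTset => x _.
  have [i _ Fi] : (\bigcup_i F i) (thead x) by rewrite -FT.
  have [j _ Gj] : (\bigcup_i G i) [tuple of behead x] by rewrite -GT.
  exists (maxn i j) => //; split.
    by move: Fi; exact/subsetPset/ndF/leq_maxl.
  by move: Gj; exact/subsetPset/ndG/leq_maxr.
move=> k; have [mF Fk] := Foo k; have [mG Gk] := Goo k; split.
  apply: measurableI; rewrite -[X in measurable X]setTI.
    exact: measurable_tnth.
  exact: measurable_behead.
rewrite /lebesgue_step /pushforward.
rewrite (_ : _ @^-1` _ = F k `*` G k); last first.
  apply/seteqP; split=> -[a t] /=; rewrite theadE;
    by rewrite (_ : [tuple of _] = t)//; apply: val_inj.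
by rewrite product_measure1E// lte_mul_pinfty// ge0_fin_numE.
Qed.

HB.instance Definition _ :=
  Measure_isSigmaFinite.Build _ _ _ lebesgue_step lebesgue_step_sigma_finite.
End step.

Fixpoint lebesgue_tuple n : {sigma_finite_measure set (n.-tuple mR) -> \bar R} :=
  match n with
  | 0 => \d_ [tuple]
  | n'.+1 => lebesgue_step (lebesgue_tuple n')
  end.

End LebesgueTuple.

Local Open Scope complex_scope.

Section L2.
Context d (T : measurableType d) (R : realType).
Variable mu : {measure set T -> \bar R}.
Local Notation C := R[i].
Local Notation Re := (@complex.Re R).
Local Notation Im := (@complex.Im R).
Implicit Types f g : T -> C^o.

Definition cmeasurable f :=
  measurable_fun setT (fun x => Re (f x)) /\
  measurable_fun setT (fun x => Im (f x)).

Definition cintegral f : C :=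
  (\int[mu]_x Re (f x)) +i* (\int[mu]_x Im (f x)).

Definition inner f g : C := cintegral (fun x => f x * (g x)^*).

Definition sqnorm f : \bar R := (\int[mu]_x ((normc (f x)) ^+ 2)%:E)%E.

Definition sqint : {pred T -> C^o} :=
  mem [set f | cmeasurable f /\ (sqnorm f < +oo)%E].

Lemma normc_sqr (z : C) : normc z ^+ 2 = Re z ^+ 2 + Im z ^+ 2.
Proof. by case: z => a b /=; rewrite sqr_sqrtr// addr_ge0// sqr_ge0. Qed.

Lemma measurable_normc_sqr f :
  cmeasurable f ->
  measurable_fun setT (EFin \o (fun x => normc (f x) ^+ 2)).
Proof.
move=> [mr mi]; apply/measurable_EFinP.
under eq_fun do rewrite normc_sqr.
by apply: measurable_funD; exact: measurable_funX.
Qed.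

Lemma sqint_submod : submod_closed sqint.
Proof.
split.
  rewrite inE; split; first by split; exact: measurable_cst.
  rewrite /sqnorm (eq_integral (cst 0%E)) ?integral0// => x _.
  by rewrite [X in normc X](_ : _ = 0)// normc0 expr0n.
move=> a f g; rewrite !inE => -[[fr fi] fo] [[gr gi] go].
have mfg : cmeasurable (a *: f + g).
  split.
    rewrite (_ : (fun x => _) = (fun x => Re a * Re (f x) - Im a * Im (f x)
      + Re (g x))).
      apply: measurable_funD => //; apply: measurable_funB;
      exact: measurable_funM.
    apply/funext => x; rewrite /GRing.scale/= /GRing.add/=.
    by case: a (f x) (g x) => [a1 a2] [f1 f2] [g1 g2].
  rewrite (_ : (fun x => _) = (fun x => Re a * Im (f x) + Im a * Re (f x)
    + Im (g x))).
    apply: measurable_funD => //; apply: measurable_funD;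
    exact: measurable_funM.
  apply/funext => x; rewrite /GRing.scale/= /GRing.add/=.
  by case: a (f x) (g x) => [a1 a2] [f1 f2] [g1 g2].
split=> //.
have mE (h : T -> C^o) k : cmeasurable h ->
    measurable_fun setT (fun x => k%:E * (normc (h x) ^+ 2)%:E)%E.
  by move=> mh; apply: measurable_funeM; exact: measurable_normc_sqr.
have k0 : 0 <= 2 * normc a ^+ 2 by rewrite mulr_ge0// sqr_ge0.
apply: (@le_lt_trans _ _ (\int[mu]_x
   ((2 * normc a ^+ 2)%:E * (normc (f x) ^+ 2)%:E
     + 2%:E * (normc (g x) ^+ 2)%:E))%E).
  apply: ge0_le_integral => //.
  - by move=> x _; rewrite lee_fin sqr_ge0.
  - exact: measurable_normc_sqr.
  - by apply: emeasurable_funD; exact: mE.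
  - move=> x _; rewrite -!EFinM -EFinD lee_fin -mulrA -exprMn -normcM.
    rewrite !normc_sqr (_ : (a *: f + g) x = a * f x + g x)// -!mulrDr.
    case: (a * f x) (g x) => [u v] [w z] /=.
    rewrite -subr_ge0 [leRHS](_ : _ = (u - w) ^+ 2 + (v - z) ^+ 2).
      by rewrite addr_ge0// sqr_ge0.
    by ring.
rewrite ge0_integralD//=; last 4 first.
- by move=> x _; rewrite -EFinM lee_fin mulr_ge0// sqr_ge0.
- exact: mE.
- by move=> x _; rewrite -EFinM lee_fin mulr_ge0// sqr_ge0.
- exact: mE.
rewrite !ge0_integralZl_EFin//; try by move=> x _; rewrite lee_fin sqr_ge0.
- by rewrite lte_add_pinfty// lte_mul_pinfty// lee_fin.
- exact: measurable_normc_sqr.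
- exact: measurable_normc_sqr.
Qed.

HB.instance Definition _ := GRing.isSubmodClosed.Build _ _ sqint sqint_submod.

Record sqfun := Sqfun { sqfun_val :> T -> C^o; _ : sqfun_val \in sqint }.

HB.instance Definition _ := [isSub for sqfun_val].
HB.instance Definition _ := [Choice of sqfun by <:].
HB.instance Definition _ := [SubChoice_isSubLmodule of sqfun by <:].

Definition ae_null : {pred sqfun} :=
  mem [set f : sqfun | {ae mu, forall x, f x = 0}].

Lemma ae_null_zmod : zmod_closed ae_null.
Proof.
split=> [|f g]; rewrite !inE; first exact/aeW.
move=> f0 g0; near=> x.
have fx : f x = 0 by near: x.
have gx : g x = 0 by near: x.
by rewrite (_ : (f - g) x = f x - g x)// fx gx subr0.
Unshelve. all: by end_near. Qed.

HB.instance Definition _ := GRing.isZmodClosed.Build _ ae_null ae_null_zmod.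

Local Open Scope quotient_scope.

(* square-integrable functions modulo equality almost everywhere *)
Definition L2 : Type := Quotient.quot ae_null.
HB.instance Definition _ := EqQuotient.on L2.
HB.instance Definition _ := Choice.on L2.
HB.instance Definition _ := GRing.Zmodule.on L2.

Definition L2_fun (u : L2) : T -> C := repr u : sqfun.
Coercion L2_fun : L2 >-> Funclass.

Definition L2_class (f : sqfun) : L2 := \pi_(Quotient.quot ae_null) f.

Lemma L2_classK (u : L2) : L2_class (repr u) = u.
Proof. exact: reprK. Qed.

Lemma L2_classP (f g : sqfun) :
  L2_class f = L2_class g <-> {ae mu, forall x, f x = g x}.
Proof.
have -> : (L2_class f = L2_class g) <-> (f - g \in ae_null).
  by rewrite Quotient.idealrBE; split=> /eqP.
rewrite inE; split; apply: filterS => x.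
  by move=> /subr0_eq.
by move=> fg; rewrite [LHS](_ : _ = f x - g x)// fg subrr.
Qed.

Lemma L2_classD (f g : sqfun) : L2_class (f + g) = L2_class f + L2_class g.
Proof. exact: Quotient.pi_add. Qed.

Definition L2_scale (a : C) (u : L2) : L2 := L2_class (a *: (repr u : sqfun)).

Lemma L2_scaleE a (f : sqfun) : L2_scale a (L2_class f) = L2_class (a *: f).
Proof.
apply/L2_classP; have := L2_classK (L2_class f) => /L2_classP.
by apply: filterS => x fx; rewrite [LHS](_ : _ = a * repr (L2_class f) x)// fx.
Qed.

Lemma L2_scaleA a b u : L2_scale a (L2_scale b u) = L2_scale (a * b) u.
Proof. by rewrite -(L2_classK u) !L2_scaleE scalerA. Qed.

Lemma L2_scale1 : left_id 1 L2_scale.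
Proof. by move=> u; rewrite -(L2_classK u) L2_scaleE scale1r. Qed.

Lemma L2_scaleDr : right_distributive L2_scale +%R.
Proof.
move=> a u v; rewrite -(L2_classK u) -(L2_classK v).
by rewrite -L2_classD !L2_scaleE -L2_classD scalerDr.
Qed.

Lemma L2_scaleDl u : {morph L2_scale^~ u : a b / a + b}.
Proof.
by move=> a b; rewrite -(L2_classK u) !L2_scaleE -L2_classD scalerDl.
Qed.

HB.instance Definition _ := GRing.Zmodule_isLmodule.Build C L2
  L2_scaleA L2_scale1 L2_scaleDr L2_scaleDl.

Definition L2_dot (u v : L2) : C := inner u v.

End L2.

Section Operators.
Variables (R : realType) (H : lmodType R[i]) (dot : H -> H -> R[i]).
Implicit Types (D : set H) (A S T : H -> H).

Definition hnorm (u : H) : R := Num.sqrt (complex.Re (dot u u)).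

(* A possibly unbounded operator is a pair (D, T): only the restriction of T
   to its domain D is meaningful. *)
Definition linear_operator D T :=
  [/\ D 0,
      forall a u v, D u -> D v -> D (a *: u + v) &
      forall a u v, D u -> D v -> T (a *: u + v) = a *: T u + T v].

Definition bounded_operator T :=
  linear_operator setT T /\ exists M, forall u, hnorm (T u) <= M * hnorm u.

Definition compact_operator T :=
  forall u : nat -> H, (exists M, forall k, hnorm (u k) <= M) ->
  exists (s : nat -> nat) (v : H),
    {homo s : i j / (i < j)%N} /\ hnorm (T (u (s k)) - v) @[k --> \oo] --> 0.

Definition dense_domain D :=
  forall u e, 0 < e -> exists2 v, D v & hnorm (u - v) < e.

(* T = T^* as unbounded operators, domains included *)
Definition selfadjoint_operator D T :=
  dense_domain D /\
  forall u v, (D u /\ T u = v) <-> (forall w, D w -> dot (T w) u = dot w v).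

Definition positive_operator D T := forall u, D u -> 0 <= dot (T u) u.

Definition is_adjoint T S := forall u v, dot (T u) v = dot u (S v).

(* A is the positive square root of T^* T *)
Definition is_absolute_value T A :=
  [/\ bounded_operator A, selfadjoint_operator setT A, positive_operator setT A &
      exists2 S, is_adjoint T S & forall u, A (A u) = S (T u)].

(* dimension of the eigenspace of A for a *)
Definition multiplicity A (a : R[i]) : \bar R :=
  ereal_sup [set (k%:R)%:E | k in [set k : nat |
    exists u : 'I_k -> H, (forall i, A (u i) = a *: u i) /\
      forall c : 'I_k -> R[i],
        \sum_(i < k) c i *: u i = 0 -> forall i, c i = 0]].

(* The sum of the r-th powers of the singular values of T, i.e. of the
   eigenvalues of |T| repeated according to multiplicity. The singular value 0
   contributes nothing since r > 0. Compactness ensures that the eigenvalues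
   of |T| exhaust its spectrum; without it an operator |T| having no
   eigenvalue at all would have an empty sum. *)
Definition schatten (r : R) T :=
  [/\ bounded_operator T, compact_operator T &
      exists2 A, is_absolute_value T A &
        (\esum_(l in [set l : R | (0 < l)%R])
           ((l `^ r)%R%:E * multiplicity A (l%:C)%C) < +oo)%E].

(* An operator given on a dense domain D is identified with its bounded
   extension to H; for D = setT this is schatten r T itself. *)
Definition schatten_class (r : R) D T :=
  exists2 S, (forall u, D u -> S u = T u) & schatten r S.

End Operators.

Section Hermite.
Variable R : realType.

(* physicists' Hermite polynomials: Rodrigues' formula
   H_k(t) = (-1)^k e^(t^2) (d/dt)^k e^(-t^2) gives H_(k+1) = 2 X H_k - H_k' *)
Fixpoint hermite_poly (k : nat) : {poly R} :=
  if k is k'.+1 then 2%:R *: ('X * hermite_poly k') - (hermite_poly k')^`()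
  else 1.

Definition hermite1 (k : nat) (t : R) : R :=
  (2 ^+ k * k`!%:R * Num.sqrt pi) `^ (- 2^-1) * (hermite_poly k).[t] *
  expR (- t ^+ 2 / 2).

Definition hermite n (nu : n.-tuple nat)
    (x : n.-tuple (measurableTypeR R)) : R :=
  \prod_(j < n) hermite1 (tnth nu j) (tnth x j).

End Hermite.

Definition tuple_sum n (nu : n.-tuple nat) : nat :=
  (\sum_(j < n) tnth nu j)%N.

Section PseudoMultiplier.
Variables (R : realType) (n : nat).
Local Notation Rn := (n.-tuple (measurableTypeR R)).
Local Notation mu := (@lebesgue_tuple R n).

(* <f, phi_nu> *)
Definition fourier_hermite (f : L2 mu) (nu : n.-tuple nat) : R[i] :=
  inner mu f (fun x => (hermite nu x)%:C).

Definition pm_term (m : Rn -> n.-tuple nat -> R[i]) (f : L2 mu)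
    (nu : n.-tuple nat) (x : Rn) : R[i] :=
  m x nu * fourier_hermite f nu * (hermite nu x)%:C.

(* g is the sum in L^2 of the unordered series defining T_m f *)
Definition pm_series_to m (f g : L2 mu) :=
  forall e : R, 0 < e -> exists s0 : {fset (n.-tuple nat)},
    forall s : {fset (n.-tuple nat)}, (s0 `<=` s)%fset ->
      (sqnorm mu (fun x => ((\sum_(nu <- s) pm_term m f nu x) - g x)%R) < e%:E)%E.

(* (D, T) is a realization of T_m: D is any linear subspace of L^2 on which the
   defining series converges and which contains the Hermite functions *)
Definition pseudo_multiplier m (D : set (L2 mu)) (T : L2 mu -> L2 mu) :=
  [/\ forall nu, cmeasurable (m ^~ nu),
      linear_operator D T,
      forall nu, exists2 f : L2 mu, D f &
        {ae mu, forall x, f x = (hermite nu x)%:C} &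
      forall f, D f -> pm_series_to m f (T f)].

End PseudoMultiplier.

(* Main.v *)
(* The Hermite functions are orthonormal, so the defining series gives
   T phi_nu = m(., nu) phi_nu and T f = sum_nu <f, phi_nu> T phi_nu on D. The
   masses in the statement are thus |T phi_nu|^2, and only the closed span V of
   the phi_nu matters: their completeness is never used.
   If sum |T phi_nu|^2 < oo, the series defines a compact extension S of T, and
   |S| comes from the spectral theorem for S^* S. A unit eigenvector e of |S|
   for an eigenvalue l > 0 lies in V, so sum_nu |<e, phi_nu>|^2 = 1. For
   orthonormal eigenvectors e_i and 0 < r <= 2, Jensen's inequality yields
     sum_i l_i^r = sum_nu sum_i l_i^r |<e_i, phi_nu>|^2
                <= sum_nu (sum_i l_i^2 |<e_i, phi_nu>|^2)^(r/2)
                <= sum_nu |T phi_nu|^r,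
   whence (3) and half of (1). Part (4) follows by Young's inequality from
   sum_(nu <> 0) |nu|^(-q) < oo for q > n. Conversely, expanding |S| phi_nu in
   eigenvectors and applying Bessel's inequality gives
   sum |S phi_nu|^2 <= sum l_i^2.
   For (2), with tau = sum <T phi_nu, phi_nu>, the Cauchy-Schwarz inequality for
   the form <T u, v> gives <T f, f> <= tau |f|^2 on D, hence
   |T phi_nu|^2 <= tau <T phi_nu, phi_nu>, so T is Hilbert-Schmidt; its
   extension is its own absolute value, and
   sum_i l_i |<e_i, phi_nu>|^2 <= <T phi_nu, phi_nu>
   replaces Jensen's inequality. *)

Require Import Defs.
From HB Require Import structures.
From mathcomp Require Import all_boot all_order all_algebra.
From mathcomp Require Import finmap generic_quotient.
From mathcomp Require Import all_classical all_reals all_analysis.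
From mathcomp Require Import measurable_realfun complex ring lra.
Import Order.TTheory GRing.Theory Num.Theory.
Import numFieldNormedType.Exports Normc.
Local Open Scope classical_set_scope.
Local Open Scope ring_scope.

Set Implicit Arguments.
Unset Strict Implicit.
Unset Printing Implicit Defensive.
Local Open Scope complex_scope.

(** The Schatten sum is a supremum over finite sets of eigenvalues, each weighted by the supremum of
    the sizes of independent families of eigenvectors; no eigenbasis occurs in it. Upper bounds are
    therefore proved for arbitrary finite orthonormal families of eigenvectors of |S|, uniformly in
    the family, and a Gram-Schmidt argument turns them into bounds on the sum. The spectral theorem
    serves to construct |S| and, in the converse directions, to supply eigenexpansions. All
    exchanges of summation are between finite sums: one truncation goes to infinity only while the
    other is fixed. In (2) the obstacle is that T is not known to be bounded, so that neither T nor
    its form can be passed to a limit in f. The form is first bounded on the span of the phi_nu, by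
    finite sums inside D; the convergence of the series for T f extends the bound to D; the density
    of D then turns it into a bound on |T f|^2. *)

Lemma complex_ge0E {R : realType} {z : R[i]} :
  0 <= z -> z = (complex.Re z)%:C /\ 0 <= complex.Re z.
Proof. by case: z => a b; rewrite lecE /= => /andP[/eqP -> ->]. Qed.

Lemma normc_ge0 {R : realType} (z : R[i]) : 0 <= normc z.
Proof. by case: z => a b; rewrite /= sqrtr_ge0. Qed.

Lemma normc_conj {R : realType} (z : R[i]) : normc (conjc z) = normc z.
Proof. by case: z => a b /=; rewrite sqrrN. Qed.

Lemma normc_real {R : realType} (a : R) : normc a%:C = `|a|.
Proof. by rewrite /= expr0n addr0 sqrtr_sqr. Qed.

Lemma mul_conj {R : realType} (z : R[i]) : z * conjc z = (normc z ^+ 2)%:C.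
Proof.
rewrite normc_sqr; case: z => a b; apply/eqP; rewrite eq_complex /=.
by apply/andP; split; apply/eqP; ring.
Qed.

Lemma ler_Re_normc {R : realType} (z : R[i]) : `|complex.Re z| <= normc z.
Proof.
by case: z => a b /=; rewrite -sqrtr_sqr ler_wsqrtr// lerDl sqr_ge0.
Qed.

Lemma ReM_real {R : realType} (a : R) (z : R[i]) :
  complex.Re (a%:C * z) = a * complex.Re z.
Proof. by case: z => x y /=; rewrite mul0r subr0. Qed.

Lemma ReD {R : realType} (x y : R[i]) :
  complex.Re (x + y) = complex.Re x + complex.Re y.
Proof. by case: x y => [a b] [c d]. Qed.

Lemma ReN {R : realType} (x : R[i]) : complex.Re (- x) = - complex.Re x.
Proof. by case: x => [a b]. Qed.

Lemma Re_sum {R : realType} I (r : seq I) P (F : I -> R[i]) :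
  complex.Re (\sum_(i <- r | P i) F i) = \sum_(i <- r | P i) complex.Re (F i).
Proof. exact: (big_morph _ (@ReD R) (erefl _)). Qed.

Lemma Re_conj {R : realType} (x : R[i]) : complex.Re (conjc x) = complex.Re x.
Proof. by case: x. Qed.

Lemma sqr_normc_real {R : realType} (a : R) : normc a%:C ^+ 2 = a ^+ 2.
Proof. by rewrite normc_sqr /= expr0n addr0. Qed.

Lemma homo_ltn_ge_id (s : nat -> nat) : {homo s : i j / (i < j)%N} ->
  forall k, (k <= s k)%N.
Proof. by move=> si; elim=> // k ih; apply: leq_ltn_trans ih _; exact: si. Qed.

(** * Hilbert spaces *)

(** The axioms are put on a bare form because the operator notions take only [H] and [dot]; L^2
    enters the abstract theory through [L2_hilbert] alone. *)
Record hilbert (R : realType) (H : lmodType R[i]) (dot : H -> H -> R[i]) : Prop :=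
  Hilbert {
  dotDl : forall u v w, dot (u + v) w = dot u w + dot v w;
  dotZl : forall a u w, dot (a *: u) w = a * dot u w;
  dotC : forall u v, dot v u = conjc (dot u v);
  dot_ge0 : forall u, 0 <= dot u u;
  dot_definite : forall u, dot u u = 0 -> u = 0;
  dot_complete : forall u : nat -> H,
    (forall e : R, 0 < e -> exists N, forall i j,
       (N <= i)%N -> (N <= j)%N -> hnorm dot (u i - u j) < e) ->
    exists v, hnorm dot (u k - v) @[k --> \oo] --> (0 : R) }.

(** The form lives on a subspace [D] and may be degenerate, so that the lemma also covers <T u, v>.
    With c = q u v, the value of the form at u - t c v is a nonnegative quadratic in t, evaluated at
    t = 1 / B. If B = 0 it is affine in t, and the t chosen there would give it the value -1 unless
    c = 0. *)
Lemma form_cauchy_schwarz (R : realType) (H : lmodType R[i]) (D : set H)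
    (q : H -> H -> R[i]) :
  (forall a u v, D u -> D v -> D (a *: u + v)) ->
  (forall a u v w, D u -> D v -> D w -> q (a *: u + v) w = a * q u w + q v w) ->
  (forall u v, D u -> D v -> q v u = conjc (q u v)) ->
  (forall u, D u -> 0 <= q u u) ->
  forall u v, D u -> D v ->
  normc (q u v) ^+ 2 <= complex.Re (q u u) * complex.Re (q v v).
Proof.
move=> DL qL qC q0 u v Du Dv.
set c := q u v; set A := complex.Re (q u u); set B := complex.Re (q v v).
have [quu A0] := complex_ge0E (q0 _ Du); have [qvv B0] := complex_ge0E (q0 _ Dv).
have key (t : R) : 0 <= A - t * 2 * normc c ^+ 2 + t ^+ 2 * normc c ^+ 2 * B.
  pose k := - (t%:C * c).
  have Dw : D (k *: v + u) by exact: DL.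
  have [_] := complex_ge0E (q0 _ Dw).
  rewrite qL// (qC (k *: v + u) v)// (qC (k *: v + u) u)// !qL//.
  rewrite (qC u v)// -/c quu qvv -/A -/B.
  have -> : normc c ^+ 2 = complex.Re c ^+ 2 + complex.Im c ^+ 2 by exact: normc_sqr.
  rewrite /k; case: (c) => x y /=; congr (_ <= _); ring.
have [B00|Bn0] := eqVneq B 0.
  rewrite B00 mulr0; have [//|cn] := leP (normc c ^+ 2) 0.
  have := key ((A + 1) / (2 * normc c ^+ 2)).
  rewrite B00 mulr0 addr0 -mulrA mulfVK; last by rewrite gt_eqF// mulr_gt0.
  by rewrite opprD addrA subrr sub0r ler0N1.
have Bp : 0 < B by rewrite lt_neqAle eq_sym Bn0.
have := key B^-1.
have -> : A - B^-1 * 2 * normc c ^+ 2 + B^-1 ^+ 2 * normc c ^+ 2 * B =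
  (A * B - normc c ^+ 2) / B by field.
by rewrite pmulr_lge0 ?invr_gt0// subr_ge0.
Qed.

(** * Extraction of subsequences by the pigeonhole principle *)

Lemma infinite_nat_gt (J : set nat) N : infinite_set J -> exists2 k, J k & (N < k)%N.
Proof.
move=> Ji; apply: contrapT => Jk; apply: Ji.
apply: (@sub_finite_set _ _ `I_N.+1); last exact: finite_II.
by move=> k Jk' /=; rewrite ltnS leqNgt; apply/negP => Nk; apply: Jk; exists k.
Qed.

(** The interval [-M, M] is cut into finitely many cells of length [e], and [b k] is the number of
    the cell containing [a k]; some cell is hit by infinitely many indices of [I]. *)
Lemma infinite_refine_real (R : realType) (a : nat -> R) (M e : R) (I : set nat) :
  (forall k, `|a k| <= M) -> 0 < e -> infinite_set I ->
  exists2 J, J `<=` I /\ infinite_set J &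
    forall i j, J i -> J j -> `|a i - a j| <= e.
Proof.
move=> aM e0 Ii.
pose b k := Num.truncn ((a k + M) / e).
pose B := Num.truncn ((M + M) / e).
have aM0 k : 0 <= (a k + M) / e.
  by rewrite divr_ge0 ?(ltW e0)//; have := aM k; rewrite ler_norml; lra.
have bB k : (b k <= B)%N.
  rewrite /b truncn_le_nat; apply: le_lt_trans (_ : (M + M) / e < _).
    rewrite ler_pM2r ?invr_gt0// lerD2r.
    exact: le_trans (ler_norm _) (aM k).
  by rewrite -truncn_le_nat.
have [[i [_ Ji]]|noJ] :=
  pselect (exists i, (i <= B)%N /\ infinite_set [set k | I k /\ b k = i]).
  exists [set k | I k /\ b k = i]; first by split=> // k [].
  move=> k l [_ bk] [_ bl].
  have /andP[k1 k2] := truncn_itv (aM0 k).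
  have /andP[l1 l2] := truncn_itv (aM0 l).
  rewrite -/(b k) bk -natr1 in k1 k2; rewrite -/(b l) bl -natr1 in l1 l2.
  rewrite ler_pdivlMr// ltr_pdivrMr// in k1 k2.
  rewrite ler_pdivlMr// ltr_pdivrMr// in l1 l2.
  by rewrite ler_norml; lra.
exfalso; apply: Ii.
apply: (@sub_finite_set _ _ (\bigcup_(i in `I_B.+1) [set k | I k /\ b k = i])).
  by move=> k Ik; exists (b k) => //=; rewrite ltnS.
apply: bigcup_finite; first exact: finite_II.
move=> i /= iB; apply: contrapT => inf; apply: noJ; exists i.
by split.
Qed.

Lemma infinite_refine_reals (R : realType) (a : nat -> nat -> R) (M : nat -> R)
    (e : R) N (I : set nat) :
  (forall n k, `|a n k| <= M n) -> 0 < e -> infinite_set I ->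
  exists2 J, J `<=` I /\ infinite_set J &
    forall n i j, (n < N)%N -> J i -> J j -> `|a n i - a n j| <= e.
Proof.
move=> aM e0; elim: N I => [|N ih] I Ii; first by exists I => //; split.
have [J [JI Ji] Je] := ih _ Ii.
have [K [KJ Ki] Ke] := infinite_refine_real (aM N) e0 Ji.
exists K; first by split=> // k /KJ /JI.
move=> n i j; rewrite ltnS leq_eqVlt => /orP[/eqP->|nN] Kki Kj; first exact: Ke.
by apply: Je => //; exact: KJ.
Qed.

Lemma cvgn_le (R : realType) (u : nat -> R) (l M : R) :
  u @ \oo --> l -> (forall k, u k <= M) -> l <= M.
Proof.
move=> ul uM; rewrite -(cvg_lim _ ul)//; apply: limr_le; last exact: nearW.
by apply/cvg_ex; exists l.
Qed.

Lemma cvgn_ge (R : realType) (u : nat -> R) (l M : R) :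
  u @ \oo --> l -> (forall k, M <= u k) -> M <= l.
Proof.
move=> ul uM; rewrite -(cvg_lim _ ul)//; apply: limr_ge; last exact: nearW.
by apply/cvg_ex; exists l.
Qed.

Lemma cvgn_sum (R : realType) (f : nat -> nat -> R) (l : nat -> R) N :
  (forall i, (i < N)%N -> f i @ \oo --> l i) ->
  (fun k => \sum_(0 <= i < N) f i k) @ \oo --> \sum_(0 <= i < N) l i.
Proof.
elim: N => [_|N ih fl].
  by rewrite big_geq//; under eq_fun do rewrite big_geq//; exact: cvg_cst.
rewrite big_nat_recr//=; under eq_fun do rewrite big_nat_recr//=.
by apply: cvgD; [apply: ih => i iN; apply: fl; exact: ltnW|exact: fl].
Qed.

(** * Young's and Jensen's inequalities for powers *)

Lemma young_powR (R : realType) (a b p : R) : 0 <= a -> 0 <= b -> 0 < p < 1 ->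
  a `^ p * b `^ (1 - p) <= p * a + (1 - p) * b.
Proof.
move=> a0 b0 /andP[p0 p1].
have p1' : 0 < 1 - p by rewrite subr_gt0.
have := @conjugate_powR R (a `^ p) (b `^ (1 - p)) p^-1 (1 - p)^-1
  (powR_ge0 _ _) (powR_ge0 _ _).
rewrite !invr_gt0 => /(_ p0 p1'); rewrite !invrK addrC subrK => /(_ erefl).
rewrite -!powRrM !divff ?gt_eqF// !powRr1// => /le_trans; apply.
by rewrite mulrC [b * _]mulrC.
Qed.

Lemma powR_tangent (R : realType) (t p : R) : 0 <= t -> 0 < p <= 1 ->
  t `^ p <= 1 + p * (t - 1).
Proof.
move=> t0 /andP[p0]; rewrite le_eqVlt => /orP[/eqP->|p1]; first by rewrite powRr1//; lra.
have := @young_powR R t 1 p t0 ler01; rewrite p0 p1 powR1 => /(_ erefl); lra.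
Qed.

(** The total weight is only at most 1, since Bessel's inequality will supply the weights. Each
    [a i] is compared with the mean [x] by the tangent bound at 1 applied to [a i / x]; summing
    gives x^p ((1 - p) W + p) with W the total weight, which is at most x^p. *)
Lemma powR_jensen (R : realType) N (w a : nat -> R) (p : R) : 0 < p <= 1 ->
  (forall i, 0 <= w i) -> (forall i, 0 <= a i) -> \sum_(0 <= i < N) w i <= 1 ->
  \sum_(0 <= i < N) w i * a i `^ p <= (\sum_(0 <= i < N) w i * a i) `^ p.
Proof.
move=> p01 w0 a0 w1; have /andP[p0 p1] := p01.
set x := \sum_(0 <= i < N) w i * a i.
have x0 : 0 <= x by apply: sumr_ge0 => i _; rewrite mulr_ge0.
have [xz|xn0] := eqVneq x 0.
  rewrite xz powR0 ?gt_eqF// big1_seq// => i /andP[_]; rewrite mem_index_iota => /andP[_ iN].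
  have : w i * a i = 0.
    apply/eqP; rewrite eq_le mulr_ge0// andbT -xz /x.
    rewrite (bigD1_seq i) ?mem_index_iota ?iota_uniq//= lerDl.
    by apply: sumr_ge0 => j _; rewrite mulr_ge0.
  move/eqP; rewrite mulf_eq0 => /orP[/eqP->|/eqP->]; first by rewrite mul0r.
  by rewrite powR0 ?mulr0// gt_eqF.
have xp : 0 < x by rewrite lt_neqAle eq_sym xn0.
have xpp : 0 < x `^ p by rewrite powR_gt0.
have h i : a i `^ p <= x `^ p * (1 + p * (a i / x - 1)).
  rewrite -{1}[a i](divfK xn0) powRM ?divr_ge0// mulrC ler_wpM2l ?powR_ge0//.
  by apply: powR_tangent => //; rewrite divr_ge0.
apply: le_trans (_ : \sum_(0 <= i < N) w i * (x `^ p * (1 + p * (a i / x - 1))) <= _).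
  by apply: ler_sum => i _; rewrite ler_wpM2l.
rewrite (eq_bigr (fun i => (x `^ p * (1 - p)) * w i + x `^ p * p / x * (w i * a i))).
  rewrite big_split /= -!mulr_sumr -/x divfK//.
  have : x `^ p * (1 - p) * \sum_(0 <= i < N) w i <= x `^ p * (1 - p).
    by rewrite ler_piMr ?mulr_ge0 ?subr_ge0 ?(ltW xpp).
  lra.
by move=> i _; field.
Qed.

Section HilbertTheory.
Variables (R : realType) (H : lmodType R[i]) (dot : H -> H -> R[i]).
Hypothesis hH : hilbert dot.
Local Notation C := R[i].
Local Notation Re := (@complex.Re R).
Local Notation hnorm := (hnorm dot).
Local Notation dotC := (dotC hH).
Local Notation dotDl := (dotDl hH).
Local Notation dotZl := (dotZl hH).
Implicit Types (u v w : H) (A : H -> H).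

Definition nsq u : R := Re (dot u u).

Lemma dotDr u v w : dot u (v + w) = dot u v + dot u w.
Proof. by rewrite dotC dotDl rmorphD/= -!dotC. Qed.

Lemma dotZr a u v : dot u (a *: v) = conjc a * dot u v.
Proof. by rewrite dotC dotZl rmorphM/= -dotC. Qed.

Lemma dot0l u : dot 0 u = 0.
Proof. by rewrite -(scale0r 0) dotZl mul0r. Qed.

Lemma dot0r u : dot u 0 = 0.
Proof. by rewrite dotC dot0l conjc0. Qed.

Lemma dotNl u v : dot (- u) v = - dot u v.
Proof. by rewrite -scaleN1r dotZl mulN1r. Qed.

Lemma dotNr u v : dot u (- v) = - dot u v.
Proof. by rewrite dotC dotNl rmorphN/= -dotC. Qed.

Lemma dotBl u v w : dot (u - v) w = dot u w - dot v w.
Proof. by rewrite dotDl dotNl. Qed.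

Lemma dotBr u v w : dot u (v - w) = dot u v - dot u w.
Proof. by rewrite dotDr dotNr. Qed.

Lemma dot_suml I (r : seq I) P (F : I -> H) v :
  dot (\sum_(i <- r | P i) F i) v = \sum_(i <- r | P i) dot (F i) v.
Proof. exact: (big_morph (dot^~ v) (fun x y => dotDl x y v) (dot0l v)). Qed.

Lemma dot_sumr I (r : seq I) P (F : I -> H) v :
  dot v (\sum_(i <- r | P i) F i) = \sum_(i <- r | P i) dot v (F i).
Proof. exact: (big_morph (dot v) (dotDr v) (dot0r v)). Qed.

Lemma Re_dotC u v : Re (dot u v) = Re (dot v u).
Proof. by rewrite dotC Re_conj. Qed.

Lemma nsq_ge0 u : 0 <= nsq u.
Proof. by have [] := complex_ge0E (dot_ge0 hH u). Qed.

Lemma dot_self u : dot u u = (nsq u)%:C.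
Proof. by have [] := complex_ge0E (dot_ge0 hH u). Qed.

Lemma sqr_hnorm u : hnorm u ^+ 2 = nsq u.
Proof. by rewrite sqr_sqrtr// nsq_ge0. Qed.

Lemma hnorm_ge0 u : 0 <= hnorm u. Proof. exact: sqrtr_ge0. Qed.

Lemma nsq_eq0 u : nsq u = 0 -> u = 0.
Proof. by move=> u0; apply: dot_definite hH _ _; rewrite dot_self u0. Qed.

Lemma hnorm_eq0 u : hnorm u = 0 -> u = 0.
Proof. by move=> u0; apply: nsq_eq0; rewrite -sqr_hnorm u0 expr0n. Qed.

Lemma nsqD u v : nsq (u + v) = nsq u + nsq v + 2 * Re (dot u v).
Proof.
by rewrite /nsq dotDl !dotDr !ReD (Re_dotC v u); ring.
Qed.

Lemma nsqN u : nsq (- u) = nsq u.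
Proof. by rewrite /nsq dotNl dotNr opprK. Qed.

Lemma nsqB u v : nsq (u - v) = nsq u + nsq v - 2 * Re (dot u v).
Proof. by rewrite nsqD nsqN dotNr ReN mulrN. Qed.

Lemma nsqZ a u : nsq (a *: u) = normc a ^+ 2 * nsq u.
Proof. by rewrite /nsq dotZl dotZr mulrA mul_conj ReM_real. Qed.

Lemma nsq0 : nsq 0 = 0. Proof. by rewrite /nsq dot0l. Qed.

Lemma hnorm0 : hnorm 0 = 0.
Proof. by rewrite /hnorm -/(nsq 0) nsq0 sqrtr0. Qed.

Lemma hnormZ a u : hnorm (a *: u) = normc a * hnorm u.
Proof.
by rewrite /hnorm -!/(nsq _) nsqZ sqrtrM ?sqr_ge0// sqrtr_sqr ger0_norm// normc_ge0.
Qed.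

Lemma hnormZr (a : R) u : hnorm (a%:C *: u) = `|a| * hnorm u.
Proof. by rewrite hnormZ normc_real. Qed.

Lemma hnormN u : hnorm (- u) = hnorm u.
Proof. by rewrite /hnorm -!/(nsq _) nsqN. Qed.

Lemma hnormBC u v : hnorm (u - v) = hnorm (v - u).
Proof. by rewrite -hnormN opprB. Qed.

Lemma ler_hnorm u v : (hnorm u <= hnorm v) = (nsq u <= nsq v).
Proof. by rewrite -!sqr_hnorm ler_sqr// nnegrE hnorm_ge0. Qed.

Lemma hnorm_le u (a : R) : 0 <= a -> (hnorm u <= a) = (nsq u <= a ^+ 2).
Proof. by move=> a0; rewrite -!sqr_hnorm ler_sqr// nnegrE hnorm_ge0. Qed.

Lemma cauchy_schwarz u v : normc (dot u v) <= hnorm u * hnorm v.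
Proof.
rewrite -ler_sqr ?nnegrE ?normc_ge0 ?mulr_ge0 ?hnorm_ge0//.
rewrite exprMn !sqr_hnorm.
apply: (@form_cauchy_schwarz _ _ setT dot) => //.
- by move=> a x y w _ _ _; rewrite dotDl dotZl.
- by move=> x y _ _; rewrite -dotC.
- by move=> x _; exact: dot_ge0 hH x.
Qed.

Lemma Re_dot_le u v : `|Re (dot u v)| <= hnorm u * hnorm v.
Proof. exact: le_trans (ler_Re_normc _) (cauchy_schwarz _ _). Qed.

Lemma hnormD u v : hnorm (u + v) <= hnorm u + hnorm v.
Proof.
rewrite hnorm_le ?addr_ge0 ?hnorm_ge0// nsqD sqrrD !sqr_hnorm.
rewrite -mulr_natl; have := le_trans (ler_norm _) (Re_dot_le u v); lra.
Qed.

Lemma hnorm_sum I (r : seq I) P (F : I -> H) :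
  hnorm (\sum_(i <- r | P i) F i) <= \sum_(i <- r | P i) hnorm (F i).
Proof.
elim/big_ind2 : _ => [|x a y b xa yb|//]; first by rewrite hnorm0.
exact: le_trans (hnormD _ _) (lerD xa yb).
Qed.

Lemma hnorm_triangle w u v : hnorm (u - v) <= hnorm (u - w) + hnorm (w - v).
Proof. by rewrite -[u - v](subrKA w); exact: hnormD. Qed.

(** * Norm convergence *)

Definition hcvg (u : nat -> H) v := hnorm (u k - v) @[k --> \oo] --> (0 : R).

Lemma hcvgP (u : nat -> H) v : hcvg u v <->
  forall e, 0 < e -> exists N, forall k, (N <= k)%N -> hnorm (u k - v) < e.
Proof.
split=> [/cvgrPdist_lt uv e e0|uv].
  have [N _ hN] := uv _ e0; exists N => k Nk.
  by have := hN _ Nk; rewrite /= sub0r normrN ger0_norm// hnorm_ge0.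
apply/cvgrPdist_lt => e e0; have [N hN] := uv _ e0; exists N => // k Nk.
by rewrite /= sub0r normrN ger0_norm ?hnorm_ge0// hN.
Qed.

Lemma hcvg_squeeze (u : nat -> H) v (a : nat -> R) :
  (forall k, hnorm (u k - v) <= a k) -> a @ \oo --> (0 : R) -> hcvg u v.
Proof.
move=> ua a0; apply: (squeeze_cvgr _ (cvg_cst 0) a0).
by near=> k; rewrite hnorm_ge0 ua.
Unshelve. all: by end_near. Qed.

Lemma hcvg_unique (u : nat -> H) v w : hcvg u v -> hcvg u w -> v = w.
Proof.
move=> uv uw; apply/eqP; rewrite -subr_eq0; apply/eqP/hnorm_eq0/eqP.
rewrite eq_le hnorm_ge0 andbT.
have : (fun k => hnorm (u k - v) + hnorm (u k - w)) @ \oo --> 0 + (0 : R).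
  exact: cvgD.
rewrite addr0 => h.
rewrite -(cvg_lim _ h)//; apply: limr_ge; first by apply/cvg_ex; exists 0.
by near=> k; rewrite (hnormBC (u k) v); exact: hnorm_triangle.
Unshelve. all: by end_near. Qed.

Lemma hcvg_cst v : hcvg (fun=> v) v.
Proof.
by apply: (@hcvg_squeeze _ _ (fun=> 0)) => [k|]; rewrite ?subrr ?hnorm0//; exact: cvg_cst.
Qed.

Lemma hcvgD (u v : nat -> H) x y : hcvg u x -> hcvg v y ->
  hcvg (fun k => u k + v k) (x + y).
Proof.
move=> ux vy.
apply: (@hcvg_squeeze _ _ (fun k => hnorm (u k - x) + hnorm (v k - y))).
  by move=> k; rewrite opprD addrACA; exact: hnormD.
by rewrite -[X in _ --> X]addr0; exact: cvgD.
Qed.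

Lemma hcvgZ a (u : nat -> H) x : hcvg u x -> hcvg (fun k => a *: u k) (a *: x).
Proof.
move=> ux; apply: (@hcvg_squeeze _ _ (fun k => normc a * hnorm (u k - x))).
  by move=> k; rewrite -scalerBr hnormZ.
by rewrite -[X in _ --> X](mulr0 (normc a)); exact: cvgMr.
Qed.

Lemma hcvgB (u v : nat -> H) x y : hcvg u x -> hcvg v y ->
  hcvg (fun k => u k - v k) (x - y).
Proof.
move=> ux vy; rewrite -scaleN1r (_ : (fun k => _) = (fun k => u k + (-1) *: v k)).
  by apply: hcvgD => //; exact: hcvgZ.
by apply/funext => k; rewrite scaleN1r.
Qed.

Lemma hcvg_subseq (u : nat -> H) v (s : nat -> nat) :
  {homo s : i j / (i < j)%N} -> hcvg u v -> hcvg (u \o s) v.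
Proof.
move=> si /hcvgP uv; apply/hcvgP => e /uv[N hN]; exists N => k Nk; apply: hN.
exact: leq_trans Nk (homo_ltn_ge_id si k).
Qed.

Lemma hnorm_dist u v : `|hnorm u - hnorm v| <= hnorm (u - v).
Proof.
have := hnormD (u - v) v; have := hnormD (v - u) u.
rewrite !subrK (hnormBC v u) ler_norml; lra.
Qed.

Lemma cvg_hnorm (u : nat -> H) x : hcvg u x -> hnorm (u k) @[k --> \oo] --> hnorm x.
Proof.
move=> /hcvgP ux; apply/cvgrPdist_lt => /= e /ux[N hN]; exists N => // k Nk /=.
by rewrite distrC; exact: le_lt_trans (hnorm_dist _ _) (hN _ Nk).
Qed.

Lemma cvg_nsq (u : nat -> H) x : hcvg u x -> nsq (u k) @[k --> \oo] --> nsq x.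
Proof.
move=> /cvg_hnorm ux; rewrite -sqr_hnorm.
by under eq_fun do rewrite -sqr_hnorm expr2; rewrite expr2; exact: cvgM.
Qed.

Lemma cvg_Re_dot (u v : nat -> H) x y : hcvg u x -> hcvg v y ->
  Re (dot (u k) (v k)) @[k --> \oo] --> Re (dot x y).
Proof.
move=> ux vy.
have E a b : Re (dot a b) = 2^-1 * (nsq (a + b) - nsq a - nsq b).
  by rewrite nsqD; field.
rewrite E; under eq_fun do rewrite E.
apply: cvgMr; apply: cvgB; last exact: cvg_nsq.
by apply: cvgB; apply: cvg_nsq => //; exact: hcvgD.
Qed.

Lemma cvg_Re_dotl (u : nat -> H) x y : hcvg u x ->
  Re (dot (u k) y) @[k --> \oo] --> Re (dot x y).
Proof. by move=> ux; apply: cvg_Re_dot => //; exact: hcvg_cst. Qed.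

Lemma cvg_Re_dotr (u : nat -> H) x y : hcvg u x ->
  Re (dot y (u k)) @[k --> \oo] --> Re (dot y x).
Proof. by move=> ux; apply: cvg_Re_dot => //; exact: hcvg_cst. Qed.

(* Real parts determine the inner products since [Re (dot ('i *: u) v) = - Im (dot u v)]. *)
Lemma Re_dot_ext (F G : H -> C) :
  (forall a u, F (a *: u) = a * F u) -> (forall a u, G (a *: u) = a * G u) ->
  (forall u, Re (F u) = Re (G u)) -> F =1 G.
Proof.
move=> FZ GZ FG u; have := FG ('i *: u); rewrite FZ GZ; have := FG u.
by case: (F u) (G u) => [a b] [c d] /= -> bd; congr (_ +i* _); lra.
Qed.

Lemma eq_dotr u v : (forall w, dot w u = dot w v) -> u = v.
Proof.
move=> uv; apply/eqP; rewrite -subr_eq0; apply/eqP/(dot_definite hH).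
by rewrite dotBr uv subrr.
Qed.

(** * Operators given by series *)

Definition lin (F : H -> H) := forall a u v, F (a *: u + v) = a *: F u + F v.

Lemma lin0 F : lin F -> F 0 = 0.
Proof.
move=> Fl; have := Fl 1 0 0; rewrite !scale1r addr0 => /(congr1 (fun z => z - F 0)).
by rewrite subrr addrK.
Qed.

Lemma linD F u v : lin F -> F (u + v) = F u + F v.
Proof. by move=> Fl; rewrite -{1}[u]scale1r Fl scale1r. Qed.

Lemma linZ F a u : lin F -> F (a *: u) = a *: F u.
Proof. by move=> Fl; rewrite -[a *: u]addr0 Fl lin0// addr0. Qed.

Lemma linB F u v : lin F -> F (u - v) = F u - F v.
Proof. by move=> Fl; rewrite linD// -scaleN1r linZ// scaleN1r. Qed.

Lemma lin_sum F I (r : seq I) P (G : I -> H) : lin F ->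
  F (\sum_(i <- r | P i) G i) = \sum_(i <- r | P i) F (G i).
Proof. by move=> Fl; apply: big_morph => [u v|]; rewrite ?lin0// linD. Qed.

Lemma lin_operator F : lin F -> linear_operator setT F.
Proof. by move=> Fl; split. Qed.

Lemma bounded_lin F : bounded_operator dot F -> lin F.
Proof. by move=> [[_ _ Fl] _] a u v; exact: Fl. Qed.

Lemma bounded_pos F : bounded_operator dot F ->
  exists2 M, 0 < M & forall u, hnorm (F u) <= M * hnorm u.
Proof.
move=> [_ [M FM]]; exists (`|M| + 1); first by rewrite ltr_wpDl.
move=> u; apply: le_trans (FM u) _; rewrite ler_wpM2r ?hnorm_ge0//.
by rewrite (le_trans (ler_norm M))// lerDl.
Qed.

Lemma bounded_hcvg F (u : nat -> H) v : bounded_operator dot F -> hcvg u v ->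
  hcvg (F \o u) (F v).
Proof.
move=> Fb uv; have [M M0 FM] := bounded_pos Fb.
apply: (@hcvg_squeeze _ _ (fun k => M * hnorm (u k - v))).
  by move=> k /=; rewrite -linB//; exact: bounded_lin.
by rewrite -[X in _ --> X](mulr0 M); exact: cvgMr.
Qed.

Lemma compact_comp F G : bounded_operator dot G -> compact_operator dot F ->
  compact_operator dot (G \o F).
Proof.
move=> Gb Fc u /Fc[s [v [si sv]]]; exists s, (G v); split=> //.
exact: (bounded_hcvg Gb sv).
Qed.

(** Diagonal extraction: nested infinite index sets, the images under [F] at stage n lying within 1
    / (n + 1) of each other, and one index taken from each set, larger than the previous one. The
    images along these indices form a Cauchy sequence. *)
Lemma cauchy_subseq_compact F :
  (forall u : nat -> H, (exists M, forall k, hnorm (u k) <= M) ->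
   forall (e : R) (I : set nat), 0 < e -> infinite_set I ->
   exists2 J, J `<=` I /\ infinite_set J &
     forall i j, J i -> J j -> hnorm (F (u i) - F (u j)) <= e) ->
  compact_operator dot F.
Proof.
move=> Fref u uM.
(* [p] packs the stage, the current index set and the last index taken. Infiniteness is a premise
   inside the existential, so that [choice] yields a total function that can be iterated. *)
have step (p : nat * (set nat * nat)) : exists q : set nat * nat,
    infinite_set p.2.1 -> [/\ q.1 `<=` p.2.1, infinite_set q.1, q.1 q.2,
      (p.2.2 < q.2)%N & forall i j, q.1 i -> q.1 j ->
      hnorm (F (u i) - F (u j)) <= p.1.+1%:R^-1].
  have [Ii|] := pselect (infinite_set p.2.1); last by exists p.2.
  have e0 : 0 < p.1.+1%:R^-1 :> R by rewrite invr_gt0.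
  have [J [JI Ji] Je] := Fref u uM _ _ e0 Ii.
  have [k Jk sk] := infinite_nat_gt p.2.2 Ji.
  by exists (J, k).
have [f hf] := choice step.
pose q := fix q n := if n is m.+1 then f (m, q m) else ([set: nat], 0%N).
have qi n : infinite_set (q n).1.
  elim: n => [|n ih]; first exact: infinite_nat.
  by have [] := hf (n, q n) ih.
have qS n := hf (n, q n) (qi n).
pose s n := (q n.+1).2.
have sub m n : (m <= n)%N -> (q n).1 `<=` (q m).1.
  elim: n => [|n ih]; first by rewrite leqn0 => /eqP->.
  rewrite leq_eqVlt => /orP[/eqP->//|mn]; apply: subset_trans (ih mn).
  by have [] := qS n.
have sJ m n : (m <= n)%N -> (q m.+1).1 (s n).
  by move=> mn; apply: (sub m.+1 n.+1) => //; have [] := qS n.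
have [v hv] : exists v, hcvg (fun k => F (u (s k))) v.
  apply: (dot_complete hH) => e e0.
  have [N _ hN] := near_infty_natSinv_lt (PosNum e0).
  exists N => i j Ni Nj; apply: le_lt_trans (hN N (leqnn N)).
  by have [_ _ _ _] := qS N; apply; exact: sJ.
exists s, v; split=> //.
apply: homo_ltn; first exact: ltn_trans.
by move=> i; have [] := qS i.+1.
Qed.

Definition psum (x y : nat -> H) m n u := \sum_(m <= k < n) dot u (x k) *: y k.

Definition is_opsum x y (F : H -> H) := forall u, hcvg (psum x y 0 ^~ u) (F u).

(* The partial sums of [u |-> \sum_k <u, x_k> y_k] are Cauchy in operator norm. *)
Definition uniform_sum x y (eta : nat -> R) :=
  [/\ eta @ \oo --> (0 : R), forall m, 0 <= eta m &
  forall m n u, (m <= n)%N -> hnorm (psum x y m n u) <= eta m * hnorm u].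

Lemma psum_lin x y m n : lin (psum x y m n).
Proof.
move=> a u v; rewrite /psum scaler_sumr -big_split; apply: eq_bigr => k _ /=.
by rewrite dotDl dotZl scalerDl scalerA.
Qed.

Lemma psum_cat x y m n p u : (m <= n)%N -> (n <= p)%N ->
  psum x y m p u = psum x y m n u + psum x y n p u.
Proof. exact: big_cat_nat. Qed.

Lemma psum_adj x y m n u v : dot (psum x y m n u) v = dot u (psum y x m n v).
Proof.
rewrite dot_suml dot_sumr; apply: eq_bigr => k _.
by rewrite dotZl dotZr -dotC mulrC.
Qed.

(** Swapping the two sequences gives the adjoint partial sum, and an operator and its adjoint have
    the same norm: pair [w] with itself, move the sum to the other side and divide by the norm of
    [w]. *)
Lemma uniform_sum_dual x y eta : uniform_sum x y eta -> uniform_sum y x eta.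
Proof.
move=> [eta0 eta_ge0 he]; split=> // m n v mn; set w := psum _ _ _ _ _.
have [w0|wn0] := eqVneq (hnorm w) 0.
  by rewrite w0 mulr_ge0 ?hnorm_ge0.
have wp : 0 < hnorm w by rewrite lt_neqAle eq_sym wn0 hnorm_ge0.
rewrite -(ler_pM2r wp) -expr2 sqr_hnorm// /nsq.
rewrite {1}/w -psum_adj.
apply: le_trans (ler_norm _) _; apply: le_trans (Re_dot_le _ _) _.
rewrite mulrAC ler_wpM2r ?hnorm_ge0//.
exact: he.
Qed.

Section OpSum.
Variables (x y : nat -> H) (eta : nat -> R).
Hypothesis xy : uniform_sum x y eta.

Let eta_cvg : eta @ \oo --> (0 : R). Proof. by case: xy. Qed.
Let eta_ge0 m : 0 <= eta m. Proof. by case: xy. Qed.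
Let psum_le m n u : (m <= n)%N -> hnorm (psum x y m n u) <= eta m * hnorm u.
Proof. by case: xy => _ _; exact. Qed.

Lemma opsum_ex : exists F, is_opsum x y F.
Proof.
suff /choice[F hF] : forall u, exists v, hcvg (psum x y 0 ^~ u) v by exists F.
move=> u; apply: (dot_complete hH) => e e0.
have : (fun m => 2 * (eta m * hnorm u)) @ \oo --> (0 : R).
  rewrite -(mulr0 2) -(mul0r (hnorm u)).
  by apply: cvgMr; apply: cvgMl; exact: eta_cvg.
move=> /cvgrPdist_lt/(_ e e0)[N _ hN]; exists N => i j Ni Nj.
rewrite (psum_cat x y _ (leq0n N) Ni) (psum_cat x y _ (leq0n N) Nj).
rewrite opprD addrACA subrr add0r.
apply: le_lt_trans (hN N (leqnn N)).
rewrite sub0r normrN ger0_norm ?mulr_ge0 ?mulr_ge0 ?hnorm_ge0//.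
apply: le_trans (hnormD _ _) _; rewrite hnormN mulr2n mulrDl !mul1r.
by apply: lerD; exact: psum_le.
Qed.

Variable F : H -> H.
Hypothesis hF : is_opsum x y F.

Lemma opsum_tail N u : hnorm (F u - psum x y 0 N u) <= eta N * hnorm u.
Proof.
have h : hnorm (psum x y 0 k u - psum x y 0 N u) @[k --> \oo] -->
    hnorm (F u - psum x y 0 N u).
  by apply: cvg_hnorm => //; apply: (hcvgB (hF u)); exact: hcvg_cst.
rewrite -(cvg_lim _ h)//; apply: limr_le; first by apply/cvg_ex; eexists; exact: h.
exists N => // k /= Nk; rewrite (psum_cat x y _ (leq0n N) Nk) addrAC subrr add0r.
exact: psum_le.
Qed.

Lemma opsum_lin : lin F.
Proof.
move=> a u v; apply: (hcvg_unique (hF (a *: u + v))).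
under [X in hcvg X _]eq_fun do rewrite psum_lin.
by apply: hcvgD => //; apply: hcvgZ.
Qed.

Lemma opsum_bounded : bounded_operator dot F.
Proof.
split; first exact/lin_operator/opsum_lin.
by exists (eta 0) => u; have := opsum_tail 0 u; rewrite /psum big_geq// subr0.
Qed.

(** A norm limit of finite-rank operators is compact. The remainder after [N] terms separates
    bounded vectors by at most e / 2; the first [N] coefficients are made almost constant along a
    subsequence by the pigeonhole principle. *)
Lemma opsum_compact : compact_operator dot F.
Proof.
apply: cauchy_subseq_compact => u [M uM] e I e0 Ii.
have M0 : 0 <= M by exact: le_trans (hnorm_ge0 _) (uM 0%N).
have [N _ hN] : \forall N \near \oo, eta N * (2 * M) < e / 2.
  have : eta k * (2 * M) @[k --> \oo] --> (0 : R).
    by rewrite -(mul0r (2 * M)); apply: cvgMl; exact: eta_cvg.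
  have e2 : 0 < e / 2 by rewrite divr_gt0.
  move=> /cvgrPdist_lt/(_ _ e2).
  by apply: filterS => k; rewrite sub0r normrN; apply: le_lt_trans; exact: ler_norm.
have {hN} hN := hN N (leqnn N).
pose Y := \sum_(0 <= k < N) hnorm (y k).
have Y0 : 0 <= Y by apply: sumr_ge0 => k _; exact: hnorm_ge0.
(* Real and imaginary parts each vary by at most [d], hence a coefficient by at most [2 * d] and the
   truncated sum by at most [2 * d * Y], which is at most e / 2. The added 1 covers [Y = 0]. *)
pose d := e / (4 * (Y + 1)).
have d0 : 0 < d by rewrite divr_gt0// mulr_gt0// ltr_wpDl.
have bd n k : normc (dot (u k) (x n)) <= M * hnorm (x n).
  apply: le_trans (cauchy_schwarz _ _) _.
  by rewrite ler_wpM2r ?hnorm_ge0.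
have ReB n k : `|Re (dot (u k) (x n))| <= M * hnorm (x n).
  exact: le_trans (ler_Re_normc _) (bd _ _).
have ImB n k : `|complex.Im (dot (u k) (x n))| <= M * hnorm (x n).
  apply: le_trans (bd n k); case: (dot _ _) => a b /=.
  by rewrite -sqrtr_sqr ler_wsqrtr// lerDr sqr_ge0.
have [J [JI Ji] Je] := infinite_refine_reals N ReB d0 Ii.
have [K [KJ Ki] Ke] := infinite_refine_reals N ImB d0 Ji.
exists K; first by split=> // k /KJ/JI.
move=> i j Kk Kj; rewrite -linB; last exact: opsum_lin.
rewrite -[F _](subrK (psum x y 0 N (u i - u j))).
apply: le_trans (hnormD _ _) _.
have -> : e = e / 2 + e / 2 by field.
apply: lerD.
  apply: le_trans (opsum_tail N _) _; apply: le_trans (ltW hN).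
  rewrite ler_wpM2l//.
  apply: le_trans (hnormD _ _) _.
  by rewrite hnormN mulr2n mulrDl mul1r lerD.
apply: le_trans (hnorm_sum _ _ _) _.
apply: (@le_trans _ _ (2 * d * Y)).
  rewrite /Y mulr_sumr big_nat [leRHS]big_nat; apply: ler_sum => k /andP[_ kN].
  rewrite hnormZ ler_wpM2r ?hnorm_ge0// dotBl.
  have := Je k i j kN (KJ _ Kk) (KJ _ Kj); have := Ke k i j kN Kk Kj.
  case: (dot (u i) (x k)) (dot (u j) (x k)) => [a b] [a' b'] /= h1 h2.
  have d2 : 0 <= 2 * d by rewrite mulr_ge0// ltW.
  rewrite -(ger0_norm d2) -sqrtr_sqr ler_wsqrtr// exprMn.
  rewrite -(real_normK (num_real (a - a'))) -(real_normK (num_real (b - b'))).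
  have : `|a - a'| ^+ 2 <= d ^+ 2 by rewrite ler_sqr ?nnegrE ?normr_ge0// ltW.
  have : `|b - b'| ^+ 2 <= d ^+ 2 by rewrite ler_sqr ?nnegrE ?normr_ge0// ltW.
  by nra.
rewrite /d; have Y1 : 0 < Y + 1 by rewrite ltr_wpDl.
rewrite -subr_ge0 (_ : _ - _ = e / (2 * (Y + 1))); last by field; lra.
by rewrite divr_ge0 ?mulr_ge0 ?(ltW Y1)// ltW.
Qed.

Lemma opsum_adjoint G : is_opsum y x G -> is_adjoint dot F G.
Proof.
move=> hG u v; have: (fun w => dot (F w) v) =1 (fun w => dot w (G v)); last exact.
apply: Re_dot_ext.
- by move=> a w; rewrite linZ ?dotZl//; exact: opsum_lin.
- by move=> a w; rewrite dotZl.
move=> w; have h1 := cvg_Re_dotl (y := v) (hF w); have h2 := cvg_Re_dotr (y := w) (hG v).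
rewrite -(cvg_lim _ h1)// -(cvg_lim _ h2)//; congr (lim (_ @ \oo)).
by apply/funext => k; rewrite psum_adj.
Qed.

End OpSum.

(* Null vectors are allowed, so that finite families are sequences as well. *)
Definition orthosys (e : nat -> H) :=
  (forall i j, i != j -> dot (e i) (e j) = 0) /\
  (forall i, nsq (e i) = 0 \/ nsq (e i) = 1).

(** * Orthonormal systems and Bessel's inequality *)

Section Ortho.
Variable e : nat -> H.
Hypothesis eo : orthosys e.

Lemma orthosys_nsq_le1 k : nsq (e k) <= 1.
Proof. by have [_ /(_ k)[->|->]] := eo. Qed.

(** At a null vector the coefficient vanishes too; this is what keeps the orthonormal formulas valid
    in the presence of null vectors. *)
Lemma orthosys_coef u k : normc (dot u (e k)) ^+ 2 * nsq (e k) = normc (dot u (e k)) ^+ 2.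
Proof.
have [_ /(_ k)[h|->]] := eo; last by rewrite mulr1.
by rewrite (nsq_eq0 h) dot0r normc0 expr0n mul0r.
Qed.

Lemma nsq_osum (c : nat -> C) m n :
  nsq (\sum_(m <= k < n) c k *: e k) = \sum_(m <= k < n) normc (c k) ^+ 2 * nsq (e k).
Proof.
elim: n => [|n ih]; first by rewrite !big_geq// nsq0.
have [mn|nm] := leqP m n; last by rewrite !big_geq// nsq0.
rewrite !big_nat_recr//= nsqD// ih nsqZ// dot_suml (_ : Re _ = 0) ?mulr0 ?addr0//.
rewrite big_nat big1// => k /andP[_ kn]; rewrite dotZl dotZr eo.1 ?mulr0//.
by rewrite ltn_eqF.
Qed.

Lemma Re_dot_proj m n u :
  Re (dot u (psum e e m n u)) = \sum_(m <= k < n) normc (dot u (e k)) ^+ 2.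
Proof.
rewrite dot_sumr Re_sum; apply: eq_bigr => k _.
by rewrite dotZr mulrC mul_conj.
Qed.

Lemma nsq_proj m n u : nsq (psum e e m n u) = \sum_(m <= k < n) normc (dot u (e k)) ^+ 2.
Proof. by rewrite nsq_osum; apply: eq_bigr => k _; exact: orthosys_coef. Qed.

Lemma nsq_resid m n u : nsq (u - psum e e m n u) =
  nsq u - \sum_(m <= k < n) normc (dot u (e k)) ^+ 2.
Proof. by rewrite nsqB nsq_proj Re_dot_proj; ring. Qed.

Lemma bessel m n u : \sum_(m <= k < n) normc (dot u (e k)) ^+ 2 <= nsq u.
Proof. by rewrite -subr_ge0 -nsq_resid nsq_ge0. Qed.

Lemma hnorm_resid m n u : hnorm (u - psum e e m n u) <= hnorm u.
Proof.
rewrite ler_hnorm nsq_resid gerBl; apply: sumr_ge0 => k _; exact: sqr_ge0.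
Qed.

Lemma dot_resid n u j : (j < n)%N -> dot (u - psum e e 0 n u) (e j) = 0.
Proof.
move=> jn; rewrite dotBl dot_suml (bigD1_seq j) ?mem_index_iota ?iota_uniq//=.
rewrite big1 => [|k kj]; last by rewrite dotZl eo.1 ?mulr0.
rewrite addr0 dotZl dot_self; have [_ /(_ j)[h|->]] := eo.
  by rewrite (nsq_eq0 h) dot0r mul0r subrr.
by rewrite mulr1 subrr.
Qed.

(** Orthogonality is of use only on the output side, so the estimate is made for the dual sum of <v,
    y_k> e_k, whose squared norm is at most |v|^2 times the sum of the |y_k|^2, and is then
    transferred by [uniform_sum_dual]. The rate is the square root of the tail of that series. *)
Lemma uniform_sum_hs (y : nat -> H) :
  (exists M, forall N, \sum_(0 <= k < N) nsq (y k) <= M) ->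
  exists eta, uniform_sum e y eta.
Proof.
move=> [M yM].
pose S n := \sum_(0 <= k < n) nsq (y k).
have S_nd : nondecreasing_seq S.
  apply/nondecreasing_seqP => n; rewrite /S big_nat_recr//= lerDl; exact: nsq_ge0.
have S_cvg : cvgn S.
  by apply: nondecreasing_is_cvgn => //; exists M => _ [n _ <-]; exact: yM.
pose L := limn S.
have SL n : S n <= L by exact: nondecreasing_cvgn_le.
exists (fun m => Num.sqrt (L - S m)); apply: uniform_sum_dual; split.
- have -> : (0 : R) = Num.sqrt (L - L) by rewrite subrr sqrtr0.
  apply: (@cvg_comp _ _ _ (fun m => L - S m) Num.sqrt _ (nbhs (L - L))).
    by apply: cvgB => //; exact: cvg_cst.
  exact: sqrt_continuous.
- by move=> m; exact: sqrtr_ge0.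
move=> m n v mn.
have h0 : 0 <= Num.sqrt (L - S m) * hnorm v by rewrite mulr_ge0 ?sqrtr_ge0 ?hnorm_ge0.
rewrite hnorm_le// exprMn sqr_sqrtr ?subr_ge0// sqr_hnorm nsq_osum.
apply: (@le_trans _ _ (\sum_(m <= k < n) nsq (y k) * nsq v)).
  apply: ler_sum => k _; rewrite -[leRHS]mulr1.
  apply: ler_pM => //; rewrite ?sqr_ge0 ?nsq_ge0//; last exact: orthosys_nsq_le1.
  rewrite -!sqr_hnorm -exprMn ler_sqr ?nnegrE ?normc_ge0 ?mulr_ge0 ?hnorm_ge0//.
  by rewrite mulrC; exact: cauchy_schwarz.
rewrite -mulr_suml ler_wpM2r ?nsq_ge0//.
rewrite lerBrDl /S -big_cat_nat//; exact: SL.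
Qed.

(** From index m on, all factors are at most [lam m], so by Bessel's inequality [lam] is its own
    rate. *)
Lemma uniform_sum_diag (lam : nat -> R) : (forall k, 0 <= lam k) ->
  (forall m n, (m <= n)%N -> lam n <= lam m) -> lam @ \oo --> (0 : R) ->
  uniform_sum e (fun k => (lam k)%:C *: e k) lam.
Proof.
move=> lam0 lamd lamc; split=> // m n u mn.
rewrite hnorm_le ?mulr_ge0 ?hnorm_ge0// exprMn sqr_hnorm.
rewrite /psum; under eq_bigr do rewrite scalerA.
rewrite nsq_osum.
apply: (@le_trans _ _ (\sum_(m <= k < n) lam m ^+ 2 * normc (dot u (e k)) ^+ 2)).
  rewrite big_nat [leRHS]big_nat; apply: ler_sum => k /andP[mk _].
  rewrite normcM exprMn -mulrA mulrC -mulrA [nsq _ * _]mulrC orthosys_coef.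
  rewrite ler_wpM2r ?sqr_ge0// sqr_normc_real ler_sqr ?nnegrE//.
  exact: lamd.
by rewrite -mulr_sumr ler_wpM2l ?sqr_ge0// bessel.
Qed.

End Ortho.

(** * Maximising the quadratic form of a compact positive operator *)

Section EigenMax.
Variables (P : H -> H) (W : H -> Prop).
Hypotheses (Pb : bounded_operator dot P) (Pc : compact_operator dot P).
Hypothesis Psym : forall u v, dot (P u) v = dot u (P v).
Hypothesis Ppos : forall u, 0 <= dot (P u) u.
Hypotheses (W0 : W 0) (WL : forall a u v, W u -> W v -> W (a *: u + v)).
Hypothesis Wcl : forall (u : nat -> H) v, (forall k, W (u k)) -> hcvg u v -> W v.
Hypothesis WP : forall u, W u -> W (P u).

Let Pl := bounded_lin Pb.
Let q u := Re (dot (P u) u).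

(** The Cauchy-Schwarz inequality for the form <P u, v> at v = P u gives |P u|^4 <= q(u) q(P u) <=
    l^2 |u|^2 |P u|^2; the invariance of [W] allows the bound to be applied at P u. *)
Lemma positive_form_norm (l : R) : 0 <= l -> (forall u, W u -> q u <= l * nsq u) ->
  forall u, W u -> hnorm (P u) <= l * hnorm u.
Proof.
move=> l0 ql u Wu; rewrite hnorm_le ?mulr_ge0 ?hnorm_ge0//.
rewrite exprMn sqr_hnorm.
have [->|n0] := eqVneq (nsq (P u)) 0; first by rewrite mulr_ge0 ?sqr_ge0 ?nsq_ge0.
have np : 0 < nsq (P u) by rewrite lt_neqAle eq_sym n0 nsq_ge0.
have cs : normc (dot (P u) (P u)) ^+ 2 <= q u * q (P u).
  apply: (@form_cauchy_schwarz _ _ setT (fun u v => dot (P u) v)) => //.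
  - by move=> a x y w _ _ _; rewrite Pl dotDl dotZl.
  - by move=> x y _ _; rewrite Psym dotC.
rewrite dot_self normc_real ger0_norm ?nsq_ge0// in cs.
have h : q u * q (P u) <= (l * nsq u) * (l * nsq (P u)).
  apply: ler_pM; [| |exact: ql|exact/ql/WP].
    by have [] := complex_ge0E (Ppos u).
  by have [] := complex_ge0E (Ppos (P u)).
rewrite -(ler_pM2r np) -expr2; apply: (le_trans cs); apply: (le_trans h).
by rewrite le_eqVlt; apply/orP; left; apply/eqP; ring.
Qed.

(** [W] will be the orthogonal complement of the eigenvectors already found. The eigenvalue is the
    supremum of the form on the unit ball of [W]. When it is 0, the null vector is returned, so that
    the iteration never has to stop. *)
Lemma eigen_max : exists e l, [/\ W e, 0 <= l, P e = l%:C *: e,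
  (l != 0 -> nsq e = 1) /\ (l = 0 -> e = 0) &
  forall u, W u -> hnorm (P u) <= l * hnorm u].
Proof.
have [M M0 PM] := bounded_pos Pb.
pose E := [set q u | u in [set u | W u /\ nsq u <= 1]].
have E0 : E 0 by exists 0; [split; rewrite ?nsq0|rewrite /q dot0r].
have Eub : ubound E M.
  move=> _ [u [Wu u1] <-]; apply: le_trans (ler_norm _) _.
  apply: le_trans (Re_dot_le _ _) _.
  have hu : hnorm u <= 1 by rewrite hnorm_le// expr1n.
  apply: le_trans (ler_wpM2r (hnorm_ge0 u) (PM u)) _.
  rewrite -mulrA -[leRHS]mulr1 ler_wpM2l ?(ltW M0)//.
  by rewrite -[leRHS]mulr1 ler_pM ?hnorm_ge0.
have Es : has_sup E by split; [exists 0|exists M].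
pose l := sup E.
have l0 : 0 <= l by exact: sup_upper_bound.
have qZ (a : R) u : q (a%:C *: u) = a ^+ 2 * q u.
  rewrite /q (linZ _ _ Pl) dotZl dotZr mulrA mul_conj ReM_real.
  by rewrite sqr_normc_real.
have ql u : W u -> q u <= l * nsq u.
  move=> Wu; have [u0|un0] := eqVneq (nsq u) 0.
    by rewrite u0 mulr0 (nsq_eq0 u0) /q dot0r.
  have np : 0 < nsq u by rewrite lt_neqAle eq_sym un0 nsq_ge0.
  have hp : hnorm u != 0 by rewrite -(sqrf_eq0 (hnorm u)) sqr_hnorm.
  have : q ((hnorm u)^-1%:C *: u) <= l.
    apply: (sup_upper_bound Es); exists ((hnorm u)^-1%:C *: u) => //; split.
      by rewrite -[_ *: _]addr0; exact: WL.
    by rewrite nsqZ sqr_normc_real exprVn sqr_hnorm mulVf.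
  by rewrite qZ exprVn sqr_hnorm mulrC ler_pdivrMr.
have Pn := positive_form_norm l0 ql.
have [lz|ln0] := eqVneq l 0.
  by exists 0, l; split=> //; [rewrite lin0// scaler0|split=> //; rewrite lz eqxx].
have lp : 0 < l by rewrite lt_neqAle eq_sym ln0.
have /choice[u hu] : forall k : nat, exists u, [/\ W u, nsq u <= 1 & l - k.+1%:R^-1 < q u].
  move=> k; have k0 : 0 < k.+1%:R^-1 :> R by rewrite invr_gt0.
  by have [_ [u [Wu u1] <-] hu] := sup_adherent k0 Es; exists u.
have u1 k : hnorm (u k) <= 1.
  by rewrite hnorm_le// expr1n; have [] := hu k.
have [s [v [si sv]]] := Pc (ex_intro _ 1 u1).
(* A maximising sequence is asymptotically an eigenvector: |P u - l u|^2 = |P u|^2 - 2 l q(u) + l^2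
   |u|^2 <= 2 l^2 - 2 l (l - 1 / (k + 1)) = 2 l / (k + 1). *)
have res : hcvg (fun k => P (u k) - l%:C *: u k) 0.
  apply: (@hcvg_squeeze _ _ (fun k => Num.sqrt (2 * l * harmonic k))).
    move=> k; rewrite subr0 hnorm_le ?sqrtr_ge0// sqr_sqrtr; last first.
      by rewrite mulr_ge0 ?mulr_ge0// ?invr_ge0.
    have [Wu nu qu] := hu k.
    rewrite nsqB nsqZ sqr_normc_real dotZr conjc_real ReM_real -/(q _).
    have : nsq (P (u k)) <= l ^+ 2.
      by rewrite -hnorm_le//; apply: le_trans (Pn _ Wu) _; rewrite ler_piMr.
    have : l ^+ 2 * nsq (u k) <= l ^+ 2 by rewrite ler_piMr ?sqr_ge0.
    have : l * (l - k.+1%:R^-1) < l * q (u k) by rewrite ltr_pM2l.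
    rewrite (_ : harmonic k = k.+1%:R^-1)//.
    by move: (k.+1%:R^-1) (nsq (P _)) (l ^+ 2 * nsq _) (q _) => h a b c; nra.
  have -> : (0 : R) = Num.sqrt (2 * l * 0) by rewrite mulr0 sqrtr0.
  apply: (@cvg_comp _ _ _ _ Num.sqrt _ (nbhs (2 * l * 0))); last exact: sqrt_continuous.
  apply: cvgMr; exact: cvg_harmonic.
(* Since P u - l u tends to 0, the multiples l u have the same limit [v] as the images P u; applying
   [P] to them shows that [v] is an eigenvector. *)
have luv : hcvg (fun k => l%:C *: u (s k)) v.
  have := hcvgB sv (hcvg_subseq si res).
  by rewrite subr0; under [X in hcvg X _ -> _]eq_fun do rewrite /= opprB addrCA subrr addr0.
have Wv : W v.
  apply: Wcl luv => k; rewrite -[_ *: _]addr0; apply: WL => //.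
  by have [] := hu (s k).
have Pv : P v = l%:C *: v.
  apply: (hcvg_unique (bounded_hcvg Pb luv)).
  have := hcvgZ l%:C sv.
  by under [X in hcvg X _ -> _]eq_fun do rewrite -(linZ _ _ Pl).
(* The limit is not 0: |P u| >= q(u) > l - 1 / (k + 1), because |u| <= 1. *)
have lv : l <= hnorm v.
  have h := cvg_hnorm sv.
  have h2 : l - (harmonic k : R) @[k --> \oo] --> l - 0.
    by apply: cvgB; [exact: cvg_cst|exact: cvg_harmonic].
  rewrite subr0 in h2; rewrite -(cvg_lim _ h)// -(cvg_lim _ h2)//.
  apply: ler_lim; [by apply/cvg_ex; eexists; exact: h2|by apply/cvg_ex; eexists; exact: h|].
  apply: nearW => k; have [Wu nu qu] := hu (s k).
  apply: le_trans (_ : l - (s k).+1%:R^-1 <= _).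
    by rewrite lerB// /harmonic lef_pV2 ?posrE// ler_nat ltnS homo_ltn_ge_id.
  apply: ltW; apply: lt_le_trans qu _.
  apply: le_trans (ler_norm _) _; apply: le_trans (Re_dot_le _ _) _.
  by rewrite ler_piMr ?hnorm_ge0.
have hv : hnorm v != 0 by rewrite gt_eqF// (lt_le_trans lp).
exists ((hnorm v)^-1%:C *: v), l; split=> //.
- by rewrite -[_ *: _]addr0; exact: WL.
- by rewrite (linZ _ _ Pl) Pv !scalerA mulrC.
- split; last by move=> lz; rewrite lz eqxx in ln0.
  by move=> _; rewrite nsqZ sqr_normc_real exprVn sqr_hnorm mulVf// -sqr_hnorm sqrf_eq0.
Qed.

End EigenMax.

Lemma hcvg_dot0 (u : nat -> H) v w : (forall k, dot (u k) w = 0) -> hcvg u v ->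
  dot v w = 0.
Proof.
move=> u0 uv; apply: eq0_normc; apply/eqP; rewrite eq_le normc_ge0 andbT.
apply/ler_addgt0Pl => e e0; rewrite addr0.
have := uv; move/hcvgP; move=> /(_ (e / (hnorm w + 1))).
have w1 : 0 < hnorm w + 1 by rewrite ltr_wpDl ?hnorm_ge0.
rewrite divr_gt0// => /(_ isT)[N /(_ _ (leqnn N)) hN].
have -> : dot v w = - dot (u N - v) w by rewrite dotBl u0 sub0r opprK.
rewrite normcN; apply: le_trans (cauchy_schwarz _ _) _.
apply: le_trans (_ : e / (hnorm w + 1) * hnorm w <= _).
  by rewrite ler_wpM2r ?hnorm_ge0// ltW.
by rewrite mulrAC ler_pdivrMr// ler_wpM2l ?(ltW e0)// lerDl.
Qed.

(** * The spectral theorem *)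

(** Only the vectors with nonzero eigenvalue must be unit vectors, so that an operator of finite
    rank is also described by a full sequence, padded with null vectors. *)
Record spectral (P : H -> H) (e : nat -> H) (lam : nat -> R) : Prop := Spectral {
  spectral_ortho : orthosys e;
  spectral_eigen : forall k, P (e k) = (lam k)%:C *: e k;
  spectral_ge0 : forall k, 0 <= lam k;
  spectral_noninc : forall m n, (m <= n)%N -> lam n <= lam m;
  spectral_cvg : lam @ \oo --> (0 : R);
  spectral_unit : forall k, lam k != 0 -> nsq (e k) = 1;
  spectral_sum : is_opsum e (fun k => (lam k)%:C *: e k) P }.

Section SpectralTheorem.
Variable P : H -> H.
Hypotheses (Pb : bounded_operator dot P) (Pc : compact_operator dot P).
Hypothesis Psym : forall u v, dot (P u) v = dot u (P v).
Hypothesis Ppos : forall u, 0 <= dot (P u) u.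

Let eigvec v := exists l : R, P v = l%:C *: v.
Let good (s : seq H) (p : H * R) := [/\ (forall v, v \in s -> dot p.1 v = 0),
  0 <= p.2, P p.1 = p.2%:C *: p.1, (p.2 != 0 -> nsq p.1 = 1) /\ (p.2 = 0 -> p.1 = 0) &
  forall u, (forall v, v \in s -> dot u v = 0) -> hnorm (P u) <= p.2 * hnorm u].

Let good_ex (s : seq H) : exists p, (forall v, v \in s -> eigvec v) -> good s p.
Proof.
have [se|] := pselect (forall v, v \in s -> eigvec v); last by exists (0, 0).
pose W u := forall v, v \in s -> dot u v = 0.
have WL a u v : W u -> W v -> W (a *: u + v).
  by move=> Wu Wv w ws; rewrite dotDl dotZl Wu// Wv// mulr0 addr0.
have Wcl (u : nat -> H) v : (forall k, W (u k)) -> hcvg u v -> W v.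
  by move=> Wu uv w ws; apply: hcvg_dot0 uv => k; exact: Wu.
have WP u : W u -> W (P u).
  by move=> Wu w ws; rewrite Psym; have [l ->] := se _ ws; rewrite dotZr Wu// mulr0.
have W0 : W 0 by move=> w _; rewrite dot0l.
have [e [l [We l0 Pe el lP]]] := eigen_max Pb Pc Psym Ppos W0 WL Wcl WP.
by exists (e, l).
Qed.

(** The form is maximised again and again on the complement of the eigenvectors found so far. The
    eigenvalues decrease as the complements shrink. They tend to 0: if all were at least d, the
    images of the orthonormal eigenvectors would stay at mutual distance at least d, against
    compactness. The residual of u after N projections lies in the N-th complement, where P is
    bounded by [lam N]; hence the expansion. *)
Lemma spectral_theorem : exists e lam, spectral P e lam.
Proof.
have [f hf] := choice good_ex.
pose pre := fix pre n : seq H := if n is m.+1 then rcons (pre m) (f (pre m)).1 else [::].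
pose e k := (f (pre k)).1; pose lam k := (f (pre k)).2.
have preE n v : v \in pre n -> exists2 k, (k < n)%N & v = e k.
  elim: n => // n ih; rewrite /= mem_rcons inE => /orP[/eqP->|/ih[k kn ->]].
    by exists n.
  by exists k => //; exact: ltnW.
have e_pre n k : (k < n)%N -> e k \in pre n.
  elim: n => // n ih; rewrite ltnS leq_eqVlt /= mem_rcons inE => /orP[/eqP->|/ih->].
    by rewrite eqxx.
  by rewrite orbT.
have pre_eig n : forall v, v \in pre n -> eigvec v.
  elim: n => // n ih v; rewrite /= mem_rcons inE => /orP[/eqP->|/ih//].
  by have [_ _ ? _ _] := hf _ ih; exists (lam n).
have g n := hf _ (pre_eig n).
have eo : orthosys e.
  split; last first.
    move=> i; have [_ _ _ [l1 l0] _] := g i.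
    have [/l0 ei|/l1 ei] := eqVneq (f (pre i)).2 0; last by right.
    by left; rewrite /e ei nsq0.
  move=> i j; rewrite neq_ltn => /orP[ij|ij].
    by rewrite dotC; have [-> //] := g j; [rewrite conjc0|exact: e_pre].
  by have [-> //] := g i; exact: e_pre.
have lam0 k : 0 <= lam k by have [] := g k.
have lamS n : lam n.+1 <= lam n.
  have [s1 _ Pe [l1 l0] _] := g n.+1; have [_ _ _ _ h] := g n.
  have [lz|/l1 en] := eqVneq (f (pre n.+1)).2 0; first by rewrite /lam lz; exact: lam0.
  have := h (e n.+1); rewrite /e Pe hnormZr /hnorm -!/(nsq _) en sqrtr1 !mulr1.
  rewrite ger0_norm ?(lam0 n.+1)//; apply => v vn; apply: s1.
  by rewrite /= mem_rcons inE vn orbT.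
have lamd m n : (m <= n)%N -> lam n <= lam m.
  elim: n => [|n ih]; first by rewrite leqn0 => /eqP->.
  by rewrite leq_eqVlt => /orP[/eqP->//|/ih]; exact: le_trans (lamS n).
have lamc : lam @ \oo --> (0 : R).
  apply/cvgrPdist_lt => d d0; apply: contrapT => nd.
  have dlam k : d <= lam k.
    rewrite leNgt; apply/negP => kd; apply: nd; exists k => // j /= kj.
    by rewrite sub0r normrN ger0_norm// (le_lt_trans (lamd _ _ kj)).
  have e1 k : nsq (e k) = 1.
    by have [_ _ _ [l1 _] _] := g k; apply: l1; rewrite gt_eqF// (lt_le_trans d0 (dlam k)).
  have eb : exists M : R, forall k, hnorm (e k) <= M.
    by exists 1 => k; rewrite hnorm_le// expr1n e1.
  have [s [v [si sv]]] := Pc eb.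
  have d2 : 0 < d / 2 by rewrite divr_gt0.
  have [N hN] := (hcvgP _ _).1 sv _ d2.
  have : hnorm (P (e (s N)) - P (e (s N.+1))) < d.
    apply: le_lt_trans (hnorm_triangle v _ _) _; rewrite [ltRHS]splitr (hnormBC v).
    by rewrite ltrD// hN.
  apply/negP; rewrite -leNgt -ler_sqr ?nnegrE ?hnorm_ge0 ?(ltW d0)//.
  have [_ _ P1 _ _] := g (s N); have [_ _ P2 _ _] := g (s N.+1).
  rewrite sqr_hnorm /e P1 P2 -/(lam _) -/(lam _) -/(e _) -/(e _).
  rewrite nsqB !nsqZ !sqr_normc_real !e1 dotZl dotZr eo.1; last first.
    by rewrite neq_ltn si.
  rewrite !mulr0 subr0 !mulr1.
  have : d ^+ 2 <= lam (s N) ^+ 2 by rewrite ler_sqr ?nnegrE ?(ltW d0).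
  by have := sqr_ge0 (lam (s N.+1)); lra.
exists e, lam; split=> //.
- by move=> k; have [] := g k.
- by move=> k; have [_ _ _ []] := g k.
move=> u; apply: (@hcvg_squeeze _ _ (fun N => lam N * hnorm u)); last first.
  by rewrite -[X in _ --> X](mul0r (hnorm u)); exact: cvgMl.
move=> N.
have -> : psum e (fun k => (lam k)%:C *: e k) 0 N u = P (psum e e 0 N u).
  rewrite (lin_sum _ _ _ (bounded_lin Pb)); apply: eq_bigr => k _.
  by rewrite (linZ _ _ (bounded_lin Pb)); have [_ _ -> _ _] := g k.
rewrite hnormBC -(linB _ _ (bounded_lin Pb)).
have [_ _ _ _ h] := g N; apply: le_trans (h _ _) _.
  by move=> v /preE[k kN ->]; exact: dot_resid.
by apply: ler_wpM2l; [exact: lam0|exact: (hnorm_resid eo)].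
Qed.

End SpectralTheorem.

Lemma adjoint_sym S S' : is_adjoint dot S S' -> is_adjoint dot S' S.
Proof. by move=> SS u v; rewrite dotC -SS -dotC. Qed.

Lemma adjoint_selfadjoint A : is_adjoint dot A A -> selfadjoint_operator dot setT A.
Proof.
move=> AA; split; first by move=> u e e0; exists u => //; rewrite subrr hnorm0.
move=> u v; split=> [[_ <-] w _|h]; first exact: AA.
split=> //; apply: eq_dotr => w; rewrite -AA; exact: h.
Qed.

Lemma selfadjoint_adjoint A : selfadjoint_operator dot setT A -> is_adjoint dot A A.
Proof. by move=> [_ h] u v; have [h1 _] := h v (A v); apply: h1. Qed.

Lemma adjoint_pos A u : is_adjoint dot A A -> 0 <= Re (dot (A u) u) -> 0 <= dot (A u) u.
Proof.
move=> AA; have := AA u u; rewrite [RHS]dotC; case: (dot _ _) => a b [] bb /= a0.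
by rewrite lecE /= a0 andbT; apply/eqP; lra.
Qed.

(** [A] is the diagonal series over the eigenvectors of S^* S with the square roots of the
    eigenvalues; these still decrease to 0, so [uniform_sum_diag] makes the series converge. *)
Lemma absolute_value_ex S S' : bounded_operator dot S -> compact_operator dot S ->
  bounded_operator dot S' -> is_adjoint dot S S' ->
  exists A, is_absolute_value dot S A.
Proof.
move=> Sb Sc S'b SS'.
pose P := S' \o S.
have Pb : bounded_operator dot P.
  have [M M0 SM] := bounded_pos Sb; have [M' M'0 SM'] := bounded_pos S'b.
  split.
    apply: lin_operator => a u v.
    by rewrite /P /= (bounded_lin Sb) (bounded_lin S'b).
  exists (M' * M) => u; apply: le_trans (SM' _) _.
  by rewrite -mulrA ler_wpM2l ?(ltW M'0).
have S'S := adjoint_sym SS'.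
have Psym u v : dot (P u) v = dot u (P v) by rewrite /P /= S'S SS'.
have Ppos u : 0 <= dot (P u) u by rewrite /P /= S'S; exact: dot_ge0.
have [e [lam [eo Pe lam0 lamd lamc lam1 Psum]]] :=
  spectral_theorem Pb (compact_comp S'b Sc) Psym Ppos.
pose mu k := Num.sqrt (lam k).
have muc : mu @ \oo --> (0 : R).
  by rewrite -sqrtr0; apply: (cvg_comp _ _ lamc); exact: sqrt_continuous.
have mud m n : (m <= n)%N -> mu n <= mu m by move=> mn; rewrite ler_wsqrtr// lamd.
have us := uniform_sum_diag eo (fun k => sqrtr_ge0 (lam k)) mud muc.
have [A hA] := opsum_ex us.
have Ab := opsum_bounded us hA.
have Al := bounded_lin Ab.
have AA : is_adjoint dot A A.
  suff h : is_opsum (fun k => (mu k)%:C *: e k) e A by exact: (opsum_adjoint hA h).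
  move=> u; have := hA u; congr (hcvg _ _); apply/funext => N; apply: eq_bigr => k _.
  by rewrite dotZr conjc_real !scalerA mulrC.
have Ae k : A (e k) = (mu k)%:C *: e k.
  apply: (hcvg_unique (hA (e k))); apply/hcvgP => d d0; exists k.+1 => N kN.
  rewrite /psum (bigD1_seq k) ?mem_index_iota ?iota_uniq//= big1 ?addr0; last first.
    by move=> j jk; rewrite eo.1 ?scale0r// eq_sym.
  rewrite dot_self scalerA mulrC -scalerA.
  have [_ /(_ k)[h|->]] := eo; last by rewrite scale1r subrr hnorm0.
  by rewrite (nsq_eq0 h) !scaler0 subr0 hnorm0.
exists A; split=> //; first exact: adjoint_selfadjoint.
  move=> u _; apply: adjoint_pos => //.
  have h := cvg_Re_dotl (y := u) (hA u); rewrite -(cvg_lim _ h)//.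
  apply: limr_ge; first by apply/cvg_ex; eexists; exact: h.
  apply: nearW => N; rewrite dot_suml Re_sum; apply: sumr_ge0 => k _.
  rewrite scalerA dotZl [_ * (mu k)%:C]mulrC -mulrA ReM_real mulr_ge0 ?sqrtr_ge0//.
  by rewrite (dotC u) mul_conj sqr_ge0.
exists S' => // u.
(* By continuity, A (A u) is the limit of [A] applied to the partial sums for A u, and these images
   are the partial sums of the spectral series of S^* S. *)
have := bounded_hcvg Ab (hA u); move=> /hcvg_unique; apply.
have := Psum u; congr (hcvg _ _); apply/funext => N; rewrite /= (lin_sum _ _ _ Al).
apply: eq_bigr => k _; rewrite !(linZ _ _ Al) Ae; congr (_ *: _).
rewrite scalerA -rmorphM /= -expr2 sqr_sqrtr//.
Qed.

Lemma absolute_value_nsq S A u : is_absolute_value dot S A -> nsq (A u) = nsq (S u).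
Proof.
move=> [Ab /selfadjoint_adjoint AA _ [S' SS' AAS]].
by rewrite /nsq AA AAS SS'.
Qed.

(** Since |A w| = |S w| for every w, [A] is Cauchy along any subsequence on which [S] converges. *)
Lemma absolute_value_compact S A : lin S -> compact_operator dot S ->
  is_absolute_value dot S A -> compact_operator dot A.
Proof.
move=> Sl Sc SA u uM; have [s [v [si sv]]] := Sc u uM.
have [Ab _ _ _] := SA.
have [w hw] : exists w, hcvg (fun k => A (u (s k))) w.
  apply: (dot_complete hH) => d d0.
  have d2 : 0 < d / 2 by rewrite divr_gt0.
  have [N hN] := (hcvgP _ _).1 sv _ d2; exists N => i j Ni Nj.
  rewrite -(linB _ _ (bounded_lin Ab)) /hnorm -/(nsq _) (absolute_value_nsq _ SA) -/(hnorm _).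
  rewrite (linB _ _ Sl); apply: le_lt_trans (hnorm_triangle v _ _) _.
  by rewrite [ltRHS]splitr (hnormBC v) ltrD// hN.
by exists s, w.
Qed.

(* [A + l] is injective since [A] is positive. *)
Lemma sqrt_eigen A v (l : R) : lin A -> positive_operator dot setT A -> 0 < l ->
  A (A v) = (l ^+ 2)%:C *: v -> A v = l%:C *: v.
Proof.
move=> Al Ap l0 AAv; set w := A v - l%:C *: v.
have Aw : A w = - (l%:C *: w).
  rewrite /w (linB _ _ Al) AAv (linZ _ _ Al) scalerBr scalerA -rmorphM /= -expr2.
  by rewrite opprB.
have := Ap w I; rewrite Aw dotNl dotZl => /complex_ge0E[_].
rewrite ReN ReM_real -/(nsq w) oppr_ge0 pmulr_rle0// => w0.
apply/eqP; rewrite -subr_eq0; apply/eqP/nsq_eq0/eqP.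
by rewrite eq_le w0 nsq_ge0.
Qed.

Let esum_mult (A : H -> H) (r : R) : \bar R :=
  (\esum_(l in [set l : R | (0 < l)%R]) ((l `^ r)%R%:E * multiplicity A (l%:C)%C))%E.

(** * Multiplicities of eigenvalues *)

Lemma multiplicity_ge A l k (u : 'I_k -> H) : (forall i, A (u i) = l *: u i) ->
  (forall c : 'I_k -> C, \sum_(i < k) c i *: u i = 0 -> forall i, c i = 0) ->
  ((k%:R : R)%:E <= multiplicity A l)%E.
Proof. by move=> Au uf; apply: ereal_sup_ubound; exists k => //; exists u. Qed.

Lemma multiplicity_ge0 A l : (0 <= multiplicity A l :> \bar R)%E.
Proof.
by apply: (@multiplicity_ge _ _ 0 (fun=> 0)) => [[]|c _ []].
Qed.

(** Indices are grouped by the value of [lam]. The eigenvectors belonging to one nonzero value are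
    orthonormal, hence independent, so their number is at most the multiplicity; the value 0
    contributes nothing as r > 0. *)
Lemma esum_multiplicity_ge A e (lam : nat -> R) (r : R) N : 0 < r -> orthosys e ->
  (forall k, A (e k) = (lam k)%:C *: e k) -> (forall k, 0 <= lam k) ->
  (forall k, lam k != 0 -> nsq (e k) = 1) ->
  ((\sum_(0 <= k < N) lam k `^ r)%:E <= esum_mult A r)%E.
Proof.
move=> r0 eo Ae lam0 lam1.
rewrite big_mkord.
pose L := undup [seq lam k | k <- iota 0 N & lam k != 0].
have LP l : l \in L -> l != 0 /\ 0 <= l.
  by rewrite mem_undup => /mapP[k]; rewrite mem_filter => /andP[k0 _] ->.
pose cnt l := #|[pred k : 'I_N | lam k == l]|.
apply: esum_ge; exists [set` L].
  split; first exact: finite_seq.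
  by move=> l /= /LP[l0 lge]; rewrite lt_neqAle eq_sym l0.
rewrite -fsbig_seq ?undup_uniq//.
apply: (@le_trans _ _ (\sum_(l <- L) ((l `^ r) * (cnt l)%:R)%:E)%E).
  rewrite sumEFin lee_fin.
  rewrite [leRHS](eq_bigr (fun l => \sum_(k < N) (lam k == l)%:R * l `^ r)); last first.
    move=> l _; rewrite -mulr_suml mulrC; congr (_ * _).
    rewrite /cnt -sum1_card natr_sum [LHS]big_mkcond; apply: eq_bigr => k _ /=.
    by rewrite inE; case: (_ == _).
  rewrite exchange_big /=; apply: ler_sum => k _.
  have [k0|k0] := eqVneq (lam k) 0.
    rewrite k0 powR0 ?gt_eqF//; apply: sumr_ge0 => l _.
    by rewrite mulr_ge0 ?powR_ge0.
  have kL : lam k \in L.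
    by rewrite mem_undup; apply/map_f; rewrite mem_filter k0 mem_iota /= add0n ltn_ord.
  rewrite (bigD1_seq (lam k)) ?undup_uniq//= eqxx mul1r lerDl.
  by apply: sumr_ge0 => l _; rewrite mulr_ge0 ?powR_ge0.
rewrite big_seq [leRHS]big_seq; apply: lee_sum => l /LP[l0 _].
rewrite EFinM lee_wpmul2l ?lee_fin ?powR_ge0//.
pose f (i : 'I_(cnt l)) : 'I_N := enum_val i.
have fl i : lam (f i) = l by apply/eqP; exact: (enum_valP i).
apply: (@multiplicity_ge _ _ _ (fun i => e (f i))) => [i|c c0 i].
  by rewrite Ae fl.
have := congr1 (fun z => dot z (e (f i))) c0.
rewrite dot0l dot_suml (bigD1 i)//= big1 ?addr0 => [|j ji]; last first.
  rewrite dotZl eo.1 ?mulr0//; apply: contra ji => /eqP fji.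
  by apply/eqP/(@enum_val_inj _ [pred k : 'I_N | lam k == l])/val_inj.
by rewrite dotZl dot_self lam1 ?mulr1// fl.
Qed.

(** Multiplicity counts independent families, whereas the estimates need orthonormal ones. While j <
    k, some [u i] lies outside the span of the j vectors built: otherwise the k x j matrix of
    coefficients would have a nonzero left kernel, that is, a linear relation among the [u i]. The
    normalised residual of such a [u i] is the next vector. *)
Lemma exists_eigenbasis A l k (u : 'I_k -> H) : lin A -> (forall i, A (u i) = l *: u i) ->
  (forall c : 'I_k -> C, \sum_(i < k) c i *: u i = 0 -> forall i, c i = 0) ->
  forall j, (j <= k)%N -> exists t : seq H, [/\ size t = j,
    forall a b, (a < b)%N -> dot (nth 0 t a) (nth 0 t b) = 0,
    forall a, (a < j)%N -> nsq (nth 0 t a) = 1 & forall v, v \in t -> A v = l *: v].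
Proof.
move=> Al Au uf; elim=> [|j ih] jk.
  by exists [::]; split=> // a b _; rewrite !nth_nil dot0l.
have [t [st to t1 tA]] := ih (ltnW jk).
pose w i := u i - \sum_(a < j) dot (u i) (nth 0 t a) *: nth 0 t a.
have to' a b : a != b -> dot (nth 0 t a) (nth 0 t b) = 0.
  by rewrite neq_ltn => /orP[/to//|/to h]; rewrite dotC h conjc0.
have [i wi] : exists i, w i != 0.
  apply/existsP; apply: contraT; rewrite negb_exists => /forallP w0.
  pose M : 'M[C]_(k, j) := \matrix_(i, a) dot (u i) (nth 0 t a).
  have : kermx M != 0.
    rewrite kermx_eq0 /row_free; apply/eqP => rM.
    by have := rank_leq_col M; rewrite rM leqNgt jk.
  case/rowV0Pn => c /sub_kermxP cM /eqP []; apply/rowP => i; rewrite mxE.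
  apply: (uf (fun i => c 0 i)).
  rewrite (eq_bigr (fun i => \sum_(a < j) (c 0 i * M i a) *: nth 0 t a)); last first.
    move=> i' _; have := w0 i'; rewrite negbK subr_eq0 => /eqP {1}->.
    by rewrite scaler_sumr; apply: eq_bigr => a _; rewrite scalerA mxE.
  rewrite exchange_big /= big1// => a _; rewrite -scaler_suml.
  by move/rowP: cM => /(_ a); rewrite !mxE => ->; rewrite scale0r.
have wp : nsq (w i) != 0 by apply: contra wi => /eqP/nsq_eq0/eqP.
have wt a : dot (w i) (nth 0 t a) = 0.
  have [aj|ja] := ltnP a j; last by rewrite nth_default ?st// dot0r.
  rewrite dotBl dot_suml (bigD1 (Ordinal aj))//= big1 => [|b ba]; last first.
    by rewrite dotZl to' ?mulr0//; apply: contra ba => /eqP ba; apply/eqP/val_inj.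
  by rewrite dotZl dot_self t1// mulr1 addr0 subrr.
pose v := ((hnorm (w i))^-1)%:C *: w i.
exists (rcons t v); split.
- by rewrite size_rcons st.
- move=> a b ab; rewrite !nth_rcons st.
  have [bj|jb] := ltnP b j; first by rewrite (ltn_trans ab bj) to.
  case: (eqVneq b j) => [bj|bj]; last by rewrite dot0r.
  by rewrite -bj ab /v dotZr dotC wt conjc0 mulr0.
- move=> a; rewrite ltnS nth_rcons st leq_eqVlt => /orP[/eqP->|aj]; last by rewrite aj t1.
  rewrite ltnn eqxx nsqZ sqr_normc_real exprVn sqr_hnorm mulVf//.
move=> x; rewrite mem_rcons inE => /orP[/eqP->|/tA//].
rewrite /v (linZ _ _ Al) scalerA mulrC -scalerA; congr (_ *: _).
rewrite /w (linB _ _ Al) Au scalerBr (lin_sum _ _ _ Al); congr (_ - _).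
rewrite scaler_sumr; apply: eq_bigr => a _.
by rewrite (linZ _ _ Al) tA ?mem_nth ?st// !scalerA mulrC.
Qed.

Let eigpair A (p : R * H) := [/\ 0 < p.1, A p.2 = p.1%:C *: p.2 & nsq p.2 = 1].

Let eigfam A (s : seq (R * H)) := (forall p, p \in s -> eigpair A p) /\
  pairwise (fun p q => dot p.2 q.2 == 0) s.

(** An orthonormal family of k eigenvectors for l gives k l^r <= M, so every multiplicity is finite
    and attained. Orthonormal bases of finitely many eigenspaces are concatenated; they are mutually
    orthogonal since [A] is self-adjoint, and the hypothesis applies to the resulting family. *)
Lemma esum_multiplicity_le A (r M : R) : 0 < r -> lin A -> is_adjoint dot A A ->
  (forall (e : nat -> H) (lam : nat -> R) N, orthosys e ->
     (forall k, A (e k) = (lam k)%:C *: e k) -> (forall k, 0 <= lam k) ->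
     (forall k, lam k != 0 -> nsq (e k) = 1) ->
     \sum_(0 <= k < N) lam k `^ r <= M) ->
  (esum_mult A r <= M%:E)%E.
Proof.
move=> r0 Al AA hM.
have hfam s : eigfam A s -> \sum_(p <- s) p.1 `^ r <= M.
  move=> [sE so].
  have E k : (k < size s)%N -> eigpair A (nth (0, 0) s k) by move=> ?; apply/sE/mem_nth.
  (* Past the end of the list, [nth] returns the null vector with eigenvalue 0, which [orthosys]
     admits. *)
  rewrite (big_nth (0, 0)).
  apply: (hM (fun k => (nth (0, 0) s k).2) (fun k => (nth (0, 0) s k).1)).
  - have lt_o i j : (i < j)%N -> dot (nth (0, 0) s i).2 (nth (0, 0) s j).2 = 0.
      move=> ij; have [js|sj] := ltnP j (size s); last first.
        by rewrite [nth _ _ j]nth_default//= dot0r.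
      by move/(pairwiseP (0, 0)): so => /(_ i j (ltn_trans ij js) js ij)/eqP.
    split=> [i j|i].
      by rewrite neq_ltn => /orP[/lt_o//|/lt_o h]; rewrite dotC h conjc0.
    have [/E[]|si] := ltnP i (size s); first by right.
    by left; rewrite nth_default//= nsq0.
  - move=> k; have [/E[]//|sk] := ltnP k (size s).
    by rewrite nth_default//= (lin0 Al) scaler0.
  - by move=> k; have [/E[/ltW]//|sk] := ltnP k (size s); rewrite nth_default.
  - by move=> k; have [/E[]//|sk] := ltnP k (size s); rewrite nth_default//= eqxx.
pose fam l k := exists u : 'I_k -> H, (forall i, A (u i) = l%:C *: u i) /\
      forall c : 'I_k -> C, \sum_(i < k) c i *: u i = 0 -> forall i, c i = 0.
have famE (l : R) k : 0 < l -> fam l k ->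
    exists s, [/\ eigfam A s, size s = k & forall p, p \in s -> p.1 = l].
  move=> l0 [u [Au uf]].
  have [t [st to t1 tA]] := exists_eigenbasis Al Au uf (leqnn k).
  exists (map (pair l) t); rewrite size_map st; split=> //; last by move=> p /mapP[v _ ->].
  split.
    move=> p /mapP[v vt ->]; split=> //=; first exact: tA.
    by rewrite -(nth_index 0 vt) t1// -st index_mem.
  rewrite pairwise_map; apply/(pairwiseP 0) => i j _ _ ij /=.
  by rewrite to.
have fam_mult (l : R) : 0 < l -> exists2 k, fam l k & multiplicity A l%:C = (k%:R : R)%:E.
  move=> l0.
  have bd k : fam l k -> (k <= Num.truncn (M / l `^ r))%N.
    move=> /(famE _ _ l0)[s [sf ss sl]].
    have lr0 : 0 < l `^ r by rewrite powR_gt0.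
    rewrite -(ler_nat R); have := hfam s sf.
    rewrite big_seq (eq_bigr (fun=> l `^ r)) => [|p /sl -> //].
    rewrite -big_seq big_const_seq count_predT iter_addr_0 ss -[_ *+ k]mulr_natl.
    rewrite -ler_pdivlMr// => kM.
    have := truncn_itv (le_trans (ler0n R k) kM) => /andP[_].
    move=> /(le_lt_trans kM); rewrite ltr_nat ltnS => ?.
    by rewrite ler_nat.
  have ex : exists k, `[< fam l k >].
    by exists 0%N; apply/asboolP; exists (fun=> 0); split=> [[]|c _ []].
  have bd' k : `[< fam l k >] -> (k <= Num.truncn (M / l `^ r))%N by move/asboolP/bd.
  have [k /asboolP kf kmax] := ex_maxnP ex bd'.
  exists k => //; apply/eqP; rewrite eq_le; apply/andP; split.
    apply: ub_ereal_sup => _ [j /= jf <-]; rewrite lee_fin ler_nat; apply: kmax.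
    exact/asboolP.
  by have [u [Au uf]] := kf; exact: multiplicity_ge Au uf.
apply: ub_ereal_sup => _ [X [Xf X0] <-].
rewrite fsbig_finite//=.
have {X0} LP l : l \in (fset_set X : seq R) -> 0 < l by rewrite in_fset_set// inE => /X0.
have Lu : uniq (fset_set X : seq R) by exact: fset_uniq.
move: LP Lu; move: (enum_fset _) => L LP Lu.
suff [s [sf sE sL]] : exists s, [/\ eigfam A s,
    (\sum_(l <- L) (l `^ r)%:E * multiplicity A l%:C)%E = (\sum_(p <- s) p.1 `^ r)%:E &
    forall p, p \in s -> p.1 \in L].
  by rewrite sE lee_fin hfam.
elim: L LP Lu => [|l L ih] LP; first by exists [::]; rewrite !big_nil.
move=> /= /andP[lL Lu].
have LP' x : x \in L -> 0 < x by move=> xL; apply: LP; rewrite inE xL orbT.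
have [s [[sE so] sS sL]] := ih LP' Lu.
have l0 : 0 < l by apply: LP; rewrite inE eqxx.
have [k kf kE] := fam_mult l l0.
have [t [[tE to] st tl]] := famE _ _ l0 kf.
exists (t ++ s); split.
- split; first by move=> p; rewrite mem_cat => /orP[/tE|/sE].
  rewrite pairwise_cat so to !andbT; apply/allrelP => p q pt qs.
  have [p0 Ap _] := tE _ pt; have [q0 Aq _] := sE _ qs.
  have pq : p.1 != q.1 by rewrite (tl _ pt); apply: contra lL => /eqP ->; exact: sL.
  have := AA p.2 q.2; rewrite Ap Aq dotZl dotZr conjc_real => /eqP.
  rewrite -subr_eq0 -mulrBl mulf_eq0 => /orP[|//].
  by rewrite -rmorphB /= => /eqP/complexI/eqP; rewrite subr_eq0 (negbTE pq).
- rewrite big_cons sS big_cat /= EFinD; congr (_ + _)%E.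
  have -> : \sum_(p <- t) p.1 `^ r = l `^ r * k%:R.
    rewrite big_seq (eq_bigr (fun=> l `^ r)) => [|p /tl -> //].
    by rewrite -big_seq big_const_seq count_predT iter_addr_0 st mulr_natr.
  by rewrite kE EFinM.
by move=> p; rewrite mem_cat inE => /orP[/tl->|/sL->]; rewrite ?eqxx ?orbT.
Qed.

(** * Schatten classes *)

Lemma nsq_spectral_psum e (lam : nat -> R) A K u : spectral A e lam ->
  nsq (psum e (fun k => (lam k)%:C *: e k) 0 K u) =
  \sum_(0 <= k < K) lam k ^+ 2 * normc (dot u (e k)) ^+ 2.
Proof.
move=> [eo _ _ _ _ _ _]; rewrite /psum; under eq_bigr do rewrite scalerA.
rewrite (nsq_osum eo); apply: eq_bigr => k _.
by rewrite normcM exprMn -mulrA mulrC -mulrA [nsq _ * _]mulrC (orthosys_coef eo)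
  sqr_normc_real.
Qed.

Lemma absolute_value_self A : bounded_operator dot A -> is_adjoint dot A A ->
  positive_operator dot setT A -> is_absolute_value dot A A.
Proof. by move=> Ab AA Ap; split=> //; [exact: adjoint_selfadjoint|exists A]. Qed.

Section Abstract.
Variables (phi : nat -> H) (D : set H) (T : H -> H).
Hypothesis phio : orthosys phi.
Hypothesis DT : linear_operator D T.
Hypothesis Dphi : forall k, D (phi k).
Hypothesis Tsum : forall f, D f -> hcvg (psum phi (T \o phi) 0 ^~ f) (T f).

Let sum_coef_le1 N u : nsq u <= 1 -> \sum_(0 <= j < N) normc (dot (phi j) u) ^+ 2 <= 1.
Proof.
move=> u1; apply: le_trans u1; apply: le_trans (bessel phio 0 N u).
by apply: ler_sum => k _; rewrite dotC normc_conj.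
Qed.

Lemma hs_extension : (exists M, forall N, \sum_(0 <= k < N) nsq (T (phi k)) <= M) ->
  exists S S', [/\ forall f, D f -> S f = T f, is_opsum phi (T \o phi) S,
    bounded_operator dot S, compact_operator dot S &
    bounded_operator dot S' /\ is_adjoint dot S S'].
Proof.
move=> hM; have [eta us] := uniform_sum_hs phio hM.
have [S hS] := opsum_ex us.
have us' := uniform_sum_dual us.
have [S' hS'] := opsum_ex us'.
exists S, S'; split => //.
- by move=> f Df; apply: (hcvg_unique (hS f)); exact: Tsum.
- exact: (opsum_bounded us hS).
- exact: (opsum_compact us hS).
- by split; [exact: (opsum_bounded us' hS')|exact: (opsum_adjoint hS hS')].
Qed.

Section Extension.
Variables (S A : H -> H).
Hypothesis hS : is_opsum phi (T \o phi) S.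
Hypothesis ST : forall f, D f -> S f = T f.
Hypothesis SA : is_absolute_value dot S A.

(* An eigenvector of |S| for a nonzero eigenvalue lies in the closed span of the [phi k]. *)
Lemma eigen_coef_cvg e (l : R) : A e = l%:C *: e -> l != 0 -> nsq e = 1 ->
  (fun N => \sum_(0 <= k < N) normc (dot e (phi k)) ^+ 2) @ \oo --> (1 : R).
Proof.
move=> Ae l0 e1; have [Ab _ _ [S' SS' AAS]] := SA.
have Al := bounded_lin Ab.
have S'S := adjoint_sym SS'.
have l20 : l ^+ 2 != 0 by rewrite sqrf_eq0.
have h := cvg_Re_dotl (y := S e) (hS e).
(* <T phi_k, S e> = <phi_k, S^* S e> = l^2 <phi_k, e>. In the limit |S e|^2 is l^2 times the sum of
   the |<e, phi_k>|^2, while |S e|^2 = |A e|^2 = l^2. *)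
have E N : Re (dot (psum phi (T \o phi) 0 N e) (S e)) =
    l ^+ 2 * \sum_(0 <= k < N) normc (dot e (phi k)) ^+ 2.
  rewrite dot_suml Re_sum mulr_sumr; apply: eq_bigr => k _.
  rewrite dotZl /= -ST// SS' -AAS Ae (linZ _ _ Al) Ae scalerA -rmorphM /=.
  rewrite dotZr conjc_real mulrCA -expr2 ReM_real (dotC e (phi k)) mul_conj.
  by [].
have -> : (fun N => \sum_(0 <= k < N) normc (dot e (phi k)) ^+ 2) =
    (fun N => (l ^+ 2)^-1 * Re (dot (psum phi (T \o phi) 0 N e) (S e))).
  by apply/funext => N; rewrite E mulKf.
rewrite -(mulVf l20).
have -> : l ^+ 2 = Re (dot (S e) (S e)).
  rewrite -/(nsq (S e)) -(absolute_value_nsq _ SA) Ae nsqZ sqr_normc_real e1.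
  by rewrite mulr1.
exact: cvgMr.
Qed.

(** The exchange of summations shared by the Jensen estimate, with [g] the r-th power of [lam], and
    the trace estimate, with [g] equal to [lam]. For fixed [N], each [g i] is the limit in K of its
    product with the partial sum of squared coefficients of [e i]; that sum tends to 1 only for
    nonzero eigenvalues, hence the condition on [g] where [lam] vanishes. *)
Lemma eigen_sum_le (e : nat -> H) (lam : nat -> R) (g b : nat -> R) (M : R) N :
  (forall k, A (e k) = (lam k)%:C *: e k) ->
  (forall k, lam k != 0 -> nsq (e k) = 1) ->
  (forall k, lam k = 0 -> g k = 0) ->
  (forall k, \sum_(0 <= i < N) g i * normc (dot (e i) (phi k)) ^+ 2 <= b k) ->
  (forall K, \sum_(0 <= k < K) b k <= M) ->
  \sum_(0 <= i < N) g i <= M.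
Proof.
move=> Ae e1 g0 gb bM.
pose f i K := g i * \sum_(0 <= k < K) normc (dot (e i) (phi k)) ^+ 2.
have fc i : (i < N)%N -> f i @ \oo --> g i.
  move=> _; have [li|li] := eqVneq (lam i) 0.
    rewrite /f g0//; under eq_fun do rewrite mul0r; exact: cvg_cst.
  rewrite -[X in _ --> X]mulr1; apply: cvgMr.
  exact: (eigen_coef_cvg (Ae i) li (e1 _ li)).
apply: (cvgn_le (cvgn_sum fc)) => K; apply: le_trans (bM K).
rewrite /f; under eq_bigr do rewrite mulr_sumr.
by rewrite exchange_big /=; apply: ler_sum => k _; exact: gb.
Qed.

(** Jensen's inequality is applied to the values l_i^2 with exponent r / 2, at most 1; for fixed k
    the weights |<e_i, phi_k>|^2 add up to at most |phi_k|^2 by Bessel. A second use of Bessel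
    bounds the sum of l_i^2 |<e_i, phi_k>|^2 = |<A phi_k, e_i>|^2 by |A phi_k|^2 = |T phi_k|^2. *)
Lemma sum_powR_singular_le (r M : R) : 0 < r <= 2 ->
  (forall N, \sum_(0 <= k < N) nsq (T (phi k)) `^ (r / 2) <= M) ->
  (\esum_(l in [set l : R | (0 < l)%R])
     ((l `^ r)%R%:E * multiplicity A (l%:C)%C) < +oo)%E.
Proof.
move=> /andP[r0 r2] hM.
have [Ab Asa Ap _] := SA; have AA := selfadjoint_adjoint Asa.
have Al := bounded_lin Ab.
apply: (@le_lt_trans _ _ M%:E); last exact: ltry.
apply: (esum_multiplicity_le r0 Al AA) => e lam N eo Ae lam0 e1.
apply: (eigen_sum_le Ae e1 _ _ hM); first by move=> k ->; rewrite powR0// gt_eqF.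
move=> k; pose w i := normc (dot (e i) (phi k)) ^+ 2.
have p01 : 0 < r / 2 <= 1 by rewrite divr_gt0//= ler_pdivrMr// mul1r.
rewrite (eq_bigr (fun i => w i * (lam i ^+ 2) `^ (r / 2))); last first.
  move=> i _; rewrite mulrC; congr (_ * _).
  by rewrite -powR_mulrn// -powRrM mulrCA divff ?mulr1.
have wE i : w i = normc (dot (phi k) (e i)) ^+ 2 by rewrite /w dotC normc_conj.
apply: le_trans (powR_jensen p01 _ _ _) _.
- by move=> i; exact: sqr_ge0.
- by move=> i; exact: sqr_ge0.
- rewrite (eq_bigr (fun i => normc (dot (phi k) (e i)) ^+ 2)) => [|i _]; last exact: wE.
  exact: le_trans (bessel eo 0 N (phi k)) (orthosys_nsq_le1 phio k).
apply: ge0_ler_powR.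
- by case/andP : p01 => /ltW.
- by rewrite nnegrE; apply: sumr_ge0 => i _; rewrite mulr_ge0// sqr_ge0.
- exact: nsq_ge0.
rewrite -ST// -(absolute_value_nsq _ SA).
apply: le_trans (bessel eo 0 N (A (phi k))).
apply: ler_sum => i _; rewrite wE AA Ae dotZr conjc_real normcM exprMn.
by rewrite sqr_normc_real mulrC.
Qed.

End Extension.

Lemma schatten_of_sum (r : R) : 0 < r <= 2 ->
  (exists M, forall N, \sum_(0 <= k < N) nsq (T (phi k)) `^ (r / 2) <= M) ->
  schatten_class dot r D T.
Proof.
move=> r02 [M hM]; have /andP[r0 r2] := r02.
(* For p <= 1, summability of the p-th powers implies summability: every [Y k] is at most M^(1/p),
   so Y = Y^p Y^(1 - p) <= Y^p B. This provides the extension [S]. *)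
have hs : exists M, forall N, \sum_(0 <= k < N) nsq (T (phi k)) <= M.
  pose p := r / 2; have p0 : 0 < p by rewrite divr_gt0.
  have p1 : p <= 1 by rewrite ler_pdivrMr// mul1r.
  pose Y k := nsq (T (phi k)); have Y0 k : 0 <= Y k by exact: nsq_ge0.
  have YM k : Y k `^ p <= M.
    apply: le_trans (hM k.+1); rewrite big_nat_recr//= lerDr.
    by apply: sumr_ge0 => i _; exact: powR_ge0.
  have M0 : 0 <= M by exact: le_trans (powR_ge0 _ _) (YM 0%N).
  pose B := (M `^ p^-1) `^ (1 - p).
  have YB k : Y k <= Y k `^ p * B.
    have [->|Yn] := eqVneq (Y k) 0; first by rewrite mulr_ge0 ?powR_ge0.
    have {1}-> : Y k = Y k `^ p * Y k `^ (1 - p).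
      by rewrite -powRD ?Yn ?implybT// addrC subrK powRr1.
    rewrite ler_wpM2l ?powR_ge0//.
    apply: ge0_ler_powR; rewrite ?subr_ge0 ?nnegrE ?powR_ge0//.
    have -> : Y k = (Y k `^ p) `^ p^-1 by rewrite -powRrM divff ?gt_eqF// powRr1.
    by apply: ge0_ler_powR; rewrite ?invr_ge0 ?(ltW p0)// ?nnegrE ?powR_ge0.
  exists (M * B) => N; apply: le_trans (_ : \sum_(0 <= k < N) Y k `^ p * B <= _).
    by apply: ler_sum => k _; exact: YB.
  by rewrite -mulr_suml ler_wpM2r ?powR_ge0//; exact: hM.
have [S [S' [ST hS Sb Sc [S'b SS']]]] := hs_extension hs.
have [A SA] := absolute_value_ex Sb Sc S'b SS'.
exists S => //; split=> //; exists A => //.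
exact: (sum_powR_singular_le hS ST SA r02 hM).
Qed.

Lemma schatten2_sum : schatten_class dot 2 D T ->
  exists M, forall N, \sum_(0 <= k < N) nsq (T (phi k)) <= M.
Proof.
move=> [S ST [Sb Sc [A SA Afin]]].
have [Ab Asa Ap _] := SA; have AA := selfadjoint_adjoint Asa.
have Ac := absolute_value_compact (bounded_lin Sb) Sc SA.
have [e [lam sp]] := spectral_theorem Ab Ac AA (fun u => Ap u I).
have [eo Ae lam0 _ _ e1 Asum] := sp.
exists (fine (\esum_(l in [set l : R | (0 < l)%R])
  ((l `^ 2)%R%:E * multiplicity A (l%:C)%C))%E) => N.
have hK K : \sum_(0 <= k < K) lam k ^+ 2 <= fine (\esum_(l in [set l : R | (0 < l)%R])
    ((l `^ 2)%R%:E * multiplicity A (l%:C)%C))%E.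
  rewrite -lee_fin fineK; last first.
    rewrite ge0_fin_numE//; apply: esum_ge0 => l _.
    by rewrite mule_ge0 ?lee_fin ?powR_ge0//; exact: multiplicity_ge0.
  apply: le_trans (esum_multiplicity_ge K _ eo Ae lam0 e1); last by [].
  by rewrite lee_fin; apply: ler_sum => k _; rewrite powR_mulrn.
have lc i : (i < N)%N ->
    nsq (psum e (fun k => (lam k)%:C *: e k) 0 K (phi i)) @[K --> \oo] --> nsq (T (phi i)).
  move=> _; rewrite -ST// -(absolute_value_nsq _ SA).
  by apply: cvg_nsq; exact: Asum.
(* [N] is fixed, so the truncation [K] of the eigenexpansions may go to infinity term by term. For
   each [K] the finite sums are exchanged, and the sum of |<phi_i, e_k>|^2 over i is at most |e_k|^2
   <= 1. *)
apply: (cvgn_le (cvgn_sum lc)) => K; apply: le_trans (hK K).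
under eq_bigr do rewrite (nsq_spectral_psum _ _ sp).
rewrite exchange_big /=; apply: ler_sum => k _.
rewrite -mulr_sumr ler_piMr ?sqr_ge0//; apply: sum_coef_le1.
exact: orthosys_nsq_le1 eo k.
Qed.

(** * Positive self-adjoint operators and the trace class *)

Section Positive.
Hypothesis Tp : positive_operator dot D T.
Hypothesis Ts : selfadjoint_operator dot D T.

Let Tsym u v : D u -> D v -> dot (T u) v = dot u (T v).
Proof. by move=> Du Dv; have [_ /(_ v (T v))[h _]] := Ts; apply: h. Qed.

Let dense_seq u : exists2 d : nat -> H, (forall k, D (d k)) & hcvg d u.
Proof.
have [Dd _] := Ts.
have /choice[d hd] : forall k : nat, exists v, D v /\ hnorm (u - v) < k.+1%:R^-1.
  move=> k; have k0 : 0 < k.+1%:R^-1 :> R by rewrite invr_gt0.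
  by have [v Dv uv] := Dd u _ k0; exists v.
exists d; first by move=> k; have [] := hd k.
apply: (@hcvg_squeeze _ _ harmonic); last exact: cvg_harmonic.
by move=> k; rewrite hnormBC; have [_ /ltW] := hd k.
Qed.

Lemma positive_extension S : bounded_operator dot S -> (forall f, D f -> S f = T f) ->
  is_adjoint dot S S /\ positive_operator dot setT S.
Proof.
move=> Sb ST; have Sl := bounded_lin Sb.
have SS : is_adjoint dot S S.
  move=> u v; have: (fun w => dot (S w) v) =1 (fun w => dot w (S v)); last exact.
  apply: Re_dot_ext => [a w|a w|w]; [by rewrite (linZ _ _ Sl) dotZl|by rewrite dotZl|].
  have [d Dd dw] := dense_seq w; have [d' Dd' dv] := dense_seq v.
  have h1 := cvg_Re_dot (bounded_hcvg Sb dw) dv.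
  have h2 := cvg_Re_dot dw (bounded_hcvg Sb dv).
  rewrite -(cvg_lim _ h1)// -(cvg_lim _ h2)//; congr (lim (_ @ \oo)).
  by apply/funext => k /=; rewrite !ST// Tsym.
split=> // u _; apply: adjoint_pos => //.
have [d Dd du] := dense_seq u.
apply: (cvgn_ge (cvg_Re_dot (bounded_hcvg Sb du) du)) => k /=.
by rewrite ST//; have [] := complex_ge0E (Tp (Dd k)).
Qed.

(** The spectral theorem is applied to [S] itself, since <T phi_i, phi_i> expands along its
    eigenvectors. As [S] is self-adjoint, A^2 = S^2, and [sqrt_eigen] makes each of them an
    eigenvector of [A] with the same eigenvalue; null eigenvalues are settled by |A e| = |S e|. *)
Lemma positive_schatten1_sum : schatten_class dot 1 D T ->
  exists M, forall N, \sum_(0 <= k < N) normc (dot (T (phi k)) (phi k)) <= M.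
Proof.
move=> [S ST [Sb Sc [A SA Afin]]].
have [SS Sp] := positive_extension Sb ST.
have [Ab Asa Ap [S' SS' AAS]] := SA; have AA := selfadjoint_adjoint Asa.
have Al := bounded_lin Ab.
have [e [lam [eo Se lam0 _ _ e1 Ssum]]] :=
  spectral_theorem Sb Sc SS (fun u => Sp u I).
have S'E u : S' u = S u by apply: eq_dotr => v; rewrite -SS' SS.
have Ae k : A (e k) = (lam k)%:C *: e k.
  have [lk|lk] := eqVneq (lam k) 0.
    rewrite lk scale0r; apply: nsq_eq0.
    by rewrite (absolute_value_nsq _ SA) Se lk scale0r nsq0.
  apply: (sqrt_eigen Al Ap); first by rewrite lt_neqAle eq_sym lk lam0.
  by rewrite AAS S'E Se (linZ _ _ (bounded_lin Sb)) Se scalerA -rmorphM /= -expr2.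
exists (fine (\esum_(l in [set l : R | (0 < l)%R])
  ((l `^ 1)%R%:E * multiplicity A (l%:C)%C))%E) => N.
have hK K : \sum_(0 <= k < K) lam k <= fine (\esum_(l in [set l : R | (0 < l)%R])
    ((l `^ 1)%R%:E * multiplicity A (l%:C)%C))%E.
  rewrite -lee_fin fineK; last first.
    rewrite ge0_fin_numE//; apply: esum_ge0 => l _.
    by rewrite mule_ge0 ?lee_fin ?powR_ge0//; exact: multiplicity_ge0.
  apply: le_trans (esum_multiplicity_ge K _ eo Ae lam0 e1); last by [].
  by rewrite lee_fin; apply: ler_sum => k _; rewrite powRr1.
have lc i : (i < N)%N ->
    Re (dot (psum e (fun k => (lam k)%:C *: e k) 0 K (phi i)) (phi i)) @[K --> \oo] -->
    normc (dot (T (phi i)) (phi i)).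
  move=> _; have [E E0] := complex_ge0E (Tp (Dphi i)).
  rewrite E normc_real ger0_norm// -ST//.
  by apply: cvg_Re_dotl; exact: Ssum.
apply: (cvgn_le (cvgn_sum lc)) => K; apply: le_trans (hK K).
rewrite (eq_bigr (fun i => \sum_(0 <= k < K) lam k * normc (dot (phi i) (e k)) ^+ 2)).
  rewrite exchange_big /=; apply: ler_sum => k _.
  rewrite -mulr_sumr ler_piMr//; apply: sum_coef_le1; exact: orthosys_nsq_le1 eo k.
move=> i _; rewrite dot_suml Re_sum; apply: eq_bigr => k _.
by rewrite scalerA dotZl [_ * (lam k)%:C]mulrC -mulrA ReM_real (dotC (phi i)) mul_conj.
Qed.

Let T_lin a u v : D u -> D v -> T (a *: u + v) = a *: T u + T v.
Proof. by case: DT => _ _; exact. Qed.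

Let D_lin a u v : D u -> D v -> D (a *: u + v).
Proof. by case: DT => _ h _; exact: h. Qed.

Let T_cs u v : D u -> D v ->
  normc (dot (T u) v) ^+ 2 <= Re (dot (T u) u) * Re (dot (T v) v).
Proof.
apply: (@form_cauchy_schwarz _ _ D (fun u v => dot (T u) v)) => //.
- by move=> a x y w Dx Dy _; rewrite T_lin// dotDl dotZl.
- by move=> x y Dx Dy; rewrite Tsym// dotC.
Qed.

Let Tp0 u : D u -> 0 <= Re (dot (T u) u).
Proof. by move=> Du; have [] := complex_ge0E (Tp Du). Qed.

Let D_psum N u : D (psum phi phi 0 N u) /\
  T (psum phi phi 0 N u) = psum phi (T \o phi) 0 N u.
Proof.
have [D0 _ _] := DT.
have T0 : T 0 = 0.
  have := T_lin 1 D0 D0; rewrite !scale1r addr0 => /(congr1 (fun z => z - T 0)).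
  by rewrite subrr addrK.
elim: N => [|N [ihD ihT]]; first by rewrite /psum !big_geq.
rewrite /psum !big_nat_recr//= -!/(psum _ _ _ _ _) -/(psum _ _ _ _ _).
by rewrite addrC; split; [exact: D_lin|rewrite T_lin// ihT addrC].
Qed.

Section TraceBound.
Variable M : R.
Hypothesis hM : forall N, \sum_(0 <= k < N) normc (dot (T (phi k)) (phi k)) <= M.

Let q u := Re (dot (T u) u).

Let qM N : \sum_(0 <= k < N) q (phi k) <= M.
Proof.
apply: le_trans (hM N); apply: ler_sum => k _.
exact: le_trans (ler_norm _) (ler_Re_normc _).
Qed.

Let M0 : 0 <= M. Proof. by have := hM 0; rewrite big_geq. Qed.

(* AM-GM: [2 |c| x <= M c^2 + x^2 / M] summed against [x^2 = q (phi k) * Q]. *)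
Let q_psum N u : q (psum phi phi 0 N u) <= M * nsq u.
Proof.
set g := psum phi phi 0 N u; have [Dg Tg] := D_psum N u; rewrite -/g in Dg Tg.
have Q0 : 0 <= q g by exact: Tp0.
have qE : q g <= \sum_(0 <= k < N) normc (dot u (phi k)) * normc (dot (T (phi k)) g).
  rewrite /q Tg dot_suml Re_sum; apply: ler_sum => k _ /=.
  by rewrite dotZl -normcM; exact: le_trans (ler_norm _) (ler_Re_normc _).
(* If [M = 0], all [q (phi k)] vanish, and by Cauchy-Schwarz so does every <T phi_k, g>. *)
have [Mz|Mn0] := eqVneq M 0.
  rewrite Mz mul0r; apply: le_trans qE _; rewrite big1_seq// => k /andP[_].
  rewrite mem_index_iota => /andP[_ kN].
  have qk : q (phi k) = 0.
    apply/eqP; rewrite eq_le Tp0// andbT; have := qM k.+1; rewrite Mz; apply: le_trans.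
    by rewrite big_nat_recr//= lerDr; apply: sumr_ge0 => i _; exact: Tp0.
  have := T_cs (Dphi k) Dg; rewrite -/(q _) qk mul0r => h.
  have /eqP : normc (dot (T (phi k)) g) ^+ 2 = 0 by apply/eqP; rewrite eq_le h sqr_ge0.
  by rewrite sqrf_eq0 => /eqP->; rewrite mulr0.
have Mp : 0 < M by rewrite lt_neqAle eq_sym Mn0.
(* Half of [q g] reappears on the right and is absorbed by the left-hand side. *)
have : q g <= 2^-1 * (M * nsq u + q g).
  apply: le_trans qE _; apply: le_trans (_ : \sum_(0 <= k < N)
    2^-1 * (M * normc (dot u (phi k)) ^+ 2 + M^-1 * q g * q (phi k)) <= _).
    apply: ler_sum => k _; have := T_cs (Dphi k) Dg; rewrite -/(q _) -/(q _).
    move: (normc (dot u _)) (normc _) (q (phi k)) => a b c bc.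
    have : 0 <= M^-1 * (M * a - b) ^+ 2 by rewrite mulr_ge0 ?invr_ge0 ?sqr_ge0.
    have -> : M^-1 * (M * a - b) ^+ 2 = M * a ^+ 2 - 2 * a * b + M^-1 * b ^+ 2 by field.
    have : M^-1 * b ^+ 2 <= M^-1 * (c * q g) by rewrite ler_wpM2l ?invr_ge0.
    lra.
  rewrite -mulr_sumr ler_wpM2l ?invr_ge0// big_split /= -!mulr_sumr.
  rewrite lerD ?ler_wpM2l ?bessel//.
  rewrite mulrAC ler_piMl// mulrC ler_pdivrMr// mul1r; exact: qM.
lra.
Qed.

(** For the projections P_N f, the values q(P_N f) are not known to converge to q(f), but the mixed
    terms <T P_N f, f> are, by the series for T f. Cauchy-Schwarz gives |<T P_N f, f>|^2 <= M |f|^2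
    q(f), and the limit is divided by q(f). *)
Let q_le f : D f -> q f <= M * nsq f.
Proof.
move=> Df; have Q0 : 0 <= q f by exact: Tp0.
have [->|Qn0] := eqVneq (q f) 0; first by rewrite mulr_ge0// nsq_ge0.
have Qp : 0 < q f by rewrite lt_neqAle eq_sym Qn0.
have h := cvg_Re_dotl (y := f) (Tsum Df).
have h2 : (fun N => Re (dot (psum phi (T \o phi) 0 N f) f) *
    Re (dot (psum phi (T \o phi) 0 N f) f)) @ \oo --> q f * q f by exact: cvgM.
rewrite -(ler_pM2r Qp); apply: (cvgn_le h2) => N.
have [Dg Tg] := D_psum N f.
rewrite -Tg /= -expr2 -(real_normK (num_real _)).
apply: le_trans (_ : normc (dot (T (psum phi phi 0 N f)) f) ^+ 2 <= _).
  by rewrite ler_sqr ?nnegrE ?normr_ge0 ?normc_ge0// ler_Re_normc.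
by apply: le_trans (T_cs Dg Df) _; rewrite -!/(q _) ler_wpM2r.
Qed.

(** T f may lie outside [D], so it is approximated by d_k in [D]: |<T f, d_k>|^2 <= q(f) q(d_k) <=
    q(f) M |d_k|^2 tends to |T f|^4 <= M q(f) |T f|^2. *)
Let nsq_T_le f : D f -> nsq (T f) <= M * q f.
Proof.
move=> Df; have [->|n0] := eqVneq (nsq (T f)) 0; first by rewrite mulr_ge0// Tp0.
have np : 0 < nsq (T f) by rewrite lt_neqAle eq_sym n0 nsq_ge0.
have [d Dd dT] := dense_seq (T f).
have h := cvg_Re_dotr (y := T f) dT.
have h2 : Re (dot (T f) (d k)) * Re (dot (T f) (d k)) @[k --> \oo] -->
  nsq (T f) * nsq (T f) by exact: cvgM.
have h3 : q f * (M * nsq (d k)) @[k --> \oo] --> q f * (M * nsq (T f)).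
  by apply: cvgMr; apply: cvgMr; exact: cvg_nsq.
rewrite -(ler_pM2r np) -subr_ge0.
rewrite (_ : _ - _ = q f * (M * nsq (T f)) - nsq (T f) * nsq (T f)); last by ring.
apply: (cvgn_ge (cvgB h3 h2)) => k /=; rewrite subr_ge0.
rewrite -expr2 -(real_normK (num_real _)).
apply: le_trans (_ : normc (dot (T f) (d k)) ^+ 2 <= _).
  by rewrite ler_sqr ?nnegrE ?normr_ge0 ?normc_ge0// ler_Re_normc.
apply: le_trans (T_cs Df (Dd k)) _; rewrite -!/(q _) ler_wpM2l ?Tp0//.
exact: q_le.
Qed.

Lemma positive_schatten1_of_sum : schatten_class dot 1 D T.
Proof.
have hs : exists M, forall N, \sum_(0 <= k < N) nsq (T (phi k)) <= M.
  exists (M * M) => N; apply: le_trans (_ : \sum_(0 <= k < N) M * q (phi k) <= _).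
    by apply: ler_sum => k _; exact: nsq_T_le.
  by rewrite -mulr_sumr ler_wpM2l.
have [S [S' [ST hS Sb Sc [S'b SS']]]] := hs_extension hs.
have [SS Sp] := positive_extension Sb ST.
have Sl := bounded_lin Sb.
have SA := absolute_value_self Sb SS Sp.
exists S => //; split=> //; exists S => //.
apply: (@le_lt_trans _ _ M%:E); last exact: ltry.
apply: (esum_multiplicity_le _ Sl SS) => // e lam N eo Se lam0 e1.
under eq_bigr do rewrite powRr1//.
apply: (eigen_sum_le hS ST SA Se e1 _ _ qM) => // k.
(* [p] is the projection of [u] to the span of the eigenvectors, which [S] preserves, so the cross
   terms vanish: q(u) = <S p, u> + <S (u - p), u - p>. The first term is the wanted sum, the second
   is nonnegative. *)
set u := phi k; set p := psum e e 0 N u.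
have Spw w : dot (S p) w = \sum_(0 <= i < N) dot u (e i) * ((lam i)%:C * dot (e i) w).
  rewrite /p (lin_sum _ _ _ Sl) dot_suml; apply: eq_bigr => i _.
  by rewrite (linZ _ _ Sl) Se !dotZl.
have pw : dot (S p) (u - p) = 0.
  rewrite Spw big1_seq// => i /andP[_]; rewrite mem_index_iota => /andP[_ iN].
  by rewrite (dotC (u - p)) (dot_resid eo)// conjc0 !mulr0.
have -> : q u = Re (dot (S p) u) + Re (dot (S (u - p)) (u - p)).
  have wp : dot (S (u - p)) p = 0 by rewrite SS dotC pw conjc0.
  have E : dot (S u) u = dot (S p) u + dot (S (u - p)) (u - p).
    by rewrite (dotBr _ u p) wp subr0 -dotDl -(linD _ _ Sl) addrC subrK.
  by rewrite /q -(ST _ (Dphi k)) -/u E ReD.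
rewrite -[leLHS]addr0 lerD//; last first.
  by have [] := complex_ge0E (Sp (u - p) I).
rewrite Spw Re_sum le_eqVlt; apply/orP; left; apply/eqP; apply: eq_bigr => i _.
by rewrite [in RHS]mulrCA ReM_real (dotC u (e i)) mul_conj normc_conj.
Qed.

End TraceBound.

End Positive.

End Abstract.

End HilbertTheory.

(** * The Hilbert space of square-integrable functions *)

Section L2Hilbert.
Context d (T : measurableType d) (R : realType).
Variable mu : {measure set T -> \bar R}.
Local Notation C := R[i].
Local Notation Re := (@complex.Re R).
Local Notation Im := (@complex.Im R).
Implicit Types f g h : T -> C^o.

Lemma sqfunP (f : sqfun mu) : cmeasurable f /\ (sqnorm mu f < +oo)%E.
Proof. by have := valP f; rewrite inE. Qed.

Lemma inner_Re f g : (fun x => Re (f x * (g x)^*)) =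
  (fun x => Re (f x) * Re (g x) + Im (f x) * Im (g x)).
Proof.
by apply/funext => x; case: (f x) (g x) => [a b] [a' b'] /=; ring.
Qed.

Lemma inner_Im f g : (fun x => Im (f x * (g x)^*)) =
  (fun x => Im (f x) * Re (g x) - Re (f x) * Im (g x)).
Proof.
by apply/funext => x; case: (f x) (g x) => [a b] [a' b'] /=; ring.
Qed.

Lemma cmeasurable_inner f g : cmeasurable f -> cmeasurable g ->
  cmeasurable (fun x => f x * (g x)^*).
Proof.
move=> [fr fi] [gr gi]; split; rewrite ?inner_Re ?inner_Im.
  by apply: measurable_funD; exact: measurable_funM.
by apply: measurable_funB; exact: measurable_funM.
Qed.

Lemma sqnorm_integrable f : cmeasurable f -> (sqnorm mu f < +oo)%E ->
  mu.-integrable setT (EFin \o (fun x => normc (f x) ^+ 2)).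
Proof.
move=> mf fo; apply/integrableP; split; first exact: measurable_normc_sqr.
rewrite (eq_integral (fun x => ((normc (f x) ^+ 2)%:E))) => [|x _ /=]; first exact: fo.
by rewrite ger0_norm ?sqr_ge0.
Qed.

Lemma inner_dominated f g (a : T -> R) : cmeasurable f -> (sqnorm mu f < +oo)%E ->
  cmeasurable g -> (sqnorm mu g < +oo)%E -> measurable_fun setT a ->
  (forall x, `|a x| <= normc (f x) ^+ 2 + normc (g x) ^+ 2) ->
  mu.-integrable setT (EFin \o a).
Proof.
move=> mf fo mg go ma ab.
apply: (le_integrable _ _ _ (integrableD _ (sqnorm_integrable mf fo)
  (sqnorm_integrable mg go))) => //; first exact/measurable_EFinP.
move=> x _ /=; rewrite lee_fin; apply: le_trans (ab x) _.
exact: ler_norm.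
Qed.

Lemma inner_integrable f g : cmeasurable f -> (sqnorm mu f < +oo)%E ->
  cmeasurable g -> (sqnorm mu g < +oo)%E ->
  mu.-integrable setT (EFin \o (fun x => Re (f x * (g x)^*))) /\
  mu.-integrable setT (EFin \o (fun x => Im (f x * (g x)^*))).
Proof.
move=> mf fo mg go; have [mr mi] := cmeasurable_inner mf mg.
split; apply: (inner_dominated mf fo mg go) => // x;
  rewrite !normc_sqr; case: (f x) (g x) => [a b] [a' b'] /=; rewrite ler_norml.
  have := sqr_ge0 (a - a'); have := sqr_ge0 (b - b').
  have := sqr_ge0 (a + a'); have := sqr_ge0 (b + b').
  by nra.
have := sqr_ge0 (a - b'); have := sqr_ge0 (b - a').
have := sqr_ge0 (a + b'); have := sqr_ge0 (b + a').
by nra.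
Qed.

Lemma ImD (x y : C) : Im (x + y) = Im x + Im y.
Proof. by case: x y => [a b] [a' b']. Qed.

Lemma eq_complex_parts (z w : C) : Re z = Re w -> Im z = Im w -> z = w.
Proof. by case: z w => [a b] [a' b'] /= -> ->. Qed.

Lemma cintegral_ae f g : cmeasurable f -> cmeasurable g ->
  {ae mu, forall x, f x = g x} -> cintegral mu f = cintegral mu g.
Proof.
move=> [fr fi] [gr gi] fg; apply: eq_complex_parts => /=; congr fine.
  apply: ae_eq_integral => //; first by apply/measurable_EFinP.
    by apply/measurable_EFinP.
  by apply: filterS fg => x /= ->.
apply: ae_eq_integral => //; first by apply/measurable_EFinP.
  by apply/measurable_EFinP.
by apply: filterS fg => x /= ->.
Qed.

Lemma sqnorm_ae f g : cmeasurable f -> cmeasurable g ->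
  {ae mu, forall x, f x = g x} -> sqnorm mu f = sqnorm mu g.
Proof.
move=> mf mg fg; apply: ae_eq_integral => //; try exact: measurable_normc_sqr.
by apply: filterS fg => x /= ->.
Qed.

Lemma L2_dot_class (f g : sqfun mu) :
  L2_dot (L2_class f) (L2_class g) = inner mu f g.
Proof.
have [mf _] := sqfunP f; have [mg _] := sqfunP g.
apply: cintegral_ae; try apply: cmeasurable_inner => //.
- by have [] := sqfunP (repr (L2_class f)).
- by have [] := sqfunP (repr (L2_class g)).
have /L2_classP ef := L2_classK (L2_class f).
have /L2_classP eg := L2_classK (L2_class g).
near=> x; rewrite /L2_fun.
have -> : (repr (L2_class f) : sqfun mu) x = f x by near: x.
by have -> : (repr (L2_class g) : sqfun mu) x = g x by near: x.
Unshelve. all: by end_near. Qed.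

Lemma L2_ind (P : L2 mu -> Prop) : (forall f : sqfun mu, P (L2_class f)) -> forall u, P u.
Proof. by move=> h u; rewrite -(L2_classK u). Qed.

Lemma innerDl (f g h : sqfun mu) : inner mu (f + g) h = inner mu f h + inner mu g h.
Proof.
have [mf fo] := sqfunP f; have [mg go] := sqfunP g; have [mh ho] := sqfunP h.
have [ifr ifi] := inner_integrable mf fo mh ho.
have [igr igi] := inner_integrable mg go mh ho.
apply: eq_complex_parts => /=.
  rewrite -RintegralD//; congr Rintegral; apply/funext => x.
  by rewrite -ReD -mulrDl.
rewrite -RintegralD//; congr Rintegral; apply/funext => x.
by rewrite -ImD -mulrDl.
Qed.

Lemma innerZl (a : C) (f h : sqfun mu) : inner mu (a *: f) h = a * inner mu f h.
Proof.
have [mf fo] := sqfunP f; have [mh ho] := sqfunP h.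
have [ir ii] := inner_integrable mf fo mh ho.
have ZI (b : R) (k : T -> R) : mu.-integrable setT (EFin \o k) ->
    mu.-integrable setT (EFin \o (fun x => b * k x)).
  by move=> ik; have := integrableZl measurableT b ik; apply: eq_integrable.
have E x : (a *: f) x * (h x)^* = a * (f x * (h x)^*) by rewrite mulrA.
case: a E => [a b] E.
apply: eq_complex_parts => /=.
  rewrite -RintegralZl// -[in X in _ = _ - X]RintegralZl// -RintegralB ?ZI//.
  congr Rintegral; apply/funext => x; rewrite E.
  by case: (f x * _).
rewrite -[in X in _ = X + _]RintegralZl// -[in X in _ = _ + X]RintegralZl// -RintegralD ?ZI//.
congr Rintegral; apply/funext => x; rewrite E.
by case: (f x * _).
Qed.

Lemma innerC (f g : sqfun mu) : inner mu g f = conjc (inner mu f g).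
Proof.
have [mf fo] := sqfunP f; have [mg go] := sqfunP g.
have [ir ii] := inner_integrable mf fo mg go.
apply: eq_complex_parts => /=.
  by rewrite !inner_Re; congr Rintegral; apply/funext => x; ring.
rewrite -mulN1r -RintegralZl//; congr Rintegral; apply/funext => x.
have := congr1 (@^~ x) (inner_Im f g); have := congr1 (@^~ x) (inner_Im g f).
by move=> /= -> ->; ring.
Qed.

Lemma inner_self (f : sqfun mu) : inner mu f f = (fine (sqnorm mu f))%:C.
Proof.
apply: eq_complex_parts => /=.
  congr fine; apply: eq_integral => x _; congr EFin.
  by rewrite normc_sqr; case: (f x) => a b /=; ring.
rewrite /Rintegral (eq_integral (cst 0%E)) ?integral0// => x _; congr EFin.
by case: (f x) => a b /=; ring.
Qed.

Lemma sqnorm_ge0 f : (0 <= sqnorm mu f)%E.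
Proof. by apply: integral_ge0 => x _; rewrite lee_fin sqr_ge0. Qed.

Lemma sqnorm_eq0 f : cmeasurable f -> sqnorm mu f = 0%E ->
  {ae mu, forall x, f x = 0}.
Proof.
move=> mf f0.
have /(ae_eq_integral_abs mu measurableT (measurable_normc_sqr mf)) :
    (\int[mu]_(x in setT) `|((normc (f x) ^+ 2)%R)%:E| = 0)%E.
  rewrite -[RHS]f0; apply: eq_integral => x _ /=.
  by rewrite ger0_norm ?sqr_ge0.
apply: filterS => x /= /(_ I) []/eqP; rewrite sqrf_eq0 => /eqP; exact: eq0_normc.
Qed.

Lemma L2_class0 : L2_class (0 : sqfun mu) = 0.
Proof. by apply: (addrI (L2_class (0 : sqfun mu))); rewrite -L2_classD !addr0. Qed.

Lemma L2_classB (f g : sqfun mu) : L2_class (f - g) = L2_class f - L2_class g.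
Proof. by apply/eqP; rewrite eq_sym subr_eq -L2_classD subrK. Qed.

Lemma L2_classZ a (f : sqfun mu) : L2_class (a *: f) = a *: L2_class f.
Proof. by rewrite -L2_scaleE. Qed.

Lemma nsq_class (f : sqfun mu) : nsq (@L2_dot _ _ R mu) (L2_class f) = fine (sqnorm mu f).
Proof. by rewrite /nsq L2_dot_class inner_self. Qed.

Lemma sqnorm_fineK (f : sqfun mu) : (fine (sqnorm mu f))%:E = sqnorm mu f.
Proof. by rewrite fineK// ge0_fin_numE ?sqnorm_ge0//; have [] := sqfunP f. Qed.

End L2Hilbert.

(** * Completeness of L^2 *)

Lemma cvgn_of_geometric_step (R : realType) (a : nat -> R) (c q : R) :
  0 <= q < 1 -> 0 <= c -> (forall k, `|a k.+1 - a k| <= c * q ^+ k) -> cvgn a.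
Proof.
move=> /andP[q0 q1] c0 ha.
have -> : a = (fun n => a 0%N + series (telescope a) n).
  by apply/funext => n; exact: eq_sum_telescope.
apply: is_cvgD; first exact: is_cvg_cst.
apply: normed_cvg; apply: (@series_le_cvg _ _ (geometric c q)).
- by move=> n; exact: normr_ge0.
- by move=> n; rewrite /= mulr_ge0 ?exprn_ge0.
- by move=> n; exact: ha.
- by apply: is_cvg_geometric_series; rewrite ger0_norm.
Qed.

Lemma limn_einf_le (R : realType) (u : nat -> \bar R) (c : \bar R) :
  (forall n, (u n <= c)%E) -> (limn_einf u <= c)%E.
Proof.
move=> uc; rewrite limn_einf_lim; apply: lime_le; first exact: is_cvg_einfs.
apply: nearW => n; apply: le_trans (uc n); apply: ereal_inf_lbound.
by exists n => /=.
Qed.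

Section L2Complete.
Context d (T : measurableType d) (R : realType).
Variable mu : {measure set T -> \bar R}.
Local Notation C := R[i].
Local Notation Re := (@complex.Re R).
Local Notation Im := (@complex.Im R).
Local Notation dot := (@L2_dot _ _ R mu).

Lemma hnorm_class_lt (f : sqfun mu) (e : R) : 0 < e ->
  (hnorm dot (L2_class f) < e) = (sqnorm mu f < (e ^+ 2)%:E)%E.
Proof.
move=> e0; have f0 : 0 <= fine (sqnorm mu f) by rewrite fine_ge0// sqnorm_ge0.
rewrite /hnorm -/(nsq dot (L2_class f)) nsq_class -sqnorm_fineK lte_fin.
by rewrite -[RHS](@ltr_sqrt R) ?exprn_gt0// sqrtr_sqr ger0_norm// ltW.
Qed.

(* [\int \sum_k 2^k |g_(k+1) - g_k|^2] is finite, so that almost everywhere the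
   increments are dominated by a geometric sequence. *)
Section FastCauchy.
Variable g : nat -> sqfun mu.
Hypothesis gfast : forall k, (sqnorm mu (g k.+1 - g k)%R <= ((2^-1 ^+ k) ^+ 2)%:E)%E.

Let df k x := normc (g k.+1 x - g k x) ^+ 2.

Let mdf k : measurable_fun setT (EFin \o df k).
Proof. by apply: measurable_normc_sqr; have [] := sqfunP (g k.+1 - g k). Qed.

Let tm k x : \bar R := (2 ^+ k)%:E * (df k x)%:E.

Let tm0 k x : (0 <= tm k x)%E.
Proof. by rewrite mule_ge0 ?lee_fin ?sqr_ge0. Qed.

Let mtm k : measurable_fun setT (tm k).
Proof. by apply: measurable_funeM; exact: mdf. Qed.

Let G x : \bar R := (\sum_(0 <= k <oo) tm k x)%E.

Let mG : measurable_fun setT G.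
Proof. by apply: (@ge0_emeasurable_sum _ _ _ setT tm xpredT). Qed.

Let E := [set x | G x \is a fin_num].

Let mE : measurable E.
Proof. by have := emeasurable_fin_num measurableT mG; rewrite setTI. Qed.

Let G_ge0 x : (0 <= G x)%E. Proof. by apply: nneseries_ge0 => k _ _; exact: tm0. Qed.

Let intG : (\int[mu]_x G x <= 2%:E)%E.
Proof.
rewrite integral_nneseries//.
apply: lime_le; first by apply: is_cvg_nneseries => k _ _; exact: integral_ge0.
apply: nearW => n; apply: (@le_trans _ _ (\sum_(0 <= k < n) (2^-1 ^+ k)%:E)%E).
  apply: lee_sum => k _.
  have -> : (\int[mu]_x tm k x)%E = ((2 ^+ k)%:E * sqnorm mu (g k.+1 - g k)%R)%E.
    by apply: ge0_integralZl_EFin => //; [move=> x _; rewrite lee_fin sqr_ge0|exact: mdf].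
  apply: (@le_trans _ _ ((2 ^+ k)%:E * ((2^-1 ^+ k) ^+ 2)%:E)%E).
    by rewrite lee_wpmul2l ?lee_fin//; exact: gfast.
  by rewrite -EFinM lee_fin expr2 mulrA -exprMn divff// expr1n mul1r.
rewrite sumEFin lee_fin.
suff -> : \sum_(0 <= k < n) (2^-1 ^+ k : R) = 2 - 2 * 2^-1 ^+ n.
  by rewrite gerBl mulr_ge0.
elim: n => [|n ih]; first by rewrite big_geq// expr0; ring.
by rewrite big_nat_recr//= ih exprS; field.
Qed.

Let aeE : {ae mu, forall x, E x}.
Proof.
have iG : mu.-integrable setT G.
  apply/integrableP; split => //.
  rewrite (eq_integral G) => [|x _]; last by rewrite gee0_abs.
  exact: le_lt_trans intG (ltry _).
by apply: filterS (integrable_ae measurableT iG) => x /(_ I).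
Qed.

(** A single term of [G x] is at most [G x]; taking square roots leaves a geometric sequence of
    ratio 2^(-1/2). *)
Let geom x k : E x -> normc (g k.+1 x - g k x) <=
  Num.sqrt (fine (G x)) * (Num.sqrt 2^-1) ^+ k.
Proof.
move=> Ex.
have h : (tm k x <= G x)%E.
  apply: le_trans (nneseries_lim_ge k.+1 _) => //.
  by rewrite big_nat_recr//= leeDr// sume_ge0.
have g0 : 0 <= fine (G x) by rewrite fine_ge0.
rewrite -ler_sqr ?nnegrE ?normc_ge0 ?mulr_ge0 ?exprn_ge0 ?sqrtr_ge0//.
rewrite exprMn sqr_sqrtr// exprAC sqr_sqrtr//.
rewrite /tm -(fineK Ex) -EFinM lee_fin in h.
by rewrite -(@ler_pM2l _ (2 ^+ k)) ?exprn_gt0// [leRHS]mulrCA -exprMn divff// expr1n mulr1.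
Qed.

(** Setting the values to 0 on the null set where [G] is infinite makes the sequence converge at
    every point, so that its limit is measurable. *)
Let masked (a : C -> R) k x := (\1_E x : R) * a (g k x).

Let masked_cvg (a : C -> R) x : (forall z w, a (z - w) = a z - a w) ->
  (forall z, `|a z| <= normc z) -> cvgn (fun k => masked a k x).
Proof.
move=> aB aN; rewrite /masked; have [Ex|nEx] := pselect (E x); last first.
  by rewrite indicE memNset//; under eq_fun do rewrite mul0r; exact: is_cvg_cst.
rewrite indicE mem_set//; under eq_fun do rewrite mul1r.
apply: (@cvgn_of_geometric_step _ _ (Num.sqrt (fine (G x))) (Num.sqrt 2^-1)).
- rewrite sqrtr_ge0/= -[ltRHS]sqrtr1 ltr_sqrt// invf_lt1//; lra.
- exact: sqrtr_ge0.
by move=> k; rewrite -aB; apply: le_trans (aN _) _; exact: geom.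
Qed.

Let ReB (z w : C) : Re (z - w) = Re z - Re w. Proof. by case: z w => [? ?] []. Qed.
Let ImB (z w : C) : Im (z - w) = Im z - Im w. Proof. by case: z w => [? ?] []. Qed.
Let ImN (z : C) : `|Im z| <= normc z.
Proof. by case: z => a b /=; rewrite -sqrtr_sqr ler_wsqrtr// lerDr sqr_ge0. Qed.

Let hr x := limn (fun k => masked Re k x).
Let hi x := limn (fun k => masked Im k x).
Let h x : C := hr x +i* hi x.
Let gm k x : C := masked Re k x +i* masked Im k x.

Let mgm k : cmeasurable (gm k : T -> C^o).
Proof.
have [[mr mi] _] := sqfunP (g k).
by split => /=; apply: measurable_funM => //; exact: measurable_indic.
Qed.

Let mh : cmeasurable (h : T -> C^o).
Proof.
split=> /=.
  apply: (@measurable_fun_cvg _ _ _ _ (masked Re)) => [k|x _].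
    by have [] := mgm k.
  by apply: masked_cvg => //; exact: ler_Re_normc.
apply: (@measurable_fun_cvg _ _ _ _ (masked Im)) => [k|x _].
  by have [] := mgm k.
by apply: masked_cvg.
Qed.

(** Fatou's lemma: |f - h|^2 is almost everywhere the limit of the |f - g_j|^2; indices are shifted
    by [J] so that the bound holds along the whole sequence. [h] is a mere measurable function here,
    its square-integrability being a consequence of this estimate. *)
Lemma fast_cauchy_limit : exists h : T -> C^o, cmeasurable h /\
  forall (f : sqfun mu) (c : \bar R) J,
    (forall j, (J <= j)%N -> (sqnorm mu (f - g j)%R <= c)%E) ->
    (sqnorm mu (fun x => (f x - h x)%R) <= c)%E.
Proof.
exists h; split=> // f c J hc.
have [mf _] := sqfunP f.
have mB (a b : T -> C^o) : cmeasurable a -> cmeasurable b ->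
    cmeasurable ((fun x => a x - b x) : T -> C^o).
  move=> [ar ai] [br bi]; split.
    by under eq_fun do rewrite ReB; exact: measurable_funB.
  by under eq_fun do rewrite ImB; exact: measurable_funB.
pose w j x := (normc (f x - gm (j + J) x) ^+ 2)%:E.
have -> : sqnorm mu ((fun x => (f x - h x)%R) : T -> C^o) = (\int[mu]_x limn_einf (w ^~ x))%E.
  apply: eq_integral => x _.
  have cr : masked Re j x @[j --> \oo] --> hr x.
    by apply: masked_cvg => //; exact: ler_Re_normc.
  have ci : masked Im j x @[j --> \oo] --> hi x by apply: masked_cvg.
  have wc : w j x @[j --> \oo] --> (normc (f x - h x) ^+ 2)%:E.
    apply: cvg_EFin; first exact: nearW.
    rewrite normc_sqr ReB ImB /=.
    rewrite (_ : fine \o _ = (fun j => (Re (f x) - masked Re (j + J) x) ^+ 2 +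
       (Im (f x) - masked Im (j + J) x) ^+ 2)); last first.
      by apply/funext => j /=; rewrite normc_sqr ReB ImB.
    have {}cr : masked Re (j + J) x @[j --> \oo] --> hr x.
      by rewrite -(cvg_shiftn J) in cr.
    have {}ci : masked Im (j + J) x @[j --> \oo] --> hi x.
      by rewrite -(cvg_shiftn J) in ci.
    rewrite !expr2; apply: cvgD; apply: cvgM; apply: cvgB => //; exact: cvg_cst.
  by rewrite is_cvg_limn_einfE ?(cvg_lim _ wc)//; apply/cvg_ex; eexists; exact: wc.
apply: le_trans (fatou _ _ _ _) _ => //.
- by move=> j; apply: measurable_normc_sqr; exact: mB.
- by move=> j x _; rewrite lee_fin sqr_ge0.
apply: limn_einf_le => j.
apply: le_trans (hc (j + J)%N (leq_addl _ _)).
rewrite le_eqVlt; apply/orP; left; apply/eqP.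
apply: (@sqnorm_ae _ _ _ mu (fun x => f x - gm (j + J) x) (f - g (j + J)%N)).
- exact: mB.
- by have [] := sqfunP (f - g (j + J)%N).
apply: filterS aeE => x Ex.
rewrite [RHS](_ : _ = f x - g (j + J)%N x)//; congr (_ - _).
by rewrite /gm /masked indicE mem_set// !mul1r; case: (g _ x).
Qed.

End FastCauchy.

Lemma L2_complete (u : nat -> L2 mu) :
  (forall e : R, 0 < e -> exists N, forall i j,
       (N <= i)%N -> (N <= j)%N -> hnorm dot (u i - u j) < e) ->
  exists v, hnorm dot (u k - v) @[k --> \oo] --> (0 : R).
Proof.
move=> hu.
pose F k : sqfun mu := repr (u k).
have uF k : u k = L2_class (F k) by rewrite L2_classK.
have hF (e : R) : 0 < e -> exists N, forall i j, (N <= i)%N -> (N <= j)%N ->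
    (sqnorm mu (F i - F j)%R < (e ^+ 2)%:E)%E.
  move=> e0; have [N hN] := hu e e0; exists N => i j Ni Nj.
  by rewrite -hnorm_class_lt// L2_classB -!uF hN.
have e0 k : 0 < (2^-1 ^+ k : R) by rewrite exprn_gt0.
have /choice[N hN] := fun k => hF _ (e0 k).
(* Summing all earlier thresholds makes [s] monotone and at least [N k]; the extra [k] makes it
   unbounded. *)
pose s k := (k + \sum_(i < k.+1) N i)%N.
have sN k : (N k <= s k)%N by rewrite /s big_ord_recr /= addnA leq_addl.
have sS k : (s k <= s k.+1)%N.
  by rewrite /s [in X in (_ <= X)%N]big_ord_recr /= leq_add// leq_addr.
have sk k : (k <= s k)%N by exact: leq_addr.
have gfast k : (sqnorm mu (F (s k.+1) - F (s k))%R <= ((2^-1 ^+ k) ^+ 2)%:E)%E.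
  by apply/ltW/hN => //; exact: leq_trans (sN k) (sS k).
have [h [mh hlim]] := @fast_cauchy_limit (F \o s) gfast.
have lim (e : R) : 0 < e -> exists K, forall k, (K <= k)%N ->
    (sqnorm mu (fun x => (F k x - h x)%R) <= (e ^+ 2)%:E)%E.
  move=> e0'; have [K hK] := hF e e0'; exists K => k Kk.
  apply: (hlim _ _ K) => j Kj; apply/ltW/hK => //.
  exact: leq_trans Kj (sk j).
have [K hK] := lim 1 ltr01.
have [[Fr Fi] _] := sqfunP (F K).
(* The limit estimate with e = 1 bounds F K - h in norm; [h] is then recovered as a difference of
   two square-integrable functions. *)
have Dsq : ((fun x => F K x - h x) : T -> C^o) \in sqint mu.
  rewrite inE; split; last exact: le_lt_trans (hK K (leqnn K)) (ltry _).
  case: mh => hr hi; split.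
    by under eq_fun do rewrite ReD ReN; exact: measurable_funB.
  rewrite (_ : (fun x => _) = (fun x => Im (F K x) - Im (h x))); first exact: measurable_funB.
  by apply/funext => x; case: (F K x) (h x) => [? ?] [].
pose H := F K - Sqfun Dsq.
have HE x : (H : T -> C) x = h x.
  by rewrite [LHS](_ : _ = F K x - (F K x - h x))// opprB addrC subrK.
exists (L2_class H); apply/hcvgP => e e0'.
have e2 : 0 < e / 2 by rewrite divr_gt0.
have [K' hK'] := lim _ e2; exists K' => k Kk.
rewrite uF -L2_classB hnorm_class_lt//.
apply: le_lt_trans (_ : ((e / 2) ^+ 2)%:E < _)%E.
  apply: le_trans (hK' k Kk); rewrite le_eqVlt; apply/orP; left; apply/eqP.
  apply: eq_integral => x _; congr (normc _ ^+ 2)%:E.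
  by rewrite -HE.
by rewrite lte_fin ltr_pXn2r ?nnegrE ?(ltW e0') ?(ltW e2)//; lra.
Qed.

Lemma L2_hilbert : hilbert dot.
Proof.
split.
- by elim/L2_ind => f; elim/L2_ind => g; elim/L2_ind => k;
    rewrite -L2_classD !L2_dot_class innerDl.
- by move=> a; elim/L2_ind => f; elim/L2_ind => k;
    rewrite -L2_classZ !L2_dot_class innerZl.
- by elim/L2_ind => f; elim/L2_ind => g; rewrite !L2_dot_class innerC.
- elim/L2_ind => f; rewrite L2_dot_class inner_self ler0c fine_ge0//.
  exact: sqnorm_ge0.
- elim/L2_ind => f; rewrite L2_dot_class inner_self => /complexI f0.
  rewrite -L2_class0; apply/L2_classP; apply: sqnorm_eq0; first by have [] := sqfunP f.
  by rewrite -sqnorm_fineK f0.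
- exact: L2_complete.
Qed.

End L2Complete.

(** * Hermite functions *)

Section GaussPoly.
Variable R : realType.
Local Notation mu := (@lebesgue_measure R).
Implicit Type p q : {poly R}.

(** [gauss_fun] is e^(-t^2), the weight that appears in a product of two Hermite functions. *)
Definition gpoly p (t : R) : R := p.[t] * gauss_fun t.

(** With y = |t| / (i + 1), |t|^i = (i + 1)^i y^i <= (i + 1)^i e^(i y) <= (i + 1)^i e^|t|; dividing
    by i + 1 rather than i covers the constant term. *)
Lemma horner_norm_le p : exists2 C, 0 <= C & forall t : R, `|p.[t]| <= C * expR `|t|.
Proof.
exists (\sum_(i < size p) `|p`_i| * i.+1%:R ^+ i).
  by apply: sumr_ge0 => i _; rewrite mulr_ge0// exprn_ge0.
move=> t; rewrite horner_coef mulr_suml; apply: le_trans (ler_norm_sum _ _ _) _.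
apply: ler_sum => i _; rewrite normrM normrX -mulrA ler_wpM2l//.
have h : `|t| / i.+1%:R <= expR (`|t| / i.+1%:R).
  by apply: le_trans (expR_ge1Dx _); rewrite lerDr.
have -> : `|t| = i.+1%:R * (`|t| / i.+1%:R) by rewrite mulrC divfK// pnatr_eq0.
set x := `|t| / i.+1%:R in h *; have x0 : 0 <= x by rewrite divr_ge0.
rewrite exprMn ler_wpM2l ?exprn_ge0//.
apply: le_trans (_ : expR x ^+ i <= _); first by rewrite lerXn2r ?nnegrE ?expR_ge0.
rewrite -expRM_natl ler_expR ler_wpM2r// ler_nat leqnSn //.
Qed.

(** From |t| <= 1/2 + t^2 / 2, the exponential growth of [p] costs half of the Gaussian and a factor
    e^(1/2). *)
Lemma gpoly_norm_le p : exists2 C, 0 <= C &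
  forall t, `|gpoly p t| <= C * expR (- (t ^+ 2) / 2).
Proof.
have [C C0 hC] := horner_norm_le p; exists (C * expR 2^-1).
  by rewrite mulr_ge0 ?expR_ge0.
move=> t; rewrite normrM (ger0_norm (expR_ge0 _)).
apply: le_trans (ler_wpM2r (expR_ge0 _) (hC t)) _.
rewrite -!mulrA ler_wpM2l// -!expRD ler_expR.
have := sqr_ge0 (`|t| - 1); rewrite sqrrB1 real_normK ?num_real//; lra.
Qed.

Lemma integrable_gauss_half :
  mu.-integrable setT (EFin \o (fun t : R => expR (- (t ^+ 2) / 2))).
Proof.
have := @integrable_normal_pdf R 0 1.
move=> /(integrableZl measurableT (normal_peak (1 : R))^-1).
apply: eq_integrable => // t _ /=.
rewrite normal_pdfE// -EFinM mulKf ?gt_eqF ?normal_peak_gt0//.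
by rewrite /normal_fun subr0 expr1n.
Qed.

Lemma measurable_gpoly p : measurable_fun setT (gpoly p).
Proof.
apply: measurable_funM; last exact: measurable_gauss_fun.
by apply: continuous_measurable_fun; exact: continuous_horner.
Qed.

Lemma integrable_gpoly p : mu.-integrable setT (EFin \o gpoly p).
Proof.
have [C C0 hC] := gpoly_norm_le p.
have := integrableZl measurableT C integrable_gauss_half.
apply: le_integrable => //; first by apply/measurable_EFinP; exact: measurable_gpoly.
move=> t _ /=; rewrite lee_fin; apply: le_trans (hC t) _.
exact: ler_norm.
Qed.

Definition gint p : R := \int[mu]_t gpoly p t.

Lemma gintD p q : gint (p + q) = gint p + gint q.
Proof.
rewrite /gint -RintegralD//; [|exact: integrable_gpoly..].
by congr Rintegral; apply/funext => t; rewrite /gpoly hornerD mulrDl.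
Qed.

Lemma gintZ a p : gint (a *: p) = a * gint p.
Proof.
rewrite /gint -RintegralZl//; last exact: integrable_gpoly.
by congr Rintegral; apply/funext => t; rewrite /gpoly hornerZ mulrA.
Qed.

Lemma gintB p q : gint (p - q) = gint p - gint q.
Proof. by rewrite -scaleN1r gintD gintZ mulN1r. Qed.

Lemma gint1 : gint 1 = Num.sqrt pi.
Proof.
rewrite /gint; have -> : gpoly 1 = gauss_fun by apply/funext => t; rewrite /gpoly hornerC mul1r.
by rewrite /Rintegral integralT_gauss.
Qed.

Lemma is_derive_gpoly p (t : R) :
  is_derive t (1 : R) (gpoly p) (gpoly (p^`() - 2 *: ('X * p)) t).
Proof.
have h1 := is_derive_poly p t.
have h2 : is_derive t (1 : R) (expR \o horner (- 'X^2))
    (expR (- 'X^2 : {poly R}).[t] * (- 'X^2 : {poly R})^`().[t]).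
  exact: is_derive1_comp.
have -> : gpoly p = horner p * (expR \o horner (- 'X^2)).
  by apply/funext => x; congr (_ * expR _); rewrite hornerN hornerXn.
apply: (is_derive_eq (is_deriveM h1 h2)).
change (p.[t] * (expR (- 'X^2 : {poly R}).[t] * (- 'X^2 : {poly R})^`().[t]) +
  expR (- 'X^2 : {poly R}).[t] * p^`().[t] = gpoly (p^`() - 2 *: ('X * p)) t).
rewrite /gpoly /gauss_fun derivN derivXn expr1 !hornerN hornerMn hornerXn.
rewrite hornerD hornerN hornerZ hornerM hornerX; ring.
Qed.

Lemma gpoly_cvg0 p : (gpoly p n.+1%:R @[n --> \oo] --> (0 : R)) /\
  (gpoly p (- n.+1%:R) @[n --> \oo] --> (0 : R)).
Proof.
have [C C0 hC] := gpoly_norm_le p.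
have Ch : C * harmonic n @[n --> \oo] --> (0 : R).
  by rewrite -(mulr0 C); apply: cvgMr; exact: cvg_harmonic.
have bd n (x : R) : x ^+ 2 = n.+1%:R ^+ 2 -> `|gpoly p x| <= C * harmonic n.
  move=> x2; apply: le_trans (hC x) _; rewrite ler_wpM2l// x2 mulNr expRN /harmonic /=.
  rewrite lef_pV2 ?posrE ?expR_gt0//; apply: le_trans (expR_ge1Dx _).
  have := sqr_ge0 (n.+1%:R - 1 : R); rewrite sqrrB1; lra.
split; apply/norm_cvg0P; apply: (squeeze_cvgr _ (cvg_cst 0) Ch); near=> n;
  rewrite normr_ge0 bd//.
by rewrite sqrrN.
Unshelve. all: by end_near. Qed.

(** Integration by parts on the line. The difference of the two integrands is the derivative of
    [gpoly p]; on [-(n + 1), n + 1] its integral is a boundary term tending to 0, and dominated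
    convergence gives the integral over the line. *)
Lemma gint_deriv p : gint p^`() = gint (2 *: ('X * p)).
Proof.
apply/eqP; rewrite -subr_eq0 -gintB; apply/eqP.
set q := (_ - _).
pose I n : set R := `[- n.+1%:R, n.+1%:R]%classic.
pose f n (t : R) : \bar R := ((\1_(I n) t : R) * gpoly q t)%:E.
have mI n : measurable (I n) by exact: measurable_itv.
have h1 n : measurable_fun setT (f n).
  apply/measurable_EFinP; apply: measurable_funM; last exact: measurable_gpoly.
  exact: measurable_indic.
have h2 : measurable_fun setT (EFin \o gpoly q).
  by apply/measurable_EFinP; exact: measurable_gpoly.
have h3 : {ae mu, forall t, setT t -> f n t @[n --> \oo] --> (EFin \o gpoly q) t}.
  apply: aeW => t _; apply: cvg_near_cst.
  exists (Num.truncn `|t|) => // n /= tn; rewrite /f indicE mem_set ?mul1r//=.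
  rewrite /I /= in_itv /= -ler_norml ltW//.
  have := truncn_itv (normr_ge0 t) => /andP[_ h]; apply: lt_le_trans h _.
  by rewrite ler_nat.
have h4 : mu.-integrable setT (fun t => `|gpoly q t|%:E).
  exact: (integrable_abse (integrable_gpoly q)).
have h5 : {ae mu, forall t, forall n, setT t -> (`|f n t| <= `|gpoly q t|%:E)%E}.
  apply: aeW => t n _; rewrite /f /= lee_fin normrM indicE.
  by case: (_ \in _); rewrite ?normr1 ?normr0 ?mul1r ?mul0r.
have [_ _ h] := @dominated_convergence _ _ _ mu setT measurableT f (EFin \o gpoly q) _
  h1 h2 h3 h4 h5.
have E n : (\int[mu]_t f n t = (gpoly p n.+1%:R - gpoly p (- n.+1%:R))%:E)%E.
  rewrite EFinB -(@continuous_FTC2 _ (gpoly q) (gpoly p)).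
  - rewrite [RHS]integral_mkcond; apply: eq_integral => t _.
    rewrite /f patchE indicE -/(I n).
    by case: (_ \in _); rewrite ?mul1r ?mul0r.
  - by rewrite gtrN.
  - apply: continuous_subspaceT => x.
    by apply: differentiable_continuous; apply/derivable1_diffP; have [] := is_derive_gpoly q x.
  - split.
    + by move=> x _; have [] := is_derive_gpoly p x.
    + apply: cvg_at_right_filter; apply: differentiable_continuous.
      by apply/derivable1_diffP; have [] := is_derive_gpoly p (- n.+1%:R).
    + apply: cvg_at_left_filter; apply: differentiable_continuous.
      by apply/derivable1_diffP; have [] := is_derive_gpoly p n.+1%:R.
  - by move=> x _; rewrite derive1E; have := is_derive_gpoly p x => -[].
have [c1 c2] := gpoly_cvg0 p.
rewrite /gint /Rintegral.
have h0 : (\int[mu]_t f n t)%E @[n --> \oo] --> (0 : \bar R).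
  under eq_fun do rewrite E.
  apply: cvg_EFin; first exact: nearW.
  by rewrite -[X in _ --> X](subr0 0); exact: cvgB.
by rewrite -(cvg_lim _ h)// (cvg_lim _ h0).
Qed.

End GaussPoly.

Section Hermite1.
Variable R : realType.
Local Notation mu := (@lebesgue_measure R).
Implicit Type p q : {poly R}.
Local Notation He := (hermite_poly R).

(* Gaussian integration by parts, applied [k] times. *)
Lemma gint_hermite k p : gint (p * He k) = gint p^`(k).
Proof.
elim: k p => [|k ih] p; first by rewrite mulr1.
rewrite derivSn -ih [He _]/=.
have -> : p * (2%:R *: ('X * He k) - (He k)^`()) =
    2 *: ('X * (p * He k)) - p * (He k)^`().
  by rewrite mulrBr -scalerAr mulrCA.
rewrite gintB -gint_deriv derivM gintD; ring.
Qed.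

Lemma size_hermite k : (size (He k) <= k.+1)%N.
Proof.
elim: k => [|k ih]; first by rewrite size_poly1.
rewrite /=; apply: leq_trans (size_polyD _ _) _; rewrite geq_max; apply/andP; split.
  apply: leq_trans (size_scale_leq _ _) _; apply: leq_trans (size_polyMleq _ _) _.
  by rewrite size_polyX /= ltnS.
rewrite size_polyN; apply/leq_sizeP => j kj; rewrite coef_deriv nth_default ?mul0rn//.
by apply: leq_trans ih _; rewrite ltnW// ltnW.
Qed.

Lemma coef_hermite k : (He k)`_k = 2 ^+ k.
Proof.
elim: k => [|k ih]; first by rewrite coefC.
rewrite [He _]/= coefB coefZ coefXM /= ih coef_deriv nth_default ?mul0rn ?subr0 ?exprS//.
by apply: leq_trans (size_hermite k) _; rewrite ltnS leqnSn.
Qed.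

Lemma derivn_hermite k : (He k)^`(k) = (2 ^+ k * k`!%:R)%:P.
Proof.
apply/polyP => i; rewrite coef_derivn coefC; have [->|i0] := eqVneq i 0%N.
  by rewrite addn0 coef_hermite ffactnn mulr_natr.
rewrite nth_default ?mul0rn//; apply: leq_trans (size_hermite k) _.
by rewrite -addn1 leq_add2l lt0n.
Qed.

(** Taking j <= k by symmetry, the integral reduces to that of the k-th derivative of [He j], which
    vanishes for j < k by degree and is the constant 2^k k! for j = k. *)
Lemma gint_hermite_hermite j k : gint (He j * He k) =
  (j == k)%:R * (2 ^+ k * k`!%:R * Num.sqrt pi).
Proof.
wlog jk : j k / (j <= k)%N.
  move=> h; have [jk|kj] := leqP j k; first exact: h.
  by rewrite mulrC h ?(ltnW kj)// eq_sym; case: eqP kj => [->|_ _]; rewrite ?ltnn// !mul0r.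
rewrite gint_hermite; have [->|jnk] := eqVneq j k.
  by rewrite derivn_hermite -alg_polyC gintZ gint1 mul1r.
rewrite derivn_poly0; last by apply: leq_trans (size_hermite j) _; rewrite ltn_neqAle jnk.
by rewrite mul0r -(scale0r 0) gintZ mul0r.
Qed.

Let cst1 k := 2 ^+ k * k`!%:R * Num.sqrt pi : R.

Let cst1_gt0 k : 0 < cst1 k.
Proof. by rewrite /cst1 !mulr_gt0 ?exprn_gt0 ?ltr0n ?fact_gt0 ?sqrtr_gt0 ?pi_gt0. Qed.

Lemma hermite1M j k t : @hermite1 R j t * hermite1 k t =
  (cst1 j `^ (- 2^-1) * cst1 k `^ (- 2^-1)) * gpoly (He j * He k) t.
Proof.
rewrite /hermite1 -/(cst1 _) -/(cst1 _) /gpoly hornerM.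
have -> : gauss_fun t = expR (- t ^+ 2 / 2) * expR (- t ^+ 2 / 2).
  by rewrite -expRD -splitr.
ring.
Qed.

Lemma measurable_hermite1 k : measurable_fun setT (@hermite1 R k).
Proof.
apply: measurable_funM.
  apply: measurable_funM; first exact: measurable_cst.
  by apply: continuous_measurable_fun; exact: continuous_horner.
apply: measurableT_comp => //; apply: measurable_funM => //.
by apply: measurable_funN; exact: measurable_funX.
Qed.

Lemma integrable_hermite1M j k :
  mu.-integrable setT (EFin \o (fun t => @hermite1 R j t * hermite1 k t)).
Proof.
under eq_fun do rewrite hermite1M.
have := integrableZl measurableT (cst1 j `^ (- 2^-1) * cst1 k `^ (- 2^-1))
  (integrable_gpoly (He j * He k)).
by apply: eq_integrable.
Qed.

Lemma Rintegral_hermite1M j k :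
  \int[mu]_t (@hermite1 R j t * hermite1 k t) = (j == k)%:R.
Proof.
under eq_fun do rewrite hermite1M.
rewrite RintegralZl//; last exact: integrable_gpoly.
rewrite -/(gint _) gint_hermite_hermite -/(cst1 k).
have [->|] := eqVneq j k; last by rewrite mul0r mulr0.
rewrite -powRD; last by rewrite (gt_eqF (cst1_gt0 k)) implybT.
have -> : - 2^-1 - 2^-1 = -1 :> R by field.
by rewrite powR_inv1 ?(ltW (cst1_gt0 k))// mul1r mulVf// gt_eqF.
Qed.

End Hermite1.

(** * Product functions on R^n *)

Section TupleProd.
Variable R : realType.
Local Notation mR := (measurableTypeR R).

Definition tuple_prod n (g : 'I_n -> R -> R) (x : n.-tuple mR) : R :=
  \prod_(j < n) g j (tnth x j).

Lemma measurable_tuple_prod n (g : 'I_n -> R -> R) :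
  (forall j, measurable_fun setT (g j)) -> measurable_fun setT (tuple_prod g).
Proof.
move=> mg; apply: measurable_prod => j _.
by apply: measurableT_comp (mg j) _; exact: measurable_tnth.
Qed.

Lemma tuple_prod_tcons n (g : 'I_n.+1 -> R -> R) (p : mR * n.-tuple mR) :
  tuple_prod g (tcons p) = g ord0 p.1 * tuple_prod (fun j => g (lift ord0 j)) p.2.
Proof.
rewrite /tuple_prod big_ord_recl; congr (_ * _).
by apply: eq_bigr => j _; congr (g _ _); rewrite (tnth_nth 0) [RHS](tnth_nth 0).
Qed.

(** Fubini's theorem by induction on n, through the pushforward along [tcons] that defines the
    measure; the base case is the Dirac mass at the empty tuple, matching the empty product 1. *)
Lemma integrable_tuple_prod n (g : 'I_n -> R -> R) :
  (forall j, measurable_fun setT (g j)) ->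
  (forall j, (@lebesgue_measure R).-integrable setT (EFin \o g j)) ->
  (@lebesgue_tuple R n).-integrable setT (EFin \o tuple_prod g) /\
  \int[@lebesgue_tuple R n]_x tuple_prod g x =
    \prod_(j < n) \int[@lebesgue_measure R]_t g j t.
Proof.
elim: n g => [|n ih] g mg ig.
  have E x : tuple_prod g x = 1 by rewrite /tuple_prod big_ord0.
  have -> : tuple_prod g = cst 1 by apply/funext.
  split.
    apply/integrableP; split; first by apply/measurable_EFinP; exact: measurable_cst.
    rewrite (eq_integral (cst 1%E)) => [|x _ /=]; last by rewrite normr1.
    by rewrite integral_dirac//= diracE mem_set//= mul1e ltry.
  rewrite big_ord0 /Rintegral (eq_integral (cst 1%E))// integral_dirac//.
  by rewrite diracE mem_set//= mulr1.
have mgp := measurable_tuple_prod mg.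
pose g' j := g (lift ord0 j).
have [ihi ihE] := ih g' (fun j => mg _) (fun j => ig _).
set m1 := @lebesgue_measure R; set m2 := @lebesgue_tuple R n.
pose G (p : mR * n.-tuple mR) := g ord0 p.1 * tuple_prod g' p.2.
have GE : tuple_prod g \o @tcons R n = G by apply/funext => p; exact: tuple_prod_tcons.
have mG : measurable_fun setT (EFin \o G).
  apply/measurable_EFinP; rewrite -GE; apply: measurableT_comp mgp _.
  exact: measurable_tcons.
have iG : (m1 \x m2)%E.-integrable setT (EFin \o G).
  apply/(integrable12ltyP m1 m2 mG).
  have -> : (\int[m1]_x \int[m2]_y `|(EFin \o G) (x, y)| =
      \int[m1]_x (`|(g ord0 x)%:E| * \int[m2]_y `|(tuple_prod g' y)%:E|))%E.
    apply: eq_integral => x _; rewrite -ge0_integralZl//.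
    - by apply: eq_integral => y _; rewrite /= -EFinM normrM.
    - apply: measurableT_comp => //; apply/measurable_EFinP.
      by apply: measurable_tuple_prod => j; exact: mg.
  have [_ fin2] := integrableP _ _ _ ihi; have [_ fin1] := integrableP _ _ _ (ig ord0).
  rewrite ge0_integralZr//.
  - by rewrite lte_mul_pinfty// ?integral_ge0// ge0_fin_numE// integral_ge0.
  - by apply: measurableT_comp => //; apply/measurable_EFinP; exact: mg.
  - by apply: integral_ge0.
have iT : (lebesgue_step m2).-integrable setT (EFin \o tuple_prod g).
  apply/integrableP; split; first exact/measurable_EFinP.
  have [_ fin] := integrableP _ _ _ iG.
  rewrite (ge0_integral_pushforward (@measurable_tcons R n)) //.
    apply: le_lt_trans fin; rewrite le_eqVlt; apply/orP; left; apply/eqP.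
    by rewrite preimage_setT; apply: eq_integral => p _ /=; rewrite tuple_prod_tcons.
  by apply: measurableT_comp => //; apply/measurable_EFinP.
split; first exact: iT.
rewrite big_ord_recl -ihE /Rintegral.
have -> : (\int[@lebesgue_tuple R n.+1]_x (tuple_prod g x)%:E =
    \int[m1 \x m2]_p (EFin \o G) p)%E.
  rewrite [LHS](integral_pushforward (@measurable_tcons R n))//.
  - by rewrite preimage_setT; apply: eq_integral => p _ /=; rewrite tuple_prod_tcons.
  - exact/measurable_EFinP.
  - apply: eq_integrable iG => // p _ /=; by rewrite tuple_prod_tcons.
rewrite -integral12_prod_meas1//.
pose c := \int[m2]_y tuple_prod g' y.
have cE : (\int[m2]_y (tuple_prod g' y)%:E = c%:E)%E.
  by rewrite fineK//; exact: (integrable_fin_num measurableT ihi).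
have -> : (\int[m1]_x fubini_F m2 (EFin \o G) x = \int[m1]_x ((g ord0 x)%:E * c%:E))%E.
  by apply: eq_integral => x _; rewrite /fubini_F -cE -integralZl.
rewrite integralZr//; last exact: ig.
by rewrite fineM//; exact: (integrable_fin_num measurableT (ig ord0)).
Qed.

Lemma measurable_hermite n (nu : n.-tuple nat) : measurable_fun setT (@hermite R n nu).
Proof.
apply: (@measurable_tuple_prod n (fun j => @hermite1 R (tnth nu j))) => j.
exact: measurable_hermite1.
Qed.

Lemma hermite_orthonormal n (nu nu' : n.-tuple nat) :
  \int[@lebesgue_tuple R n]_x (hermite nu x * hermite nu' x) = (nu == nu')%:R.
Proof.
pose g (j : 'I_n) (t : R) := hermite1 (tnth nu j) t * hermite1 (tnth nu' j) t.
have mg j : measurable_fun setT (g j).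
  by apply: measurable_funM; exact: measurable_hermite1.
have ig j : (@lebesgue_measure R).-integrable setT (EFin \o g j).
  exact: integrable_hermite1M.
have [_] := integrable_tuple_prod mg ig.
rewrite (_ : tuple_prod g = (fun x => hermite nu x * hermite nu' x)); last first.
  by apply/funext => x; rewrite /tuple_prod /g big_split.
move=> ->; under eq_bigr do rewrite Rintegral_hermite1M.
have [->|nunu] := eqVneq nu nu'; first by rewrite big1// => j _; rewrite eqxx.
have [j jn] : exists j, tnth nu j != tnth nu' j.
  apply/existsP; apply: contraT; rewrite negb_exists => /forallP h.
  case/eqP : nunu; apply/eq_from_tnth => j; apply/eqP; have := h j.
  by rewrite negbK.
by rewrite (bigD1 j)//= (negbTE jn) mul0r.
Qed.

End TupleProd.

(** * A series over multi-indices *)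

Section PSeries.
Variable R : realType.

(** With a = i + 1 and b = i + 2, ln (a / b) = ln (1 - 1/b) <= -1/b, hence (b / a)^d >= 1 + d / b.
    This discrete form of the integral test makes the series telescope. *)
Lemma powR_telescope (d : R) (i : nat) : 0 < d ->
  i.+2%:R `^ (- (d + 1)) <= d^-1 * (i.+1%:R `^ (- d) - i.+2%:R `^ (- d)).
Proof.
move=> d0; have a0 : 0 < i.+1%:R :> R by rewrite ltr0n.
have b0 : 0 < i.+2%:R :> R by rewrite ltr0n.
set a : R := i.+1%:R in a0 *; set b : R := i.+2%:R in b0 *.
have ab : a / b = 1 + - b^-1.
  have -> : a = b - 1 by rewrite /a /b -[i.+2%:R]natr1 addrK.
  by rewrite mulrBl divff ?gt_eqF// mul1r.
have lnab : b^-1 <= ln b - ln a.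
  have b1 : -1 < - b^-1 by rewrite ltrN2 invf_lt1// ltr1n.
  by have := le_ln1Dx b1; rewrite -ab ln_div ?posrE// => h; rewrite -lerN2 opprB.
have h : b `^ (- d) * (1 + d * b^-1) <= a `^ (- d).
  have -> : a `^ (- d) = b `^ (- d) * expR (d * (ln b - ln a)).
    rewrite /powR !gt_eqF// -expRD; congr expR; ring.
  rewrite ler_wpM2l ?powR_ge0//; apply: le_trans (expR_ge1Dx _).
  by rewrite lerD2l ler_wpM2l// ltW.
rewrite -(@ler_pM2l _ d)// mulrA divff ?gt_eqF// mul1r opprD powRD; last first.
  by rewrite (gt_eqF b0) implybT.
rewrite powR_inv1 ?(ltW b0)//; move: h; rewrite mulrDr mulr1 mulrCA.
move: (b `^ _) (a `^ _) (d * _) => x y z; lra.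
Qed.

Lemma powR_series_bounded (p : R) : 1 < p ->
  exists K, forall B, \sum_(i < B) i.+1%:R `^ (- p) <= K.
Proof.
move=> p1; pose d := p - 1; have d0 : 0 < d by rewrite subr_gt0.
have pd : p = d + 1 by rewrite subrK.
exists (1 + d^-1) => B.
have h b : \sum_(i < b.+1) i.+1%:R `^ (- p) <= 1 + d^-1 * (1 - b.+1%:R `^ (- d)).
  elim: b => [|b ih]; first by rewrite big_ord_recl big_ord0 !powR1 subrr mulr0 !addr0.
  rewrite big_ord_recr /=; have := powR_telescope b d0; rewrite -pd.
  move: ih; rewrite !mulrBr; lra.
case: B => [|B]; first by rewrite big_ord0 addr_ge0// invr_ge0 ltW.
by apply: le_trans (h B) _; rewrite lerD2l ler_piMr ?invr_ge0 ?(ltW d0)//.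
Qed.

(** A finite set of multi-indices lies in a cube with side B, over which the sum of products is the
    n-th power of a one-dimensional sum. *)
Lemma tuple_prod_series_bounded n (p : R) : 1 < p ->
  exists K, forall s : seq (n.-tuple nat), uniq s ->
    \sum_(nu <- s) \prod_(j < n) (tnth nu j).+1%:R `^ (- p) <= K.
Proof.
move=> /powR_series_bounded[K hK]; exists (K ^+ n) => s us.
pose B := (\max_(nu <- s) \max_(j < n) tnth nu j).+1.
have sB nu j : nu \in s -> (tnth nu j < B)%N.
  move=> nus; rewrite ltnS; apply: leq_trans (leq_bigmax_seq _ nus _) => //.
  exact: (leq_bigmax (F := fun j => tnth nu j)).
pose h (nu : n.-tuple nat) : {ffun 'I_n -> 'I_B} := [ffun j => inord (tnth nu j)].
pose g (f : {ffun 'I_n -> 'I_B}) : R := \prod_(j < n) (f j).+1%:R `^ (- p).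
have gh nu : nu \in s -> \prod_(j < n) (tnth nu j).+1%:R `^ (- p) = g (h nu).
  by move=> nus; apply: eq_bigr => j _; rewrite ffunE inordK// sB.
have hinj : {in s &, injective h}.
  move=> nu nu' nus nus' /ffunP e; apply/eq_from_tnth => j; have := e j.
  by rewrite !ffunE => /(congr1 val); rewrite /= !inordK ?sB.
have g0 f : 0 <= g f by apply: prodr_ge0 => j _; exact: powR_ge0.
rewrite big_seq (eq_bigr (g \o h)) => [|nu /gh//]; rewrite -big_seq.
rewrite -(big_map h xpredT g) big_uniq ?map_inj_in_uniq//=.
apply: (@le_trans _ _ (\sum_f g f)).
  by rewrite [leRHS](bigID (mem (map h s)))/= lerDl sumr_ge0.
rewrite /g -(bigA_distr_bigA (fun _ (i : 'I_B) => i.+1%:R `^ (- p))).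
rewrite prodr_const card_ord; apply: lerXn2r; rewrite ?nnegrE ?hK//.
  by apply: sumr_ge0 => i _; exact: powR_ge0.
by apply: le_trans (hK 0%N); rewrite big_ord0.
Qed.

(** For nu nonzero, nu_j + 1 <= 2 |nu| for every j, so (2 |nu|)^(-p n) is at most the product of the
    (nu_j + 1)^(-p). With p = q / n > 1 this bounds |nu|^(-q), at the cost of a factor 2^q. *)
Lemma tuple_sum_series_bounded n (q : R) : n%:R < q ->
  exists K, forall s : seq (n.-tuple nat), uniq s ->
    \sum_(nu <- s | tuple_sum nu != 0%N) (tuple_sum nu)%:R `^ (- q) <= K.
Proof.
move=> nq; pose p : R := if n == 0%N then 2 else q / n%:R.
have q0 : 0 < q by apply: le_lt_trans nq.
(* For n = 0, where q / n is meaningless, any p > 1 serves, as p n = 0. *)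
have [p1 pn] : 1 < p /\ p * n%:R <= q.
  rewrite /p; have [->|n0] := eqVneq n 0%N; first by rewrite mulr0 (ltW q0) ltr1n.
  by rewrite divfK ?pnatr_eq0// ltr_pdivlMr ?mul1r// ltr0n lt0n.
have [K hK] := @tuple_prod_series_bounded n p p1.
exists (2 `^ q * K) => s us.
apply: (@le_trans _ _ (2 `^ q * \sum_(nu <- s) \prod_(j < n) (tnth nu j).+1%:R `^ (- p))).
  rewrite mulr_sumr big_mkcond; apply: ler_sum => nu _; case: ifPn => [nu0|_]; last first.
    by rewrite mulr_ge0 ?powR_ge0//; apply: prodr_ge0 => j _; exact: powR_ge0.
  set t : R := (tuple_sum nu)%:R.
  have t0 : 0 < t by rewrite ltr0n lt0n.
  have t21 : 1 <= 2 * t.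
    by rewrite /t -natrM ler1n muln_gt0/= lt0n.
  have E : t `^ (- q) = 2 `^ q * (2 * t) `^ (- q).
    rewrite powRM ?(ltW t0)// mulrA -powRD ?subrr ?powRr0 ?mul1r//.
    by rewrite pnatr_eq0 implybT.
  rewrite E ler_wpM2l ?powR_ge0//.
  have h1 : (2 * t) `^ (- q) <= (2 * t) `^ (- (p * n%:R)).
    by rewrite ler_powR// lerN2.
  apply: le_trans h1 _.
  have -> : (2 * t) `^ (- (p * n%:R)) = \prod_(j < n) (2 * t) `^ (- p).
    by rewrite prodr_const card_ord -powR_mulrn ?powR_ge0// -powRrM mulNr.
  apply: ler_prod => j _; rewrite powR_ge0/= !powRN lef_pV2 ?posrE ?powR_gt0 ?mulr_gt0//.
  apply: ge0_ler_powR; rewrite ?nnegrE ?(ltW (lt_trans ltr01 p1)) ?mulr_ge0 ?(ltW t0)//.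
  rewrite /t -natrM ler_nat mul2n -addnn -addn1.
  have jt : (tnth nu j <= tuple_sum nu)%N by rewrite /tuple_sum (bigD1 j)//= leq_addr.
  by rewrite leq_add// lt0n.
by rewrite ler_wpM2l ?powR_ge0// hK.
Qed.

End PSeries.

Lemma ler_sum_uniq_subset (R : numDomainType) (I : eqType) (s s' : seq I) (F : I -> R) :
  uniq s -> uniq s' -> {subset s <= s'} -> (forall i, 0 <= F i) ->
  \sum_(i <- s) F i <= \sum_(i <- s') F i.
Proof.
move=> us us' ss' F0.
have /(perm_big _)-> : perm_eq s [seq i <- s' | i \in s].
  apply: uniq_perm => //; first exact: filter_uniq.
  by move=> i; rewrite mem_filter; case: (boolP (i \in s)) => //= /ss' ->.
by rewrite big_filter big_mkcond; apply: ler_sum => i _; case: ifP.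
Qed.

(** * Unordered sums along an enumeration *)

Section Enumeration.
Variables (I : countType) (R : realType).

(** The codes of a countable type may leave gaps in [nat]; [pmap] drops them, so only decodable
    numbers below [N] count. *)
Definition enum_upto N : seq I := pmap (@pickle_inv I) (index_iota 0 N).

Lemma enum_upto_uniq N : uniq (enum_upto N).
Proof. by apply: (pmap_uniq (@pickle_invK I)); exact: iota_uniq. Qed.

Lemma mem_enum_upto N i : (choice.pickle i < N)%N -> i \in enum_upto N.
Proof.
move=> iN; rewrite mem_pmap; apply/mapP; exists (choice.pickle i).
  by rewrite mem_index_iota.
by rewrite pickleK_inv.
Qed.

(** Convergence along finite sets ordered by inclusion thereby becomes convergence along [nat]. *)
Lemma enum_upto_cofinal (s : seq I) :
  exists N0, forall N, (N0 <= N)%N -> {subset s <= enum_upto N}.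
Proof.
exists (\max_(i <- s) (choice.pickle i).+1) => N N0N i si; apply: mem_enum_upto.
apply: leq_trans N0N.
exact: (@leq_bigmax_seq _ s xpredT (fun i => (choice.pickle i).+1) i si isT).
Qed.

Lemma sum_enum_upto (V : zmodType) (G : I -> V) N :
  \sum_(0 <= k < N) oapp G 0 (pickle_inv k) = \sum_(i <- enum_upto N) G i.
Proof.
rewrite /enum_upto; elim: (index_iota 0 N) => [|k s ih]; first by rewrite !big_nil.
by rewrite big_cons ih /=; case: (pickle_inv k) => [i|] /=; rewrite ?big_cons ?add0r.
Qed.

Lemma esum_enum_upto (a : I -> R) : (forall i, 0 <= a i) ->
  (\esum_(i in [set: I]) (a i)%:E < +oo)%E <->
  exists M, forall N, \sum_(i <- enum_upto N) a i <= M.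
Proof.
move=> a0; split=> [afin|[M hM]].
  exists (fine (\esum_(i in [set: I]) (a i)%:E)%E) => N.
  rewrite -lee_fin fineK; last first.
    by rewrite ge0_fin_numE//; apply: esum_ge0 => i _; rewrite lee_fin.
  apply: esum_ge; exists [set` enum_upto N]; first by split=> //; exact: finite_seq.
  by rewrite -fsbig_seq ?enum_upto_uniq// sumEFin.
apply: (@le_lt_trans _ _ M%:E); last exact: ltry.
apply: ub_ereal_sup => _ [X [Xf _] <-]; rewrite fsbig_finite//= sumEFin lee_fin.
have [N /(_ N (leqnn N)) XN] := enum_upto_cofinal (fset_set X).
apply: le_trans (hM N).
by apply: ler_sum_uniq_subset => //; [exact: fset_uniq|exact: enum_upto_uniq].
Qed.

End Enumeration.

(** * Pseudo-multipliers *)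

Section L2Fun.
Context d (T : measurableType d) (R : realType).
Variable mu : {measure set T -> \bar R}.
Local Notation C := R[i].
Local Notation dot := (@L2_dot _ _ R mu).
Implicit Types (u v : L2 mu) (f g : T -> C^o).

Lemma L2_fun_class (f : sqfun mu) : {ae mu, forall x, L2_fun (L2_class f) x = f x}.
Proof. by apply/L2_classP; rewrite L2_classK. Qed.

Lemma L2_fun0 : {ae mu, forall x, L2_fun (0 : L2 mu) x = 0}.
Proof. by apply: filterS (L2_fun_class 0) => x; rewrite L2_class0. Qed.

Lemma L2_funD u v : {ae mu, forall x, L2_fun (u + v) x = u x + v x}.
Proof.
by apply: filterS (L2_fun_class (repr u + repr v)) => x; rewrite L2_classD !L2_classK.
Qed.

Lemma L2_funZ a u : {ae mu, forall x, L2_fun (a *: u) x = a * u x}.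
Proof.
by apply: filterS (L2_fun_class (a *: (repr u : sqfun mu))) => x;
  rewrite L2_classZ L2_classK.
Qed.

Lemma L2_funB u v : {ae mu, forall x, L2_fun (u - v) x = u x - v x}.
Proof.
by apply: filterS (L2_fun_class (repr u - repr v)) => x; rewrite L2_classB !L2_classK.
Qed.

Lemma L2_fun_sum (I : Type) (s : seq I) (c : I -> C) (u : I -> L2 mu) (g : I -> T -> C) :
  (forall i, {ae mu, forall x, u i x = g i x}) ->
  {ae mu, forall x, L2_fun (\sum_(i <- s) c i *: u i) x = \sum_(i <- s) c i * g i x}.
Proof.
move=> ug; elim: s => [|i s ih].
  by rewrite big_nil; apply: filterS L2_fun0 => x ->; rewrite big_nil.
rewrite big_cons; near=> x; rewrite big_cons.
have -> : L2_fun (c i *: u i + \sum_(i <- s) c i *: u i) x =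
    L2_fun (c i *: u i) x + L2_fun (\sum_(i <- s) c i *: u i) x.
  by near: x; exact: L2_funD.
have -> : L2_fun (c i *: u i) x = c i * u i x by near: x; exact: L2_funZ.
have -> : u i x = g i x by near: x; exact: ug.
by congr (_ + _); near: x.
Unshelve. all: by end_near. Qed.

Lemma cmeasurable_L2 u : cmeasurable (u : T -> C^o).
Proof. by have [] := sqfunP (repr u : sqfun mu). Qed.

Lemma L2_dot_ae u v f g : cmeasurable f -> cmeasurable g ->
  {ae mu, forall x, u x = f x} -> {ae mu, forall x, v x = g x} ->
  dot u v = cintegral mu (fun x => f x * (g x)^*).
Proof.
move=> mf mg uf vg; apply: cintegral_ae.
- by apply: cmeasurable_inner; exact: cmeasurable_L2.
- exact: cmeasurable_inner.
near=> x; have -> : u x = f x by near: x.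
by have -> : v x = g x by near: x.
Unshelve. all: by end_near. Qed.

Lemma sqnorm_L2 u : sqnorm mu u = (nsq dot u)%:E.
Proof. by rewrite -[in RHS](L2_classK u) nsq_class sqnorm_fineK. Qed.

Lemma sqnorm_L2_ae u f : cmeasurable f -> {ae mu, forall x, u x = f x} ->
  sqnorm mu f = (nsq dot u)%:E.
Proof.
move=> mf uf; rewrite -sqnorm_L2; apply: sqnorm_ae => //; first exact: cmeasurable_L2.
by apply: filterS uf => x ->.
Qed.

Lemma hnorm_lt_sqnorm u (e : R) : 0 < e ->
  (hnorm dot u < e) = (sqnorm mu u < (e ^+ 2)%:E)%E.
Proof. by move=> e0; rewrite -[u in LHS](L2_classK u) hnorm_class_lt. Qed.

Lemma cmeasurableM f g : cmeasurable f -> cmeasurable g ->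
  cmeasurable ((fun x => f x * g x) : T -> C^o).
Proof.
move=> [fr fi] [gr gi]; split.
  rewrite (_ : (fun x => _) = (fun x => complex.Re (f x) * complex.Re (g x)
    - complex.Im (f x) * complex.Im (g x))).
    by apply: measurable_funB; exact: measurable_funM.
  by apply/funext => x; case: (f x) (g x) => [a b] [a' b'].
rewrite (_ : (fun x => _) = (fun x => complex.Re (f x) * complex.Im (g x)
  + complex.Im (f x) * complex.Re (g x))).
  by apply: measurable_funD; exact: measurable_funM.
by apply/funext => x; case: (f x) (g x) => [a b] [a' b'].
Qed.

Lemma cmeasurableD f g : cmeasurable f -> cmeasurable g ->
  cmeasurable ((fun x => f x + g x) : T -> C^o).
Proof.
move=> [fr fi] [gr gi]; split.
  by under eq_fun do rewrite ReD; exact: measurable_funD.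
by under eq_fun do rewrite ImD; exact: measurable_funD.
Qed.

Lemma cmeasurable_cst (c : C) : cmeasurable ((fun=> c) : T -> C^o).
Proof. by split; exact: measurable_cst. Qed.

Lemma cmeasurableB f g : cmeasurable f -> cmeasurable g ->
  cmeasurable ((fun x => f x - g x) : T -> C^o).
Proof.
move=> mf mg; apply: cmeasurableD => //.
rewrite (_ : (fun x => _) = (fun x => (-1) * g x)).
  by apply: cmeasurableM => //; exact: cmeasurable_cst.
by apply/funext => x; rewrite mulN1r.
Qed.

Lemma cmeasurable_sum (I : Type) (s : seq I) (g : I -> T -> C^o) :
  (forall i, cmeasurable (g i)) ->
  cmeasurable ((fun x => \sum_(i <- s) g i x) : T -> C^o).
Proof.
move=> mg; elim: s => [|i s ih].
  by under eq_fun do rewrite big_nil; exact: cmeasurable_cst.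
by under eq_fun do rewrite big_cons; exact: cmeasurableD.
Qed.

Lemma cmeasurable_real (a : T -> R) : measurable_fun setT a ->
  cmeasurable ((fun x => (a x)%:C) : T -> C^o).
Proof. by move=> ma; split => //=; exact: measurable_cst. Qed.

Lemma cintegral_real (a : T -> R) :
  cintegral mu ((fun x => (a x)%:C) : T -> C^o) = (\int[mu]_x a x)%:C.
Proof.
apply: eq_complex_parts => //=.
by rewrite /Rintegral (eq_integral (cst 0%E)) ?integral0.
Qed.

End L2Fun.

Section PseudoMultiplier.
Variables (R : realType) (n : nat).
Local Notation C := R[i].
Local Notation Rn := (n.-tuple (measurableTypeR R)).
Local Notation mu := (@lebesgue_tuple R n).
Local Notation dot := (@L2_dot _ _ R mu).
Local Notation I := (n.-tuple nat).
Variables (m : Rn -> I -> C) (D : set (L2 mu)) (T : L2 mu -> L2 mu).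
Hypothesis hT : pseudo_multiplier m D T.

Let mm nu : cmeasurable (m ^~ nu). Proof. by case: hT. Qed.

Let mhermite nu : cmeasurable ((fun x => (hermite nu x)%:C) : Rn -> C^o).
Proof. apply: cmeasurable_real; exact: measurable_hermite. Qed.

Definition symbol_term nu (x : Rn) : C := m x nu * (hermite nu x)%:C.

Let msymbol nu : cmeasurable (symbol_term nu : Rn -> C^o).
Proof. exact: cmeasurableM. Qed.

Definition symbol_mass nu : \bar R :=
  (\int[mu]_x (normc (m x nu) ^+ 2 * hermite nu x ^+ 2)%R%:E)%E.

Lemma symbol_massE nu : symbol_mass nu = sqnorm mu (symbol_term nu).
Proof.
by apply: eq_integral => x _; rewrite /symbol_term normcM exprMn sqr_normc_real.
Qed.

Variable phi : I -> L2 mu.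
Hypothesis Dphi : forall nu, D (phi nu).
Hypothesis phiE : forall nu, {ae mu, forall x, phi nu x = (hermite nu x)%:C}.

Lemma fourier_hermiteE f nu : fourier_hermite f nu = dot f (phi nu).
Proof.
rewrite (@L2_dot_ae _ _ _ _ _ _ (f : Rn -> C^o) ((fun x => (hermite nu x)%:C) : Rn -> C^o)) //.
- exact: cmeasurable_L2.
- exact: aeW.
Qed.

Lemma dot_phi nu nu' : dot (phi nu) (phi nu') = (nu == nu')%:R.
Proof.
rewrite (L2_dot_ae (mhermite nu) (mhermite nu')) //.
rewrite [X in cintegral _ X](_ : _ = (fun x => (hermite nu x * hermite nu' x)%:C)).
  by rewrite cintegral_real hermite_orthonormal; case: eqP.
by apply/funext => x; rewrite rmorphM /=; congr (_ * _); exact: conjc_real.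
Qed.

(** Once a finite set contains [nu], orthonormality leaves a single term of the series, the same for
    all such sets; its squared distance to T phi_nu is therefore below every [e]. *)
Lemma T_phi nu : {ae mu, forall x, T (phi nu) x = symbol_term nu x}.
Proof.
have [_ _ _ /(_ _ (Dphi nu)) hs] := hT.
pose g : Rn -> C^o := fun x => symbol_term nu x - T (phi nu) x.
have mg : cmeasurable g.
  by apply: cmeasurableB => //; exact: cmeasurable_L2.
have g0 : sqnorm mu g = 0%E.
  apply/eqP; rewrite eq_le sqnorm_ge0 andbT; apply/lee_addgt0Pr => e e0.
  rewrite add0e; have [s0 hs0] := hs e e0.
  have := hs0 (nu |` s0)%fset (fsubsetUr _ _); move=> /ltW; congr (_ <= _)%E.
  congr sqnorm; apply/funext => x; congr (_ - _).
  rewrite (bigD1_seq nu) ?fset_uniq ?fset1U1//= big1 ?addr0 => [|nu' nn].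
    by rewrite /pm_term fourier_hermiteE dot_phi eqxx mulr1.
  by rewrite /pm_term fourier_hermiteE dot_phi eq_sym (negbTE nn) mulr0 mul0r.
apply: filterS (sqnorm_eq0 mg g0) => x /eqP; rewrite subr_eq0 => /eqP.
by rewrite /g => ->.
Qed.

Lemma symbol_mass_nsq nu : symbol_mass nu = (nsq dot (T (phi nu)))%:E.
Proof. by rewrite symbol_massE; apply: sqnorm_L2_ae (T_phi nu). Qed.

Lemma cintegral_symbol nu :
  cintegral mu (fun x => (m x nu * ((hermite nu x ^+ 2)%:C)%C)%R) =
  dot (T (phi nu)) (phi nu).
Proof.
rewrite (L2_dot_ae (msymbol nu) (mhermite nu) (T_phi nu) (phiE nu)).
congr cintegral; apply/funext => x; rewrite /symbol_term -mulrA; congr (_ * _).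
by rewrite expr2 rmorphM /=; congr (_ * _); symmetry; exact: conjc_real.
Qed.

(* The multi-indices enumerated by [nat]; gaps are filled with 0. *)
Definition hermite_seq (k : nat) : L2 mu := oapp phi 0 (pickle_inv k).

Let D0 : D 0. Proof. by have [_ [? _ _] _ _] := hT. Qed.

Lemma linear_T0 : T 0 = 0.
Proof.
have [_ [_ _ Tl] _ _] := hT; have := Tl 1 0 0 D0 D0.
rewrite !scale1r addr0 => /(congr1 (fun z => z - T 0)).
by rewrite subrr addrK.
Qed.

Lemma hermite_seq_ortho : orthosys dot hermite_seq.
Proof.
have dot0 := dot0l (L2_hilbert mu); have dot0' := dot0r (L2_hilbert mu).
split=> [i j ij|i].
  rewrite /hermite_seq; have := @pickle_invK I i; have := @pickle_invK I j.
  case: (pickle_inv i) => [nu|_ _] /=; last by rewrite dot0.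
  case: (pickle_inv j) => [nu'|_ _] /=; last by rewrite dot0'.
  move=> jE iE; rewrite dot_phi; case: eqP => // nn; move: ij.
  by rewrite -iE -jE nn eqxx.
rewrite /hermite_seq; case: (pickle_inv i) => [nu|] /=; last by left; rewrite /nsq dot0.
by right; rewrite /nsq dot_phi eqxx.
Qed.

Lemma D_hermite_seq k : D (hermite_seq k).
Proof. by rewrite /hermite_seq; case: (pickle_inv k). Qed.

Lemma hermite_seq_sum (V : zmodType) (G : L2 mu -> V) N : G 0 = 0 ->
  \sum_(0 <= k < N) G (hermite_seq k) = \sum_(nu <- enum_upto I N) G (phi nu).
Proof.
move=> G0; rewrite -sum_enum_upto; apply: eq_bigr => k _.
by rewrite /hermite_seq; case: (pickle_inv k).
Qed.

(** The finite sets of enumerated indices eventually contain the set given by [pm_series_to]. The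
    tolerance requested there is e^2, because that definition measures the squared norm. *)
Lemma T_series f : D f -> hcvg dot (psum dot hermite_seq (T \o hermite_seq) 0 ^~ f) (T f).
Proof.
move=> Df; apply/hcvgP => e e0; have [_ _ _ /(_ _ Df) hs] := hT.
have [s0 hs0] := hs _ (exprn_gt0 2 e0).
have [N0 hN0] := enum_upto_cofinal s0.
exists N0 => N NN; rewrite hnorm_lt_sqnorm//.
have s0N : (s0 `<=` [fset nu in enum_upto I N])%fset.
  by apply/fsubsetP => nu nus; rewrite inE; exact: hN0 nus.
apply: le_lt_trans (hs0 _ s0N); rewrite le_eqVlt; apply/orP; left; apply/eqP.
have -> : psum dot hermite_seq (T \o hermite_seq) 0 N f =
    \sum_(nu <- enum_upto I N) dot f (phi nu) *: T (phi nu).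
  rewrite /psum /= (@hermite_seq_sum _ (fun u => dot f u *: T u))//.
  by rewrite linear_T0 scaler0.
rewrite sqnorm_L2; symmetry.
pose G x := \sum_(nu <- enum_upto I N) dot f (phi nu) * symbol_term nu x.
have -> : (fun x => \sum_(nu <- [fset nu in enum_upto I N]%fset) pm_term m f nu x - T f x)
    = (fun x => G x - T f x).
  apply/funext => x; congr (_ - _).
  have pe : perm_eq [fset nu in enum_upto I N]%fset (enum_upto I N).
    apply: uniq_perm; [exact: fset_uniq|exact: enum_upto_uniq|].
    by move=> nu; rewrite inE.
  rewrite (perm_big _ pe) /=.
  apply: eq_bigr => nu _; rewrite /pm_term /symbol_term fourier_hermiteE.
  by rewrite mulrCA mulrA.
apply: sqnorm_L2_ae.
  apply: cmeasurableB; last exact: cmeasurable_L2.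
  apply: cmeasurable_sum => nu; apply: cmeasurableM; last exact: msymbol.
  exact: cmeasurable_cst.
have h := L2_fun_sum (enum_upto I N) (fun nu => dot f (phi nu)) T_phi.
near=> x; rewrite /G.
have -> : L2_fun (\sum_(nu <- enum_upto I N) dot f (phi nu) *: T (phi nu) - T f) x =
  L2_fun (\sum_(nu <- enum_upto I N) dot f (phi nu) *: T (phi nu)) x - T f x.
  by near: x; exact: L2_funB.
by congr (_ - _); near: x.
Unshelve. all: by end_near. Qed.

Let hH := L2_hilbert mu.

Let G_sum (G : L2 mu -> R) : G 0 = 0 -> (forall u, 0 <= G u) ->
  (\esum_(nu in [set: I]) (G (phi nu))%:E < +oo)%E <->
  exists M, forall N, \sum_(0 <= k < N) G (hermite_seq k) <= M.
Proof.
move=> G0 Gge; rewrite (esum_enum_upto (fun nu => Gge (phi nu))).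
by split=> -[M hM]; exists M => N; have := hM N; rewrite hermite_seq_sum.
Qed.

Lemma pseudo_multiplier_schatten_of_sum (r : R) : 0 < r <= 2 ->
  (\esum_(nu in [set: I]) symbol_mass nu `^ (r / 2) < +oo)%E ->
  schatten_class dot r D T.
Proof.
move=> r02; have /andP[r0 _] := r02.
rewrite (eq_esum (b := fun nu => (nsq dot (T (phi nu)) `^ (r / 2))%:E)) => [|nu _]; last first.
  by rewrite symbol_mass_nsq poweR_EFin.
move/(G_sum (G := fun u => nsq dot (T u) `^ (r / 2))) => h.
apply: (schatten_of_sum hH hermite_seq_ortho D_hermite_seq T_series r02); apply: h => [|u].
  by rewrite linear_T0 (nsq0 hH) powR0// gt_eqF// divr_gt0.
exact: powR_ge0.
Qed.

Lemma pseudo_multiplier_schatten2 : schatten_class dot 2 D T <->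
  (\esum_(nu in [set: I]) symbol_mass nu < +oo)%E.
Proof.
split=> [/(schatten2_sum hH hermite_seq_ortho D_hermite_seq) h|h].
  rewrite (eq_esum (b := fun nu => (nsq dot (T (phi nu)))%:E)) => [|nu _]; last first.
    exact: symbol_mass_nsq.
  apply/(G_sum (G := fun u => nsq dot (T u))) => //.
    by rewrite linear_T0 (nsq0 hH).
  by move=> u; exact: nsq_ge0.
apply: pseudo_multiplier_schatten_of_sum; first by rewrite ltr0n lexx.
rewrite (eq_esum (b := symbol_mass)) // => nu _.
by rewrite symbol_mass_nsq poweR_EFin divff// powRr1// nsq_ge0.
Qed.

Lemma pseudo_multiplier_positive_schatten1 : positive_operator dot D T ->
  selfadjoint_operator dot D T ->
  (schatten_class dot 1 D T <->
   (\esum_(nu in [set: I]) (normc (cintegral mu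
      (fun x => (m x nu * ((hermite nu x ^+ 2)%:C)%C)%R)))%:E < +oo)%E).
Proof.
move=> Tp Ts.
rewrite (eq_esum (b := fun nu => (normc (dot (T (phi nu)) (phi nu)))%:E)) => [|nu _]; last first.
  by rewrite cintegral_symbol.
rewrite (G_sum (G := fun u => normc (dot (T u) u))); last first.
- by move=> u; exact: normc_ge0.
- by rewrite (dot0r hH) normc0.
split.
  exact: (positive_schatten1_sum hH hermite_seq_ortho D_hermite_seq Tp Ts).
have [_ DT _ _] := hT.
move=> [M].
exact: (positive_schatten1_of_sum hH hermite_seq_ortho DT D_hermite_seq T_series Tp Ts).
Qed.

Lemma pseudo_multiplier_schatten_of_weighted_sum (r s : R) : 1 < r < 2 ->
  n%:R * (1 / r - 1 / 2) < s ->
  (\esum_(nu in [set: I])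
     ((tuple_sum nu)%:R `^ (2 * s))%R%:E * symbol_mass nu < +oo)%E ->
  schatten_class dot r D T.
Proof.
move=> /andP[r1 r2] rs hs; have r0 : 0 < r by exact: lt_trans r1.
apply: pseudo_multiplier_schatten_of_sum; first by rewrite r0 ltW.
pose a nu := nsq dot (T (phi nu)).
have a0 nu : 0 <= a nu by exact: nsq_ge0.
pose w (nu : I) : R := (tuple_sum nu)%:R `^ (2 * s).
have w0 nu : 0 <= w nu by exact: powR_ge0.
pose p := r / 2; have p0 : 0 < p by rewrite divr_gt0.
have p1 : p < 1 by rewrite ltr_pdivrMr// mul1r.
have p1' : 0 < 1 - p by rewrite subr_gt0.
rewrite (eq_esum (b := fun nu => (w nu * a nu)%:E)) in hs; last first.
  by move=> nu _; rewrite symbol_mass_nsq EFinM.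
have /esum_enum_upto[|M hM] := hs; first by move=> nu; rewrite mulr_ge0.
rewrite (eq_esum (b := fun nu => (a nu `^ p)%:E)) => [|nu _]; last first.
  by rewrite symbol_mass_nsq poweR_EFin.
(* The exponent for which the weights cancel: (w a)^p (t^(-q))^(1 - p) = a^p with w = t^(2 s). After
   multiplication by r, the lower bound on [s] reads n (1 - r / 2) < s r, which is n < q. *)
pose q := 2 * s * p / (1 - p).
have nq : n%:R < q.
  rewrite /q ltr_pdivlMr// /p.
  have -> : 2 * s * (r / 2) = s * r by field.
  have -> : n%:R * (1 - r / 2) = (n%:R * (1 / r - 1 / 2)) * r by field; rewrite gt_eqF.
  by rewrite ltr_pM2r.
have [K hK] := tuple_sum_series_bounded nq.
apply/esum_enum_upto; first by move=> nu; exact: powR_ge0.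
pose nu0 : I := [tuple 0%N | j < n].
(* The zero multi-index has weight 0, so [M] does not control it and its term is kept apart. Young's
   inequality splits all others between the weighted sum, bounded by [M], and the series of
   |nu|^(-q), bounded by [K]. *)
exists (a nu0 `^ p + M + K) => N.
have us := enum_upto_uniq I N.
have sum0 (nu : I) : tuple_sum nu = 0%N -> nu = nu0.
  move/eqP; rewrite /tuple_sum sum_nat_eq0 => /forallP h.
  by apply/eq_from_tnth => j; rewrite tnth_mktuple; exact/eqP/(h j).
apply: (@le_trans _ _ (\sum_(nu <- enum_upto I N) ((nu == nu0)%:R * a nu0 `^ p +
   w nu * a nu + (tuple_sum nu != 0%N)%:R * (tuple_sum nu)%:R `^ (- q)))).
  apply: ler_sum => nu _; have [nz|nz] := eqVneq (tuple_sum nu) 0%N.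
    by rewrite (sum0 _ nz) eqxx mul1r mul0r addr0 lerDl mulr_ge0.
  have t0 : 0 < (tuple_sum nu)%:R :> R by rewrite ltr0n lt0n.
  set t : R := (tuple_sum nu)%:R in t0 *.
  have wp : 0 < w nu by rewrite powR_gt0.
  have E : a nu `^ p = (w nu * a nu) `^ p * (t `^ (- q)) `^ (1 - p).
    rewrite powRM// mulrAC -!powRrM -powRD; last by rewrite (gt_eqF t0) implybT.
    rewrite (_ : _ + _ = 0) ?powRr0 ?mul1r// /q.
    by field; rewrite gt_eqF.
  rewrite E; apply: le_trans (young_powR _ _ _) _; rewrite ?p0 ?mulr_ge0 ?powR_ge0//.
  rewrite mul1r -addrA; apply: le_trans (_ : w nu * a nu + t `^ (- q) <= _).
    rewrite lerD// ler_piMl ?mulr_ge0 ?powR_ge0// ?(ltW p1)//.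
    by rewrite gerBl ltW.
  by rewrite lerDr mulr_ge0 ?powR_ge0.
rewrite !big_split /=; apply: lerD; last first.
  by apply: le_trans (hK _ us); rewrite [leRHS]big_mkcond; apply: ler_sum => nu _;
    case: ifP; rewrite ?mul1r ?mul0r.
apply: lerD; last exact: hM.
rewrite -mulr_suml ler_piMl ?powR_ge0//.
have -> : \sum_(nu <- enum_upto I N) (nu == nu0)%:R = (count_mem nu0 (enum_upto I N))%:R :> R.
  rewrite -sum1_count natr_sum [RHS]big_mkcond; apply: eq_bigr => nu _ /=.
  by case: (nu == nu0).
by rewrite count_uniq_mem//; case: (_ \in _).
Qed.

End PseudoMultiplier.

Close Scope complex_scope.
Unset Implicit Arguments.

Theorem theorem1p1 (R : realType) (n : nat)
    (m : n.-tuple (measurableTypeR R) -> n.-tuple nat -> R[i])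
    (D : set (L2 (@lebesgue_tuple R n)))
    (T : L2 (@lebesgue_tuple R n) -> L2 (@lebesgue_tuple R n))
    (hT : pseudo_multiplier m D T) :
  (schatten_class (@L2_dot _ _ R (@lebesgue_tuple R n)) 2 D T <->
    (\esum_(nu in [set: n.-tuple nat])
       \int[@lebesgue_tuple R n]_x
         (normc (m x nu) ^+ 2 * hermite nu x ^+ 2)%R%:E < +oo)%E) /\
  (positive_operator (@L2_dot _ _ R (@lebesgue_tuple R n)) D T ->
   selfadjoint_operator (@L2_dot _ _ R (@lebesgue_tuple R n)) D T ->
   (schatten_class (@L2_dot _ _ R (@lebesgue_tuple R n)) 1 D T <->
    (\esum_(nu in [set: n.-tuple nat])
       (normc (cintegral (@lebesgue_tuple R n)
         (fun x => m x nu * ((hermite nu x ^+ 2)%:C)%C)%R))%:E < +oo)%E)) /\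
  (forall r : R, 0 < r <= 1 ->
    (\esum_(nu in [set: n.-tuple nat])
       (\int[@lebesgue_tuple R n]_x
         (normc (m x nu) ^+ 2 * hermite nu x ^+ 2)%R%:E) `^ (r / 2) < +oo)%E ->
    schatten_class (@L2_dot _ _ R (@lebesgue_tuple R n)) r D T) /\
  (forall r : R, 1 < r < 2 ->
    (exists2 s : R, n%:R * (1 / r - 1 / 2) < s &
      (\esum_(nu in [set: n.-tuple nat])
         ((tuple_sum nu)%:R `^ (2 * s))%R%:E *
         \int[@lebesgue_tuple R n]_x
           (normc (m x nu) ^+ 2 * hermite nu x ^+ 2)%R%:E < +oo)%E) ->
    schatten_class (@L2_dot _ _ R (@lebesgue_tuple R n)) r D T).
Proof.
have /choice[phi hphi] : forall nu : n.-tuple nat, exists f : L2 (@lebesgue_tuple R n),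
    D f /\ {ae @lebesgue_tuple R n, forall x, f x = ((hermite nu x)%:C)%C}.
  by move=> nu; have [_ _ /(_ nu)[f Df fE] _] := hT; exists f.
have Dphi nu := (hphi nu).1; have phiE nu := (hphi nu).2.
split; first exact: (pseudo_multiplier_schatten2 hT Dphi phiE).
split; first exact: (pseudo_multiplier_positive_schatten1 hT Dphi phiE).
split=> [r /andP[r0 r1]|r r12 [s rs]].
  apply: (pseudo_multiplier_schatten_of_sum hT Dphi phiE).
  by rewrite r0 (le_trans r1)// ler1n.
exact: (pseudo_multiplier_schatten_of_weighted_sum hT Dphi phiE).
Qed.
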